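(* Let $\alpha\in(0,2]$, let $\theta$ be a non-negative integer-valued random variable with $E\theta^3<\infty$, and for $T>0$ let $N^T$ be the empirical process of the particle system described in the context, with $X_T(t)=T^{-1/2}(N^T_t-EN^T_t)$. Let $\Psi=(\psi_t)_{t\ge0}$ be a family of bounded piecewise continuous functions on $\mathbb R$ with compact support. Then, as $T\to\infty$, the real-valued processes $(\langle X_T(1),\psi_t\rangle)_{t\ge 0}$ converge, in the sense of weak convergence of finite dimensional distributions, to the centered Gaussian process $\varrho^\Psi=(\langle X(1),\psi_t\rangle)_{t\ge0}$, whose covariance function is $$E\varrho^\Psi_s\varrho^\Psi_t=E\theta\int_{\mathbb R}\psi_s(x)\psi_t(x)\,dx+(\operatorname{Var}\theta-E\theta)\int_{\mathbb R}\psi_s(x)\,\mathcal T_2\psi_t(x)\,dx,\qquad s,t\ge0 .$$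
   Context: The standard symmetric $\alpha$-stable Lévy process in $\mathbb R$ starts at $0$ and has characteristic function $E e^{iz\vartheta_t}=e^{-t|z|^\alpha}$; $p_t$ is its transition density and $\mathcal T_t\varphi=p_t*\varphi$. Initial configuration $\nu_T$: let $\theta_j$, $j\in\mathbb Z$, be independent copies of $\theta$, and for each $j\in\mathbb Z$ and $k=1,2,\dots$ let $\rho^j_k=(\rho^j_{k,1},\dots,\rho^j_{k,k})$ be a random vector with values in $[j,j+1)^k$. Assume that the families $(\theta_j,(\rho^j_k)_{k=1,2,\dots})$, $j\in\mathbb Z$, are independent. Put $$\nu_T=\sum_{j\in\mathbb Z}\sum_{n=1}^{\theta_j}\delta_{\kappa_{j,n,T}},\qquad \kappa_{j,n,T}=\tfrac1T\rho^j_{\theta_j,n}.$$ At time $0$ the particles are located at the points of $\nu_T$; then they move independently (of each other and of $\nu_T$) according to the standard symmetric $\alpha$-stable Lévy process. $N^T_t(A)$ is the number of particles in $A\subset\mathbb R$ at time $t$, i.e. $\langle N^T_t,\varphi\rangle=\sum_{j\in\mathbb Z}\sum_{n=1}^{\theta_j}\varphi(\kappa_{j,n,T}+\vartheta^{j,n}_t)$ with $\vartheta^{j,n}$ independent standard symmetric $\alpha$-stable Lévy processes, independent of $\nu_T$. $EN^T_t$ is defined by $\langle EN^T_t,\varphi\rangle=E\langle N^T_t,\varphi\rangle$. $X(1)$ is the centered Gaussian $\mathcal S'$-valued random variable ($\mathcal S'$ = tempered distributions on $\mathbb R$, dual of the Schwartz space $\mathcal S$) with $E\langle X(1),\varphi\rangle\langle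 X(1),\psi\rangle=E\theta\int_{\mathbb R}\varphi\psi\,dx+(\operatorname{Var}\theta-E\theta)\int_{\mathbb R}\mathcal T_1\varphi\,\mathcal T_1\psi\,dx$ for $\varphi,\psi\in\mathcal S$; for $\psi$ bounded, piecewise continuous and compactly supported, $\langle X(1),\psi\rangle$ is defined by $L^2$-approximation of $\psi$ by elements of $\mathcal S$. *)

(* Defs.v *)
From HB Require Import structures.
From mathcomp Require Export all_boot all_order all_algebra.
From mathcomp Require Export all_classical all_reals all_analysis.
Export Order.TTheory GRing.Theory Num.Theory.
Export numFieldNormedType.Exports.
Set Implicit Arguments.
Unset Strict Implicit.
Unset Printing Implicit Defensive.

Local Open Scope classical_set_scope.
Local Open Scope ring_scope.

Definition mutual_indep d (Omega : measurableType d) (R : realType)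
    (P : probability Omega R) (I : eqType) (F : I -> set (set Omega)) : Prop :=
  forall (s : seq I) (A : I -> set Omega),
    uniq s -> (forall i, i \in s -> F i (A i)) ->
    P (\big[setI/setT]_(i <- s) A i) = (\prod_(i <- s) P (A i))%E.

Definition sigma_process d (Omega : measurableType d) (R : realType)
    (X : R -> Omega -> R) : set (set Omega) :=
  <<s \bigcup_(t in [set t : R | 0 <= t])
        preimage_set_system setT (X t) measurable >>.

(* Processes are indexed by R; only the times t >= 0 matter. *)
Record levy_process d (Omega : measurableType d) (R : realType)
    (P : probability Omega R) (X : R -> {RV P >-> R}) : Prop := {
  levy_start : {ae P, forall w, X 0 w = 0} ;
  levy_indep : forall t : nat -> R, 0 <= t 0%N ->
    {homo t : m n / (m <= n)%N >-> m <= n} ->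
    mutual_indep P (fun n : nat => preimage_set_system setT
      (fun w => X (t n.+1) w - X (t n) w) (@measurable _ R)) ;
  levy_stationary : forall s t : R, 0 <= s -> 0 <= t ->
    forall A : set R, measurable A ->
    P [set w | A (X (s + t) w - X s w)] = P [set w | A (X t w)] ;
  levy_cadlag : {ae P, forall w, forall t : R, 0 <= t ->
    X u w @[u --> t^'+] --> X t w /\
    (0 < t -> cvg (X u w @[u --> t^'-]))}
}.

(* The last two fields are the real and imaginary parts of
   E exp(i z X_t) = exp(- t |z|^alpha). *)
Record standard_stable_process d (Omega : measurableType d) (R : realType)
    (P : probability Omega R) (alpha : R) (X : R -> {RV P >-> R}) : Prop := {
  stable_levy : levy_process X ;
  stable_cos : forall t z : R, 0 <= t ->
    'E_P[fun w => cos (z * X t w)]%E = (expR (- (t * `|z| `^ alpha)))%:E ;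
  stable_sin : forall t z : R, 0 <= t ->
    'E_P[fun w => sin (z * X t w)]%E = 0%E
}.

Definition transition_density d (Omega : measurableType d) (R : realType)
    (P : probability Omega R) (X : R -> {RV P >-> R}) (p : R -> R -> R) : Prop :=
  forall t : R, 0 < t ->
    [/\ measurable_fun setT (p t),
        forall x, 0 <= p t x
      & forall A : set R, measurable A ->
          distribution P (X t) A
            = (\int[lebesgue_measure]_(x in A) (p t x)%:E)%E].

Definition stable_semigroup (R : realType) (p : R -> R -> R) (t : R) (phi : R -> R)
    (x : R) : R :=
  \int[lebesgue_measure]_y (p t (x - y) * phi y).

(* [theta j] is the number of particles starting in the cell [j/T, (j+1)/T),
  [rho j k] is the random vector rho^j_k, and [vartheta j n] is the motion of
  the n-th particle of cell j.  The particles of a cell, and the coordinates of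
  [rho j k], are numbered from 0. *)

Definition sigma_cell d (Omega : measurableType d) (R : realType)
    (P : probability Omega R) (theta : int -> {RV P >-> nat})
    (rho : int -> forall k : nat, 'I_k -> {RV P >-> R}) (j : int) :
    set (set Omega) :=
  <<s preimage_set_system setT (theta j) measurable `|`
      \bigcup_k \bigcup_(i : 'I_k)
        preimage_set_system setT (rho j k i) measurable >>.

(* The sigma-algebra of the initial configuration.  It is generated by the
   events "cell j contains exactly k particles and the i-th of them is in
   B_i / T, for all i < k", and hence does not depend on T > 0. *)
Definition sigma_config d (Omega : measurableType d) (R : realType)
    (P : probability Omega R) (theta : int -> {RV P >-> nat})
    (rho : int -> forall k : nat, 'I_k -> {RV P >-> R}) : set (set Omega) :=
  <<s [set A | exists (j : int) (k : nat) (B : 'I_k -> set R),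
         (forall i, measurable (B i)) /\
         A = [set w | theta j w = k /\ forall i, B i (rho j k i w)]] >>.

(* The motions are independent of each other and, jointly, of the initial
   configuration, whose index is [None]. *)
Definition independent_motions d (Omega : measurableType d) (R : realType)
    (P : probability Omega R) (theta : int -> {RV P >-> nat})
    (rho : int -> forall k : nat, 'I_k -> {RV P >-> R})
    (vartheta : int -> nat -> R -> {RV P >-> R}) : Prop :=
  mutual_indep P (fun a : option (int * nat) =>
    if a is Some (j, n) then sigma_process (vartheta j n)
    else sigma_config theta rho).

Definition kappa d (Omega : measurableType d) (R : realType)
    (P : probability Omega R) (theta : int -> {RV P >-> nat})
    (rho : int -> forall k : nat, 'I_k -> {RV P >-> R})
    (T : R) (w : Omega) (j : int) (n : 'I_(theta j w)) : R :=
  T^-1 * rho j (theta j w) n w.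

(* The sum of f >= 0 over the positions of the particles at time t. *)
Definition particle_sum d (Omega : measurableType d) (R : realType)
    (P : probability Omega R) (theta : int -> {RV P >-> nat})
    (rho : int -> forall k : nat, 'I_k -> {RV P >-> R})
    (vartheta : int -> nat -> R -> {RV P >-> R})
    (T t : R) (f : R -> R) (w : Omega) : \bar R :=
  \esum_(j in [set: int])
    (\sum_(n < theta j w) f (kappa rho T n + vartheta j n t w))%:E.

(* <N^T_t, phi>; the sum over the infinitely many particles is split into its
   positive and negative parts. *)
Definition pairing_N d (Omega : measurableType d) (R : realType)
    (P : probability Omega R) (theta : int -> {RV P >-> nat})
    (rho : int -> forall k : nat, 'I_k -> {RV P >-> R})
    (vartheta : int -> nat -> R -> {RV P >-> R})
    (T t : R) (phi : R -> R) (w : Omega) : R :=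
  fine (particle_sum theta rho vartheta T t (phi^\+)%R w
        - particle_sum theta rho vartheta T t (phi^\-)%R w)%E.

Definition pairing_XT d (Omega : measurableType d) (R : realType)
    (P : probability Omega R) (theta : int -> {RV P >-> nat})
    (rho : int -> forall k : nat, 'I_k -> {RV P >-> R})
    (vartheta : int -> nat -> R -> {RV P >-> R})
    (T t : R) (phi : R -> R) (w : Omega) : R :=
  (Num.sqrt T)^-1 * (pairing_N theta rho vartheta T t phi w
                     - fine 'E_P[pairing_N theta rho vartheta T t phi]%E).

Definition bounded_real (T : Type) (R : realType) (f : T -> R) : Prop :=
  exists M : R, forall x, `|f x| <= M.

Definition piecewise_continuous (R : realType) (f : R -> R) : Prop :=
  (forall a b : R, exists s : seq R, forall x, a <= x <= b -> x \notin s ->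
     {for x, continuous f}) /\
  (forall x : R, cvg (f y @[y --> x^'-]) /\ cvg (f y @[y --> x^'+])).

Definition compact_support (R : realType) (f : R -> R) : Prop :=
  compact (closure [set x | f x != 0]).

Definition schwartz (R : realType) (phi : R -> R) : Prop :=
  (forall (n : nat) (x : R), derivable (derive1n n phi) x 1) /\
  (forall m n : nat, bounded_real (fun x : R => x ^+ m * derive1n n phi x)).

Definition schwartz_cvg (R : realType) (phi_ : nat -> R -> R) (phi : R -> R) :
    Prop :=
  forall m n : nat, forall e : R, 0 < e ->
    \forall k \near \oo, forall x : R,
      `|x ^+ m * (derive1n n (phi_ k) x - derive1n n phi x)| <= e.

(* Elements of S' are represented by total functions on R -> R, of which only
   the values on Schwartz functions matter.  S is metrizable, so sequential
   continuity is continuity. *)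
Definition tempered (R : realType) (u : (R -> R) -> R) : Prop :=
  (forall (a : R) (phi psi : R -> R), schwartz phi -> schwartz psi ->
     u (fun x => a * phi x + psi x) = a * u phi + u psi) /\
  (forall (phi_ : nat -> R -> R) (phi : R -> R),
     (forall k, schwartz (phi_ k)) -> schwartz phi -> schwartz_cvg phi_ phi ->
     u (phi_ k) @[k --> \oo] --> u phi).

(* Degenerate laws are allowed.  The case s = 0 is separate because
   [normal_prob 0 0] is a junk value, not the Dirac mass at 0. *)
Definition centered_gaussian d (Omega : measurableType d) (R : realType)
    (P : probability Omega R) (X : Omega -> R) : Prop :=
  measurable_fun setT X /\
  exists s : R, forall A : set R, measurable A ->
    P (X @^-1` A) = if s == 0 then dirac (0 : R) A else normal_prob 0 s A.

Definition centered_gaussian_process d (Omega : measurableType d)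
    (R : realType) (P : probability Omega R) (Y : R -> {RV P >-> R}) : Prop :=
  forall (m : nat) (t a : 'I_m -> R), (forall i, 0 <= t i) ->
    centered_gaussian P (fun w => \sum_(i < m) a i * Y (t i) w).

Definition centered_gaussian_tempered d (Omega : measurableType d)
    (R : realType) (P : probability Omega R) (X : Omega -> (R -> R) -> R) :
    Prop :=
  (forall w, tempered (X w)) /\
  (forall phi, schwartz phi -> centered_gaussian P (fun w => X w phi)).

(* Y is a version of <X, psi>, defined as an L^2-limit of <X, phi_k> with
   phi_k in S and phi_k -> psi in L^2. *)
Definition L2_pairing d (Omega : measurableType d) (R : realType)
    (P : probability Omega R) (X : Omega -> (R -> R) -> R) (psi : R -> R)
    (Y : Omega -> R) : Prop :=
  exists phi_ : nat -> R -> R,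
    [/\ forall k, schwartz (phi_ k),
        (\int[lebesgue_measure]_x ((phi_ k x - psi x) ^+ 2)%:E)%E
          @[k --> \oo] --> 0%E
      & 'E_P[fun w => ((X w (phi_ k) - Y w) ^+ 2)%R]%E @[k --> \oo] --> 0%E].

(* Weak convergence of the finite dimensional distributions of Z T, as
   T -> +oo, for processes indexed by [0, +oo). *)
Definition cvg_fdd d (Omega : measurableType d) d' (Omega' : measurableType d')
    (R : realType) (P : probability Omega R) (P' : probability Omega' R)
    (Z : R -> R -> Omega -> R) (Y : R -> Omega' -> R) : Prop :=
  forall (m : nat) (t : 'I_m -> R), (forall i, 0 <= t i) ->
  forall f : 'rV[R]_m -> R, continuous f -> bounded_real f ->
    'E_P[fun w => f (\row_i Z T (t i) w)]%E @[T --> +oo%R]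
      --> 'E_P'[fun w => f (\row_i Y (t i) w)]%E.

(* Main.v *)
(* Let S_j be the sum of phi over the particles which start in the cell
   [j/T, (j+1)/T), for phi bounded, compactly supported and with countably many
   discontinuities.  The S_j are independent, each of them has three moments, and
   <X_T(1), phi> is the sum of the T^(-1/2) (S_j - E S_j).

   Replacing these terms one at a time by Gaussian variables (Lindeberg) shows
   that E cos(<X_T(1), phi> + c) differs from exp(-V_T/2) cos c by O(T^(-1/2)),
   where V_T = T^-1 sum_j Var S_j is the integral of x |-> Var S_[T x].  All the
   particles of the cell of x are within 1/T of x, and G phi (x) = E phi(x + theta_1)
   is continuous because the stable law has a density.  By dominated convergence
   V_T tends to the integral of m1 G(phi^2) + (m2 - m1 - m1^2) (G phi)^2, where m1
   and m2 are the moments of theta, and G preserves the Lebesgue integral.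

   For phi a linear combination of the psi_t, this is the limit of the
   characteristic functions.  On the other side, <X(1), phi> is an L^2-limit of
   centered Gaussian variables, so that it is centered Gaussian with the limiting
   variance.  Together with tightness (Chebyshev) and the uniform approximation of
   continuous functions on boxes by trigonometric polynomials (Bernstein
   polynomials in the variables (1 + sin(a x_i)) / 2), this gives convergence of
   the finite dimensional distributions.

   The symmetry of the stable law and T_1 T_1 = T_2, both read off the
   characteristic function, turn the integral of T_1 psi_s T_1 psi_t into that of
   psi_s T_2 psi_t. *)
Require Import Defs.
From mathcomp Require Import measurable_realfun ring lra.
Set Implicit Arguments.
Unset Strict Implicit.
Unset Printing Implicit Defensive.

Local Open Scope classical_set_scope.
Local Open Scope ring_scope.

(** The displacements may have no second moment, so nothing can be controlled through the distance
    that a particle travels. What replaces it is the probability that a particle from a given place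
    lands in the enlarged support of the test function. By translation invariance this probability
    has a finite Lebesgue integral, and it does not depend on [T]. Moments of a cell sum are bounded
    linearly in it: one factor keeps the indicator of the support, the others are bounded by the
    number of particles. This gives one majorant for the variances, the Lindeberg error, tightness
    and dominated convergence. Since the bounds are also uniform in the number of cells, the
    infinite sum over cells is taken at fixed [T], along an enumeration of the integers, before [T]
    grows. The positions inside a cell may depend on each other and on the count in any way; they
    are frozen by conditioning on the configuration. Characteristic functions are replaced
    throughout by integrals of cosines with an arbitrary phase, which carry the same information in
    real form. *)

Definition indep_systems d (Omega : measurableType d) (R : realType)
    (P : probability Omega R) (G H : set (set Omega)) : Prop :=
  forall A B, G A -> H B -> P (A `&` B) = (P A * P B)%E.

(** * Independence of generated sigma-algebras, and decoupling *)

Section independence.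
Context d (Omega : measurableType d) (R : realType) (P : probability Omega R).
Implicit Types (G H : set (set Omega)).

Lemma indep_systemsC G H : indep_systems P G H -> indep_systems P H G.
Proof. by move=> GH A B HA GB; rewrite setIC muleC GH. Qed.

Lemma sub_indep_systems G H G' H' : G' `<=` G -> H' `<=` H ->
  indep_systems P G H -> indep_systems P G' H'.
Proof. by move=> GG HH GH A B /GG GA /HH HB; exact: GH. Qed.

Lemma sigma_sub_measurable G : G `<=` measurable -> <<s G >> `<=` measurable.
Proof. by move=> Gm; apply: smallest_sub => //; exact: sigma_algebra_measurable. Qed.

(** For fixed [B] in [H], the restriction of [P] to [B] and the multiple of [P] by [P B] are finite
    measures that agree on the pi-system [G], hence on the sigma-algebra that it generates. *)
Lemma indep_sigmal G H : setI_closed G -> G setT ->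
  G `<=` measurable -> H `<=` measurable ->
  indep_systems P G H -> indep_systems P <<s G >> H.
Proof.
move=> GI GT Gm Hm GH A B GA HB.
have mB : measurable B by exact: Hm.
have PBfin : (0 <= fine (P B))%R by rewrite fine_ge0.
pose m1 := mrestr P mB.
pose m2 := mscale (NngNum PBfin) P.
have PBE : (fine (P B))%:E = P B by rewrite fineK// fin_num_measure.
have e A' : m2 A' = (P A' * P B)%E.
  by rewrite /m2 /mscale/= PBE muleC.
transitivity (m2 A); last exact: e.
rewrite -[LHS]/(m1 A).
apply: (@g_sigma_algebra_measure_unique _ _ _ G Gm (fun=> setT) _ _ m1 m2) => //.
- by rewrite bigcup_const//; exists 0%N.
- by move=> A' GA'; exact: etrans (GH _ _ GA' HB) (esym (e A')).
- move=> _; change (P (setT `&` B) < +oo)%E.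
  apply: le_lt_trans (ltry 1); apply: probability_le1; exact: measurableI.
Qed.

Lemma indep_sigma G H : setI_closed G -> setI_closed H -> G setT -> H setT ->
  G `<=` measurable -> H `<=` measurable ->
  indep_systems P G H -> indep_systems P <<s G >> <<s H >>.
Proof.
move=> GI HI GT HT Gm Hm GH.
apply: indep_sigmal => //; first exact: sigma_sub_measurable.
apply: indep_systemsC; apply: indep_sigmal => //; exact: indep_systemsC.
Qed.

(** The union of the families is not closed under intersection; this pi-system generates the same
    sigma-algebra and is the natural domain of [mutual_indep]. *)
Definition cylinders (I : eqType) (F : I -> set (set Omega)) (K : set I) :
    set (set Omega) :=
  [set A | exists (s : seq I) (B : I -> set Omega),
    [/\ uniq s, forall i, i \in s -> K i /\ F i (B i)
      & A = \big[setI/setT]_(i <- s) B i]].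

Lemma bigsetI_seqP (I : eqType) (s : seq I) (B : I -> set Omega) w :
  (\big[setI/setT]_(i <- s) B i) w <-> (forall i, i \in s -> B i w).
Proof.
elim: s => [|i s IH]; first by rewrite big_nil; split.
rewrite big_cons; split=> [[wi /IH ws] j|ws].
  by rewrite inE => /predU1P[->|/ws].
by split; [exact/ws/mem_head|apply/IH => j js; apply: ws; rewrite inE js orbT].
Qed.

Section families.
Variables (I : eqType) (F : I -> set (set Omega)).
Hypothesis Fs : forall i, sigma_algebra setT (F i).
Hypothesis Fm : forall i, F i `<=` measurable.

Lemma family_setT i : F i setT.
Proof.
by have [F0 FC _] := Fs i; rewrite -[setT]setD0; exact: FC.
Qed.

Lemma family_setI i : setI_closed (F i).
Proof. by have /sigma_algebraP[] := Fs i. Qed.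

Lemma cylinders_setT K : cylinders F K setT.
Proof. by exists [::], (fun=> setT); split => //; rewrite big_nil. Qed.

Lemma cylinders_setI K : setI_closed (cylinders F K).
Proof.
move=> _ _ [s1 [B1 [u1 h1 ->]]] [s2 [B2 [u2 h2 ->]]].
(* Padding with [setT] lets both intersections run over one common index list. *)
pose C (s : seq I) (B : I -> set Omega) i := if i \in s then B i else setT.
have FC (s : seq I) B i : (forall i, i \in s -> K i /\ F i (B i)) -> F i (C s B i).
  by rewrite /C; case: ifP => [si /(_ _ si)[]//|_ _]; exact: family_setT.
exists (undup (s1 ++ s2)), (fun i => C s1 B1 i `&` C s2 B2 i).
split; first exact: undup_uniq.
  move=> i; rewrite mem_undup mem_cat => i12; split.
    by case/orP : i12 => [/h1[]|/h2[]].
  by apply: family_setI; exact: FC.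
apply/seteqP; split=> w /=.
  move=> [/bigsetI_seqP w1 /bigsetI_seqP w2]; apply/bigsetI_seqP => i _.
  by rewrite /C; split; case: ifP => // si; [exact: w1|exact: w2].
move=> /bigsetI_seqP w12; split; apply/bigsetI_seqP => i si.
  by have [] := w12 i; rewrite ?mem_undup ?mem_cat ?si// /C si.
by have [] := w12 i; rewrite ?mem_undup ?mem_cat ?si ?orbT// /C si.
Qed.

Lemma cylinders_measurable K : cylinders F K `<=` measurable.
Proof.
move=> _ [s [B [_ h ->]]]; rewrite big_seq.
by apply: bigsetI_measurable => i /h[_ /Fm].
Qed.

Lemma sub_sigma_cylinders K :
  <<s \bigcup_(i in K) F i >> `<=` <<s cylinders F K >>.
Proof.
apply: sub_sigma_algebra2 => A [i Ki FA].
exists [:: i], (fun=> A); split => //; last by rewrite big_seq1.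
by move=> j; rewrite inE => /eqP ->.
Qed.

(** Two cylinders over disjoint index sets concatenate into one cylinder over a duplicate-free list,
    on which [mutual_indep] factors. The passage to the sigma-algebras is [indep_sigma]. *)
Lemma mutual_indep_groups K1 K2 : mutual_indep P F ->
    (forall i, K1 i -> ~ K2 i) ->
  indep_systems P <<s \bigcup_(i in K1) F i >> <<s \bigcup_(i in K2) F i >>.
Proof.
move=> indF K12.
apply: sub_indep_systems; [exact: sub_sigma_cylinders..|].
apply: indep_sigma; [exact: cylinders_setI|exact: cylinders_setI|
  exact: cylinders_setT|exact: cylinders_setT|exact: cylinders_measurable|
  exact: cylinders_measurable|].
move=> _ _ [s1 [B1 [u1 h1 ->]]] [s2 [B2 [u2 h2 ->]]].
rewrite (indF s1)//; last by move=> i /h1[].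
rewrite (indF s2)//; last by move=> i /h2[].
pose B i := if i \in s1 then B1 i else B2 i.
have s12 i : i \in s2 -> i \in s1 = false.
  by move=> /h2[Ki _]; apply/negP => /h1[/K12].
have e1 : \big[setI/setT]_(i <- s1) B1 i = \big[setI/setT]_(i <- s1) B i.
  by rewrite big_seq [RHS]big_seq; apply: eq_bigr => i si; rewrite /B si.
have e2 : \big[setI/setT]_(i <- s2) B2 i = \big[setI/setT]_(i <- s2) B i.
  by rewrite big_seq [RHS]big_seq; apply: eq_bigr => i /s12 si; rewrite /B si.
rewrite e1 e2 -big_cat indF.
- rewrite big_cat/=; congr (_ * _)%E.
    by rewrite big_seq [RHS]big_seq; apply: eq_bigr => i si; rewrite /B si.
  by rewrite big_seq [RHS]big_seq; apply: eq_bigr => i /s12 si; rewrite /B si.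
- rewrite cat_uniq u1 u2 andbT/=; apply/hasPn => i /s12 si.
  by rewrite /= si.
- move=> i; rewrite mem_cat /B; case: ifPn => [/h1[]//|_ /= /h2[]//].
Qed.

End families.
End independence.

Lemma integral_pushforward_measurable (d1 d2 : measure_display) (X : measurableType d1)
    (Y : measurableType d2) (R : realType) (phi : X -> Y)
    (mphi : measurable_fun setT phi) (mu : {measure set X -> \bar R})
    (f : Y -> \bar R) : measurable_fun setT f ->
  (\int[pushforward mu phi]_y f y = \int[mu]_x f (phi x))%E.
Proof.
move=> mf; rewrite [LHS]integralE [RHS]integralE.
congr (_ - _)%E; rewrite ge0_integral_pushforward//.
- rewrite preimage_setT; apply: eq_integral => x _; by rewrite -funepos_comp.
- exact: measurable_funepos.
- rewrite preimage_setT; apply: eq_integral => x _; by rewrite -funeneg_comp.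
- exact: measurable_funeneg.
Qed.

Section decoupling.
Context d (Omega : measurableType d) (R : realType) (P : probability Omega R).
Context d1 (T1 : measurableType d1) d2 (T2 : measurableType d2).
Variables (X : Omega -> T1) (Y : Omega -> T2).
Hypotheses (mX : measurable_fun setT X) (mY : measurable_fun setT Y).
Hypothesis XY : forall A B, measurable A -> measurable B ->
  P (X @^-1` A `&` Y @^-1` B) = (P (X @^-1` A) * P (Y @^-1` B))%E.

Let PX : probability T1 R := distribution P (mfun_Sub (mem_set mX)).
Let PY : probability T2 R := distribution P (mfun_Sub (mem_set mY)).
Let mXY : measurable_fun setT (fun w => (X w, Y w)).
Proof. exact: measurable_fun_pair. Qed.

Let PXY : probability (T1 * T2)%type R := distribution P (mfun_Sub (mem_set mXY)).

Let PXYE A : measurable A -> (PX \x PY)%E A = PXY A.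
Proof.
apply: product_measure_unique => A1 A2 mA1 mA2.
by rewrite -XY.
Qed.

(** The joint law of an independent pair is the product of its marginals, so Fubini allows [Y] to be
    integrated with [X] frozen. Both integrals are written over [P], with a second outcome [w'] as
    the independent copy. *)
Lemma integral_decoupling (f : T1 * T2 -> \bar R) :
  measurable_fun setT f -> P.-integrable setT (fun w => f (X w, Y w)) ->
  (\int[P]_w f (X w, Y w) = \int[P]_w \int[P]_w' f (X w, Y w'))%E.
Proof.
move=> mf intf.
have mfXY : measurable_fun setT (fun w => f (X w, Y w)).
  by have /integrableP[] := intf.
have intfXY : (PX \x PY)%E.-integrable setT f.
  apply/integrableP; split => //.
  rewrite (eq_measure_integral PXY)/=; last by move=> A mA _; apply: PXYE.
  rewrite ge0_integral_pushforward//; last exact: measurableT_comp.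
  by have /integrableP[] := intf.
transitivity (\int[PXY]_z f z)%E.
  by rewrite integral_pushforward_measurable.
transitivity (\int[PX \x PY]_z f z)%E.
  by apply: eq_measure_integral => A mA _; apply/esym/PXYE.
rewrite -integral12_prod_meas1//.
have intF := integrable_fubini_F intfXY.
have mF : measurable_fun setT (fubini_F PY f) by have /integrableP[] := intF.
rewrite integral_pushforward_measurable//.
apply: eq_integral => w _ /=; rewrite /fubini_F.
by rewrite integral_pushforward_measurable//; exact: measurable_fun_pair2.
Qed.

End decoupling.

(** * Taylor bounds for sine and cosine *)

Section trigonometric_bounds.
Variable R : realType.
Implicit Types x y u : R.

(** The intermediate point is located by its distance to [x], so that the order of [x] and [y] does
    not matter. *)
Lemma mean_value (f df : R -> R) x y : (forall u, is_derive u (1 : R) f (df u)) ->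
  exists2 u, `|u - x| <= `|y - x| & f y - f x = df u * (y - x).
Proof.
move=> fdf.
have cf (A : set R) : {within A, continuous f}.
  apply: continuous_subspaceT => u; apply: differentiable_continuous.
  by apply/derivable1_diffP; have [] := fdf u.
have [xy|/ltW yx] := leP x y.
  have [u] := MVT_segment xy (fun u _ => fdf u) (cf _).
  rewrite in_itv/= => /andP[xu uy] ->; exists u => //.
  by rewrite !ger0_norm ?subr_ge0// lerB.
have [u] := MVT_segment yx (fun u _ => fdf u) (cf _).
rewrite in_itv/= => /andP[yu ux] e; exists u.
  by rewrite (distrC u) (distrC y) !ger0_norm ?subr_ge0// lerB.
by rewrite -opprB e -mulrN opprB.
Qed.

Lemma dist_cos x y : `|cos y - cos x| <= `|y - x|.
Proof.
have [u _ ->] := @mean_value cos (fun u => - sin u) x y (@is_derive_cos R).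
by rewrite normrM normrN ler_piMl// sin_max.
Qed.

Lemma dist_sin x y : `|sin y - sin x| <= `|y - x|.
Proof.
have [u _ ->] := @mean_value sin cos x y (@is_derive_sin R).
by rewrite normrM ler_piMl// cos_max.
Qed.

Lemma norm_sin_le x : `|sin x| <= `|x|.
Proof. by have := dist_sin 0 x; rewrite sin0 !subr0. Qed.

(** Here and below each bound follows from an earlier one on the derivative, the mean value theorem
    gaining one power of [x]. The constants are crude; only the exponents matter. *)
Lemma cos_sub1_le x : `|cos x - 1| <= x ^+ 2.
Proof.
have [u] := @mean_value cos (fun u => - sin u) 0 x (@is_derive_cos R).
rewrite !subr0 cos0 => ux ->.
rewrite normrM normrN -normr_id -(real_normK (num_real x)) expr2 normr_id.
by rewrite ler_pM// (le_trans (norm_sin_le u)).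
Qed.

Lemma sin_sub_le3 x : `|sin x - x| <= `|x| ^+ 3.
Proof.
have [u] := @mean_value (sin - id) (cos - cst 1) 0 x
  (fun u => is_deriveB (is_derive_sin u) (is_derive_id u 1)).
rewrite !fctE !subr0 sin0 subr0 => ux ->.
rewrite normrM exprSr ler_pM// (le_trans (cos_sub1_le u))//.
by rewrite -(real_normK (num_real u)) lerXn2r ?nnegrE.
Qed.

Lemma sin_sub_le2 x : `|sin x - x| <= x ^+ 2.
Proof.
have [u] := @mean_value (sin - id) (cos - cst 1) 0 x
  (fun u => is_deriveB (is_derive_sin u) (is_derive_id u 1)).
rewrite !fctE !subr0 sin0 subr0 => ux ->.
rewrite normrM -(real_normK (num_real x)) expr2 ler_pM//.
by rewrite -cos0 (le_trans (dist_cos 0 u))// subr0.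
Qed.

Lemma cos_taylor2_le3 x : `|cos x - (1 - x ^+ 2 / 2)| <= `|x| ^+ 3.
Proof.
pose f u : R := cos u - (1 - u ^+ 2 / 2).
have df u : is_derive u (1 : R) f (u - sin u).
  pose q v : R := 2^-1 *: v ^+ 2.
  have dq : is_derive u (1 : R) q u.
    rewrite /q; apply: is_derive_eq.
    by rewrite /GRing.scale/=; field.
  have fE : f = cos - (cst 1 - q).
    by apply/funext => v; rewrite /f/q !fctE/= /GRing.scale/= mulrC.
  have dF : is_derive u (1 : R) (cos - (cst 1 - q)) (u - sin u).
    by apply: is_derive_eq; rewrite /GRing.scale/=; field.
  by move: dF; rewrite -fE.
have [u] := @mean_value f (fun u => u - sin u) 0 x df.
rewrite {2}/f cos0 expr0n mul0r !subr0 subrr subr0 => ux; rewrite /f => ->.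
rewrite normrM exprSr ler_pM// distrC (le_trans (sin_sub_le2 u))//.
by rewrite -(real_normK (num_real u)) lerXn2r ?nnegrE.
Qed.

End trigonometric_bounds.

(** * Trigonometric polynomials and Bernstein means *)

Section trigonometric_polynomials.
Variables (R : realType) (m : nat).
Implicit Types (x : 'rV[R]_m) (h g : 'rV[R]_m -> R).

(** The triple consists of an amplitude, a frequency vector and a phase. The phase brings sines and
    products of cosines under the same shape, without complex exponentials. *)
Definition frequency_term (e : R * ('I_m -> R) * R) x : R :=
  e.1.1 * cos (\sum_(i < m) e.1.2 i * x ord0 i + e.2).

Definition trig_poly h : Prop :=
  exists s, forall x, h x = \sum_(e <- s) frequency_term e x.

Lemma trig_poly_cst c : trig_poly (fun=> c).
Proof.
exists [:: (c, fun=> 0, 0)] => x.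
rewrite big_seq1 /frequency_term/= big1 ?addr0 ?cos0 ?mulr1//.
by move=> i _; rewrite mul0r.
Qed.

Lemma trig_polyD h g : trig_poly h -> trig_poly g ->
  trig_poly (fun x => h x + g x).
Proof. by move=> [s hs] [t gt]; exists (s ++ t) => x; rewrite big_cat hs gt. Qed.

(** This is the product formula 2 cos a cos b = cos (a + b) + cos (a - b); [sgn] selects one of the
    two terms. *)
Lemma trig_polyM h g : trig_poly h -> trig_poly g ->
  trig_poly (fun x => h x * g x).
Proof.
move=> [s hs] [t gt].
pose prod (e f : R * ('I_m -> R) * R) (sgn : R) : R * ('I_m -> R) * R :=
  (e.1.1 * f.1.1 / 2, fun i => e.1.2 i + sgn * f.1.2 i, e.2 + sgn * f.2).
exists ([seq prod e f 1 | e <- s, f <- t] ++ [seq prod e f (- 1) | e <- s, f <- t]).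
move=> x; rewrite big_cat !big_allpairs_dep/= hs gt mulr_suml -big_split/=.
apply: eq_bigr => e _; rewrite mulr_sumr -big_split/=; apply: eq_bigr => f _.
rewrite /frequency_term/=.
have sumE (sgn : R) : \sum_(i < m) (e.1.2 i + sgn * f.1.2 i) * x ord0 i =
    \sum_(i < m) e.1.2 i * x ord0 i + sgn * \sum_(i < m) f.1.2 i * x ord0 i.
  rewrite mulr_sumr -big_split; apply: eq_bigr => i _.
  by rewrite mulrDl mulrA.
rewrite !sumE; set A := \sum_(i < m) _; set B := \sum_(i < m) _.
have -> : A + 1 * B + (e.2 + 1 * f.2) = (A + e.2) + (B + f.2) by ring.
have -> : A + -1 * B + (e.2 + -1 * f.2) = (A + e.2) - (B + f.2) by ring.
move: (A + e.2) (B + f.2) => a b.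
by rewrite cosB cosD; field.
Qed.

Lemma trig_poly_sin (i : 'I_m) a : trig_poly (fun x => sin (a * x ord0 i)).
Proof.
exists [:: (1, fun j => a * (j == i)%:R, - (pi / 2))] => x.
rewrite big_seq1 /frequency_term/= mul1r (bigD1 i)//= eqxx mulr1 big1 ?addr0.
  by rewrite cosBpihalf.
by move=> j /negbTE ->; rewrite mulr0 mul0r.
Qed.

(* Expectation of [h k] when the counter [k], starting from [k0], is updated by
   one independent coin flip for every coordinate listed in [s]; coordinate [i]
   is incremented with probability [y i].  For [h k = G (k / n)] this is a
   Bernstein polynomial in [y]. *)
Fixpoint coin_mean (s : seq 'I_m) (y : 'I_m -> R) (h : ('I_m -> nat) -> R)
    (k : 'I_m -> nat) : R :=
  if s is i :: s' then
    y i * coin_mean s' y h (fun j => (j == i) + k j)%N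
      + (1 - y i) * coin_mean s' y h k
  else h k.

Lemma coin_mean_cst s y c k : coin_mean s y (fun=> c) k = c.
Proof. by elim: s k => //= i s IH k; rewrite !IH; ring. Qed.

Lemma coin_meanZD s y (h g : ('I_m -> nat) -> R) a k : coin_mean s y (fun l => a * h l + g l) k =
  a * coin_mean s y h k + coin_mean s y g k.
Proof. by elim: s k => //= i s IH k; rewrite !IH; ring. Qed.

Lemma coin_mean_sum (I : Type) (r : seq I) s y (h : I -> ('I_m -> nat) -> R) k :
  coin_mean s y (fun l => \sum_(i <- r) h i l) k =
  \sum_(i <- r) coin_mean s y (h i) k.
Proof.
elim: r => [|i r IH].
  rewrite big_nil -[RHS](coin_mean_cst s y 0 k); congr (coin_mean s y _ k).
  by apply/funext => l; rewrite big_nil.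
rewrite big_cons -IH -[coin_mean s y (h i) k]mul1r -coin_meanZD.
congr (coin_mean s y _ k).
by apply/funext => l; rewrite big_cons mul1r.
Qed.

Section probabilities.
Variable y : 'I_m -> R.
Hypothesis y01 : forall i, 0 <= y i <= 1.

Lemma norm_coin_mean_le s (h g : ('I_m -> nat) -> R) k : (forall l, `|h l| <= g l) ->
  `|coin_mean s y h k| <= coin_mean s y g k.
Proof.
move=> hg; elim: s k => //= i s IH k; have /andP[y0 y1] := y01 i.
rewrite (le_trans (ler_normD _ _))// !normrM.
have y1' : 0 <= 1 - y i by rewrite subr_ge0.
by rewrite (ger0_norm y0) (ger0_norm y1') lerD// ler_wpM2l.
Qed.

(** Binomial variance plus squared bias: coordinate [i] receives [count_mem i s] independent flips.
    This is the input of the Chebyshev estimate for Bernstein polynomials. *)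
Lemma coin_mean_sqr s i a k :
  coin_mean s y (fun l => ((l i)%:R - a) ^+ 2) k =
  (count_mem i s)%:R * (y i * (1 - y i))
    + ((k i)%:R + (count_mem i s)%:R * y i - a) ^+ 2.
Proof.
elim: s k a => [|j s IH] k a /=; first by rewrite mul0r add0r mul0r addr0.
rewrite !IH eq_sym natrD; have [->|ij] := eqVneq i j; first by rewrite !natrD/=; ring.
by rewrite !natrD/=; ring.
Qed.

End probabilities.

Lemma trig_poly_coin_mean s (y : 'I_m -> 'rV[R]_m -> R) (h : ('I_m -> nat) -> R) k :
  (forall i, trig_poly (y i)) ->
  trig_poly (fun x => coin_mean s (y ^~ x) h k).
Proof.
move=> yt; elim: s k => [|i s IH] k /=; first exact: trig_poly_cst.
apply: trig_polyD; apply: trig_polyM => //.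
have -> : (fun x => 1 - y i x) = (fun x => 1 + -1 * y i x).
  by apply/funext => x; rewrite mulN1r.
by apply: trig_polyD; [|apply: trig_polyM => //]; exact: trig_poly_cst.
Qed.

End trigonometric_polynomials.

(** * Uniform approximation on boxes with a global bound *)

Section trigonometric_approximation.
Variables (R : realType) (m : nat).

Lemma row_continuous (c : R -> R) : continuous c ->
  continuous (fun x : 'rV[R]_m => \row_i c (x ord0 i)).
Proof.
move=> cc x.
have FF : Filter ((fun x : 'rV[R]_m => \row_i c (x ord0 i)) @ x) by apply: fmap_filter; exact: nbhs_filter.
apply/cvg_mx_entourageP => A entA.
have near_i (i : 'I_m) :
    nbhs x [set z : 'rV[R]_m | (c (x ord0 i), c (z ord0 i)) \in A].
  have : (fun z : 'rV[R]_m => c (z ord0 i)) @ x --> c (x ord0 i).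
    apply: (@continuous_comp _ _ _ (fun z : 'rV[R]_m => z ord0 i) c); last exact: cc.
    exact: coord_continuous.
  move/cvg_app_entourageP => /(_ A entA); apply: filterS => z ?; exact/mem_set.
have : nbhs x [set z : 'rV[R]_m | forall i : 'I_m, (c (x ord0 i), c (z ord0 i)) \in A].
  have FX : Filter (nbhs x) by exact: nbhs_filter.
  exact: filter_forall near_i.
by apply: filterS => z zA i j; rewrite !mxE.
Qed.

(** Only [t] is confined to [K]: in the application [u] is a grid point of a Bernstein polynomial,
    which may leave the box. *)
Lemma uniform_continuity_compact (G : 'rV[R]_m -> R) (K : set 'rV[R]_m) (e : R) :
  continuous G -> compact K -> 0 < e ->
  exists2 d : R, 0 < d & forall t u : 'rV[R]_m, K t ->
    (forall i, `|t ord0 i - u ord0 i| < d) -> `|G t - G u| <= e.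
Proof.
move=> cG /compact_near_coveringP cK e0.
pose P (d : R) (t : 'rV[R]_m) := forall u : 'rV[R]_m, (forall i, `|t ord0 i - u ord0 i| < d) ->
  `|G t - G u| <= e.
have : \forall d \near 0^'+, K `<=` P d.
  apply: cK => t Kt.
  have e20 : 0 < e / 2 by rewrite divr_gt0.
  have := cG t => /cvgrPdist_le /(_ _ e20) /nbhs_ballP[r /= r0 tr].
  have r20 : 0 < r / 2 by rewrite divr_gt0.
  exists (ball t (r / 2), [set d | 0 < d < r / 2]); first split => /=.
  - exact: nbhsx_ballx.
  - near=> d; apply/andP; split; first by near: d; exact: nbhs_right_gt.
    by near: d; exact: nbhs_right_lt.
  - move=> [t' d] /= [[_ tt'] /andP[d0 dr]] u t'u.
    have Gt' : `|G t - G t'| <= e / 2.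
      apply: tr; split => // i j; rewrite (ord1 i).
      by apply: lt_trans (tt' ord0 j) _; rewrite ltr_pdivrMr// ltr_pMr// ltr1n.
    have Gu : `|G t - G u| <= e / 2.
      apply: tr; split => // i j; rewrite (ord1 i) /ball/=.
      rewrite (splitr r) -(subrK (t' ord0 j) (t ord0 j)) -addrA.
      rewrite (le_lt_trans (ler_normD _ _))// ltrD//; first exact: (tt' ord0 j).
      exact: lt_trans (t'u j) dr.
    rewrite (splitr e) -(subrK (G t) (G t')) -addrA.
    by rewrite (le_trans (ler_normD _ _))// lerD// distrC.
move=> nearP; near (0 : R)^'+ => d; exists d => //.
by move=> t u Kt; apply: (near nearP d).
Unshelve. all: by end_near. Qed.

Lemma trig_poly_approx (f : 'rV[R]_m -> R) (M L e : R) :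
  continuous f -> (forall x, `|f x| <= M) -> 0 < L -> 0 < e ->
  exists h, [/\ trig_poly h, forall x, `|h x| <= M
    & forall x : 'rV[R]_m, (forall i, `|x ord0 i| <= L) -> `|f x - h x| <= e].
Proof.
move=> cf fM L0 e0.
have M0 : 0 <= M by rewrite (le_trans _ (fM 0)).
(* On the box this gives |a x_i| <= 1/2, where sine is inverted by [asin] and (1 + sin (a x_i)) / 2
   stays in [1/4, 3/4]. *)
pose a := (2 * L)^-1.
have a0 : 0 < a by rewrite invr_gt0 mulr_gt0.
(* Clamping keeps the argument of [asin] inside its open interval of continuity, so that the inverse
   [c] of the change of variables is continuous on the whole line. Every value of [G] is then a
   value of [f], whence the global bound [M] on the approximation. *)
pose clamp (t : R) : R := Num.max (4^-1) (Num.min t (3 / 4)).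
have clampP t : 4^-1 <= clamp t <= 3 / 4.
  rewrite /clamp le_max lexx/= ge_max ge_min lexx orbT andbT.
  by rewrite ler_pdivlMr// mulVf// ler1n.
have clampK t : 4^-1 <= t <= 3 / 4 -> clamp t = t.
  by move=> /andP[t1 t2]; rewrite /clamp min_l// max_r.
pose c t := asin (2 * clamp t - 1) / a.
have cclamp : continuous clamp.
  have cmin : continuous (fun t : R => Num.min t (3 / 4) : R^o).
    move=> t; apply: (@continuous_min R R (id : R -> R^o) (cst (3 / 4)) t).
      exact: cvg_id.
    exact: cvg_cst.
  move=> t; apply: (@continuous_max R R (cst 4^-1) (fun t => Num.min t (3 / 4)) t).
    exact: cvg_cst.
  exact: cmin.
have cc : continuous c.
  move=> t; apply: cvgMl; apply: (@continuous_comp _ _ _ (fun t => 2 * clamp t - 1) asin).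
    apply: cvgB; last exact: cvg_cst.
    by apply: cvgMr; exact: cclamp.
  by apply: continuous_asin; have := clampP t; lra.
pose G (t : 'rV[R]_m) := f (\row_i c (t ord0 i)).
have cG : continuous G.
  move=> t; apply: (@continuous_comp _ _ _ (fun t : 'rV[R]_m => \row_i c (t ord0 i)) f).
    exact: row_continuous.
  exact: cf.
pose K := [set t : 'rV[R]_m | forall i, `[4^-1, 3 / 4]%classic (t ord0 i)].
have cK : compact K.
  apply: (@rV_compact R m (fun=> `[4^-1, 3 / 4]%classic)) => i.
  exact: segment_compact.
have e20 : 0 < e / 2 by rewrite divr_gt0.
have [d d0 Gd] := uniform_continuity_compact cG cK e20.
(* With [n] flips per coordinate the Chebyshev term below is at most 2 M m / (d^2 n), which this
   choice makes at most e / 2. *)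
pose n := (Num.truncn (4 * M * m%:R / (d ^+ 2 * e))).+1.
have n0 : 0 < n%:R :> R by rewrite ltr0n.
have nP : 4 * M * m%:R / (d ^+ 2 * e) <= n%:R by rewrite ltW// truncnS_gt.
pose h' (k : 'I_m -> nat) := G (\row_i ((k i)%:R / n%:R)).
pose y (i : 'I_m) (x : 'rV[R]_m) := (1 + sin (a * x ord0 i)) / 2.
have y01 x i : 0 <= y i x <= 1.
  by have := sin_max (a * x ord0 i); rewrite ler_norml /y; lra.
pose s := flatten (nseq n (enum 'I_m)).
have sE i : count_mem i s = n.
  rewrite count_flatten map_nseq sumn_nseq.
  by rewrite count_uniq_mem ?enum_uniq// mem_enum mul1n.
have h'M k : `|h' k| <= M by exact: fM.
exists (fun x => coin_mean s (y ^~ x) h' (fun=> 0%N)); split.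
- apply: trig_poly_coin_mean => i.
  have -> : y i = fun x => (1 + sin (a * x ord0 i)) * 2^-1 by [].
  apply: trig_polyM; last exact: trig_poly_cst.
  by apply: trig_polyD; [exact: trig_poly_cst|exact: trig_poly_sin].
- move=> x; rewrite -(coin_mean_cst s (y ^~ x) M (fun=> 0%N)).
  exact: norm_coin_mean_le.
move=> x xL.
have ax i : `|a * x ord0 i| <= 2^-1.
  rewrite normrM (gtr0_norm a0) /a invfM -mulrA ler_piMr//.
  by rewrite mulrC ler_pdivrMr// mul1r.
have y14 i : 4^-1 <= y i x <= 3 / 4.
  by have := le_trans (norm_sin_le (a * x ord0 i)) (ax i); rewrite /y ler_norml; lra.
have fE : f x = G (\row_i y i x).
  congr f; apply/rowP => i; rewrite !mxE /c clampK//.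
  have -> : 2 * y i x - 1 = sin (a * x ord0 i) by rewrite /y; field.
  rewrite sinK; first by rewrite mulrAC mulfV ?mul1r// gt_eqF.
  by have := ax i; have := pi_ge2 R; rewrite in_itv/= ler_norml; lra.
pose C := 2 * M / (d ^+ 2 * n%:R ^+ 2).
have C0 : 0 <= C.
  by apply: divr_ge0; apply: mulr_ge0 => //; exact: sqr_ge0.
(* If all coordinates of the grid point are within [d] of [y], uniform continuity gives e / 2.
   Otherwise one square is at least (d n)^2, and [C] is chosen so that the first term is then at
   least 2 M. *)
have close k : `|1 * h' k + - f x| <=
    C * (\sum_(i < m) ((k i)%:R - n%:R * y i x) ^+ 2) + e / 2.
  rewrite mul1r distrC fE.
  have [near|] := pselect (forall i : 'I_m, `|y i x - (k i)%:R / n%:R| < d).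
    rewrite ler_wpDl//.
      by rewrite mulr_ge0// sumr_ge0// => i _; rewrite sqr_ge0.
    by apply: Gd => i; rewrite !mxE//=; rewrite in_itv/= y14.
  move=> /existsNP[i /negP]; rewrite -leNgt => far.
  rewrite ler_wpDr ?(ltW e20)//.
  apply: (@le_trans _ _ (2 * M)).
    by rewrite (le_trans (ler_normB _ _))// mulrDl mul1r lerD// fM.
  rewrite (bigD1 i)//= mulrDr ler_wpDr//.
    by rewrite mulr_ge0// sumr_ge0// => j _; rewrite sqr_ge0.
  rewrite /C mulrAC ler_pdivlMr ?mulr_gt0 ?exprn_gt0//.
  rewrite ler_wpM2l ?mulr_ge0// -exprMn -[leRHS]real_normK ?num_real//.
  have dn : d * n%:R <= `|(k i)%:R - n%:R * y i x|.
    have -> : `|(k i)%:R - n%:R * y i x| = `|y i x - (k i)%:R / n%:R| * n%:R.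
      rewrite -[X in _ = _ * X](gtr0_norm n0) -normrM mulrBl divfK ?gt_eqF//.
      by rewrite distrC (mulrC n%:R).
    by rewrite ler_pM2r.
  by apply: lerXn2r => //; rewrite nnegrE ?mulr_ge0 ?ltW.
rewrite distrC -[coin_mean _ _ _ _]mul1r.
have -> : - f x = coin_mean s (y ^~ x) (fun=> - f x) (fun=> 0%N).
  by rewrite coin_mean_cst.
rewrite -coin_meanZD (le_trans (norm_coin_mean_le _ _ _ close))//.
rewrite coin_meanZD coin_mean_sum coin_mean_cst [leRHS](splitr e) lerD2r.
apply: (@le_trans _ _ (C * \sum_(i < m) n%:R)).
  rewrite ler_wpM2l// ler_sum// => i _; rewrite coin_mean_sqr sE add0r subrr expr0n addr0.
  rewrite ler_piMr ?ler0n//; have := y01 x i; nra.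
rewrite sumr_const card_ord -mulr_natr /C.
have d2 : 0 < d ^+ 2 by rewrite exprn_gt0.
rewrite ler_pdivrMr ?mulr_gt0// in nP.
have dn : 0 < d ^+ 2 * n%:R ^+ 2 by rewrite mulr_gt0// exprn_gt0.
rewrite mulrAC ler_pdivrMr//.
have := ler_wpM2r (ltW n0) nP; nra.
Qed.

End trigonometric_approximation.

Lemma measurable_cos (R : realType) : measurable_fun setT (@cos R).
Proof. by apply: continuous_measurable_fun => x; exact: continuous_cos. Qed.

Lemma measurable_sin (R : realType) : measurable_fun setT (@sin R).
Proof. by apply: continuous_measurable_fun => x; exact: continuous_sin. Qed.

(** * Integrals of real-valued functions *)

Section real_integrals.
Context d (T : measurableType d) (R : realType) (mu : {measure set T -> \bar R}).
Implicit Types f g h : T -> R.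

Lemma integrable_le f g : measurable_fun setT f -> (forall x, `|f x| <= g x) ->
  mu.-integrable setT (EFin \o g) -> mu.-integrable setT (EFin \o f).
Proof.
move=> mf fg; apply: le_integrable => //; first exact/measurable_EFinP.
by move=> x _; rewrite /= lee_fin (le_trans (fg x)) // ler_norm.
Qed.

Lemma ae_dominated_cvg_Rintegral (f_ : nat -> T -> R) f g :
  (forall n, measurable_fun setT (f_ n)) -> measurable_fun setT f ->
  {ae mu, forall x, f_ n x @[n --> \oo] --> f x} ->
  mu.-integrable setT (EFin \o g) -> (forall n x, `|f_ n x| <= g x) ->
  (\int[mu]_x f_ n x)%R @[n --> \oo] --> (\int[mu]_x f x)%R.
Proof.
move=> mf_ mf f_f intg f_g; apply: fine_cvg.
have mf_E n : measurable_fun setT (EFin \o f_ n) by exact/measurable_EFinP.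
have mfE : measurable_fun setT (EFin \o f) by exact/measurable_EFinP.
have f_fE : {ae mu, forall x, setT x -> (EFin \o f_ n) x @[n --> \oo] --> (EFin \o f) x}.
  by apply: filterS f_f => x fx _; apply: cvg_EFin => //; exact: nearW.
have f_gE : {ae mu, forall x n, setT x -> (`|(EFin \o f_ n) x| <= (EFin \o g) x)%E}.
  by apply: aeW => x n _ /=; rewrite lee_fin.
have [intf _] := dominated_convergence measurableT mf_E mfE f_fE intg f_gE.
by rewrite fineK//; exact: integrable_fin_num.
Qed.

Lemma dominated_cvg_Rintegral (f_ : nat -> T -> R) f g :
  (forall n, measurable_fun setT (f_ n)) ->
  (forall x, f_ n x @[n --> \oo] --> f x) ->
  mu.-integrable setT (EFin \o g) -> (forall n x, `|f_ n x| <= g x) ->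
  (\int[mu]_x f_ n x)%R @[n --> \oo] --> (\int[mu]_x f x)%R.
Proof.
move=> mf_ f_f; apply: ae_dominated_cvg_Rintegral => //; last exact: aeW.
by apply: (@measurable_fun_cvg _ _ _ _ f_) => // x _; exact: f_f.
Qed.

Lemma EFin_Rintegral f : mu.-integrable setT (EFin \o f) ->
  ((\int[mu]_x f x)%R)%:E = (\int[mu]_x (f x)%:E)%E.
Proof. by move=> intf; rewrite /Rintegral fineK//; exact: integrable_fin_num. Qed.

Lemma integrableD_real f g : mu.-integrable setT (EFin \o f) ->
  mu.-integrable setT (EFin \o g) ->
  mu.-integrable setT (EFin \o (fun x => f x + g x)).
Proof. by move=> intf intg; exact: (integrableD measurableT intf intg). Qed.

Lemma integrableZ_real c f : mu.-integrable setT (EFin \o f) ->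
  mu.-integrable setT (EFin \o (fun x => c * f x)).
Proof. by move=> intf; exact: (integrableZl measurableT c intf). Qed.

Lemma integrableB_real f g : mu.-integrable setT (EFin \o f) ->
  mu.-integrable setT (EFin \o g) ->
  mu.-integrable setT (EFin \o (fun x => f x - g x)).
Proof. by move=> intf intg; exact: (integrableB measurableT intf intg). Qed.

Lemma integrable_norm_real f : mu.-integrable setT (EFin \o f) ->
  mu.-integrable setT (EFin \o (fun x => `|f x|)).
Proof. by move=> intf; exact: (integrable_abse intf). Qed.

Lemma integrable_sum_real (I : Type) (s : seq I) (f : I -> T -> R) :
  (forall i, mu.-integrable setT (EFin \o f i)) ->
  mu.-integrable setT (EFin \o (fun x => \sum_(i <- s) f i x)).
Proof.
move=> intf; elim: s => [|i s IH].
  have -> : (fun x => \sum_(i <- [::]) f i x) = cst 0.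
    by apply/funext => x; rewrite big_nil.
  exact: integrable0.
have -> : (fun x => \sum_(j <- i :: s) f j x) = fun x => f i x + \sum_(j <- s) f j x.
  by apply/funext => x; rewrite big_cons.
exact: integrableD_real.
Qed.

Lemma Rintegral_sum (I : Type) (s : seq I) (f : I -> T -> R) :
  (forall i, mu.-integrable setT (EFin \o f i)) ->
  (\int[mu]_x (\sum_(i <- s) f i x) = \sum_(i <- s) \int[mu]_x f i x)%R.
Proof.
move=> intf; elim: s => [|i s IH].
  rewrite big_nil -[RHS](Rintegral_set0 mu (fun=> 0)) /Rintegral.
  by rewrite !integral0_eq// => x _; rewrite big_nil.
rewrite big_cons -IH -RintegralD//; last exact: integrable_sum_real.
by apply: eq_Rintegral => x _; rewrite big_cons.
Qed.

End real_integrals.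

Section probability_integrals.
Context d (T : measurableType d) (R : realType) (P : probability T R).
Implicit Types f g h : T -> R.

Lemma integrable_cst_probability (c : R) : P.-integrable setT (EFin \o cst c).
Proof. by apply: finite_measure_integrable_cst. Qed.

Lemma bounded_integrable_probability f M : measurable_fun setT f ->
  (forall x, `|f x| <= M) -> P.-integrable setT (EFin \o f).
Proof.
by move=> mf fM; apply: (integrable_le mf fM); exact: integrable_cst_probability.
Qed.

Lemma Rintegral_cst_probability (c : R) : (\int[P]_x c = c)%R.
Proof.
by rewrite Rintegral_cst//= probability_setT/= mulr1.
Qed.

Lemma bounded_cvg_Rintegral (f_ : nat -> T -> R) f M :
  (forall n, measurable_fun setT (f_ n)) ->
  (forall x, f_ n x @[n --> \oo] --> f x) -> (forall n x, `|f_ n x| <= M) ->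
  (\int[P]_x f_ n x)%R @[n --> \oo] --> (\int[P]_x f x)%R.
Proof.
move=> mf_ f_f f_M; apply: (@dominated_cvg_Rintegral _ _ _ P f_ f (cst M)) => //.
exact: integrable_cst_probability.
Qed.

Lemma expectation_Rintegral f : P.-integrable setT (EFin \o f) ->
  'E_P[f]%E = ((\int[P]_x f x)%R)%:E.
Proof. by move=> intf; rewrite unlock EFin_Rintegral. Qed.

Lemma tail_cvg0 f : measurable_fun setT f -> forall e, 0 < e ->
  exists2 L, 0 < L & (P [set w | (L < `|f w|)%R] <= e%:E)%E.
Proof.
move=> mf e e0.
pose A (n : nat) := [set w | (n.+1%:R < `|f w|)%R].
have mA n : measurable (A n).
  rewrite /A -[X in measurable X]setTI.
  apply: (measurable_fun_ltr (f := cst n.+1%:R)) => //.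
  exact: measurableT_comp.
have : P (A n) @[n --> \oo] --> P (\bigcap_n A n).
  apply: nonincreasing_cvg_mu => //.
  - by rewrite (le_lt_trans (probability_le1 P (mA 0%N))) ?ltry.
  - exact: bigcap_measurable.
  - move=> m n mn; rewrite subsetEset => w /=; apply: le_lt_trans.
    by rewrite ler_nat ltnS.
have -> : \bigcap_n A n = set0.
  apply/seteqP; split => // w /(_ (Num.truncn `|f w|) I) /=.
  by rewrite /A/= ltNge ltW// truncnS_gt.
rewrite measure0 => /fine_cvgP[_ /cvgr0_norm_lt /(_ _ e0)[N _ /(_ N (leqnn N))]] /= H.
exists N.+1%:R => //.
have Pfin := fin_num_measure P _ (mA N).
by rewrite -(fineK Pfin) lee_fin ltW// (le_lt_trans _ H)// ler_norm.
Qed.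

End probability_integrals.

(** * Weak convergence from integrals of cosines *)

Section weak_convergence.
Variables (R : realType) (m : nat).

Lemma measurable_trig_poly d (T : measurableType d) (Z : 'I_m -> T -> R)
    (h : 'rV[R]_m -> R) : (forall i, measurable_fun setT (Z i)) -> trig_poly h ->
  measurable_fun setT (fun w => h (\row_i Z i w)).
Proof.
move=> mZ [s hs].
have -> : (fun w => h (\row_i Z i w)) = fun w => \sum_(e <- s) e.1.1 *
    cos (\sum_(i < m) e.1.2 i * Z i w + e.2).
  apply/funext => w; rewrite hs; apply: eq_bigr => e _.
  congr (_ * cos (_ + _)); apply: eq_bigr => i _; by rewrite mxE.
apply: measurable_sum => e; apply: measurable_funM => //.
apply: measurableT_comp; first exact: measurable_cos.
apply: measurable_funD => //; apply: measurable_sum => i.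
exact: measurable_funM.
Qed.

(** A bounded continuous function is the pointwise limit of trigonometric polynomials that
    approximate it on growing boxes, so its measurability reduces to that of cosines. *)
Lemma measurable_continuous_row d (T : measurableType d) (Z : 'I_m -> T -> R)
    (f : 'rV[R]_m -> R) : (forall i, measurable_fun setT (Z i)) ->
  continuous f -> bounded_real f ->
  measurable_fun setT (fun w => f (\row_i Z i w)).
Proof.
move=> mZ cf [M fM].
have /choice[h hP] k : exists h, [/\ trig_poly h, forall x, `|h x| <= M
    & forall x : 'rV[R]_m, (forall i, `|x ord0 i| <= k.+1%:R) ->
      `|f x - h x| <= k.+1%:R^-1].
  by apply: trig_poly_approx => //; rewrite ?invr_gt0.
apply: (@measurable_fun_cvg _ _ _ _ (fun k w => h k (\row_i Z i w))).
  by move=> k; apply: measurable_trig_poly => //; case: (hP k).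
move=> w _; apply/cvgrPdist_le => e e0.
pose B := \sum_(i < m) `|Z i w|.
near=> k; have [_ _ /(_ (\row_i Z i w)) H] := hP k.
apply: le_trans (H _) _.
  move=> i; rewrite mxE (@le_trans _ _ B)//.
    by rewrite /B (bigD1 i)//= lerDl sumr_ge0.
  rewrite ltW// (lt_le_trans (truncnS_gt B))// ler_nat ltnS.
  near: k; exact: nbhs_infty_ge.
rewrite ltW//; near: k; exact: (near_infty_natSinv_lt (PosNum e0)).
Unshelve. all: by end_near. Qed.

End weak_convergence.

Section weak_convergence.
Variables (R : realType) (m : nat).
Context d (T : measurableType d) (P : probability T R).

Lemma Rintegral_trig_polyE (Z : 'I_m -> T -> R) s :
  (forall i, measurable_fun setT (Z i)) ->
  \int[P]_w (\sum_(e <- s) frequency_term e (\row_i Z i w)) =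
  \sum_(e <- s) e.1.1 * \int[P]_w cos (\sum_(i < m) e.1.2 i * Z i w + e.2).
Proof.
move=> mZ.
have intc (e : R * ('I_m -> R) * R) : P.-integrable setT
    (EFin \o (fun w => cos (\sum_(i < m) e.1.2 i * Z i w + e.2))).
  apply: (@bounded_integrable_probability _ _ _ _ _ 1).
    apply: measurableT_comp; first exact: measurable_cos.
    apply: measurable_funD => //; apply: measurable_sum => i.
    exact: measurable_funM.
  by move=> x; exact: cos_max.
transitivity (\sum_(e <- s) \int[P]_w (e.1.1 *
    cos (\sum_(i < m) e.1.2 i * Z i w + e.2))); last first.
  by apply: eq_bigr => e _; rewrite RintegralZl.
rewrite -Rintegral_sum; last by move=> e; exact: integrableZ_real.
apply: eq_Rintegral => w _; apply: eq_bigr => e _.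
congr (_ * cos (_ + _)); apply: eq_bigr => i _; by rewrite mxE.
Qed.

(** On the box the difference is at most [e]. Off the box it is at most 2 M, and by the union bound
    this has probability at most m q. *)
Lemma Rintegral_close_on_box (Z : 'I_m -> T -> R) (f h : 'rV[R]_m -> R)
    (M L e : R) (q : R) :
  (forall i, measurable_fun setT (Z i)) -> continuous f -> trig_poly h ->
  (forall x, `|f x| <= M) -> (forall x, `|h x| <= M) ->
  (forall x : 'rV[R]_m, (forall i, `|x ord0 i| <= L) -> `|f x - h x| <= e) ->
  0 <= e -> (forall i, P [set w | (L < `|Z i w|)%R] <= q%:E)%E ->
  `|\int[P]_w f (\row_i Z i w) - \int[P]_w h (\row_i Z i w)| <= e + 2 * M * (m%:R * q).
Proof.
move=> mZ cf ht fM hM fh e0 Zq.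
have M0 : 0 <= M by rewrite (le_trans _ (fM 0)).
have mfZ : measurable_fun setT (fun w => f (\row_i Z i w)).
  by apply: measurable_continuous_row => //; exists M.
have mhZ := measurable_trig_poly mZ ht.
have intf := bounded_integrable_probability P mfZ (fun w => fM (\row_i Z i w)).
have inth := bounded_integrable_probability P mhZ (fun w => hM (\row_i Z i w)).
pose A i := [set w | (L < `|Z i w|)%R].
have mA i : measurable (A i).
  rewrite /A -[X in measurable X]setTI.
  apply: (measurable_fun_ltr (f := cst L)) => //.
  exact: measurableT_comp.
have intA i : P.-integrable setT (EFin \o (\1_(A i) : T -> R)).
  apply: (@bounded_integrable_probability _ _ _ _ _ 1) => //.
  by move=> x; rewrite indicE; case: (_ \in _); rewrite ?normr1 ?normr0.
rewrite -RintegralB//.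
apply: (le_trans (le_normr_Rintegral measurableT (integrableB_real intf inth))).
apply: (@le_trans _ _ (\int[P]_w (e + 2 * M * \sum_(i < m) \1_(A i) w))).
  apply: le_Rintegral => //.
  - exact/integrable_norm_real/integrableB_real.
  - apply: integrableD_real; first exact: integrable_cst_probability.
    by apply: integrableZ_real; exact: integrable_sum_real.
  - move=> w _.
    have [near|] := pselect (forall i : 'I_m, `|Z i w| <= L).
      rewrite ler_wpDr//.
        by rewrite mulr_ge0 ?mulr_ge0// sumr_ge0// => i _; rewrite indicE.
      by apply: fh => i; rewrite mxE.
    move=> /existsNP[i /negP]; rewrite -ltNge => far.
    rewrite ler_wpDl//.
    apply: (@le_trans _ _ (2 * M)).
      by rewrite (le_trans (ler_normB _ _))// mulrDl mul1r lerD.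
    rewrite ler_peMr ?mulr_ge0// (bigD1 i)//= indicE mem_set//=.
    by rewrite lerDl sumr_ge0// => j _; rewrite indicE.
rewrite RintegralD//; last 2 first.
  exact: integrable_cst_probability.
  by apply: integrableZ_real; exact: integrable_sum_real.
rewrite Rintegral_cst_probability lerD2l RintegralZl//; last exact: integrable_sum_real.
rewrite ler_wpM2l ?mulr_ge0// Rintegral_sum//.
rewrite mulr_natl -[m in leRHS]card_ord -sumr_const ler_sum// => i _.
rewrite -lee_fin EFin_Rintegral// integral_indic// setIT.
exact: Zq.
Qed.

Lemma tail_le (f : T -> R) (L L' : R) : measurable_fun setT f -> L <= L' ->
  (P [set w | (L' < `|f w|)%R] <= P [set w | (L < `|f w|)%R])%E.
Proof.
move=> mf LL'; apply: le_measure; rewrite ?inE.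
- rewrite -[X in measurable X]setTI.
  by apply: (measurable_fun_ltr (f := cst L')) => //; exact: measurableT_comp.
- rewrite -[X in measurable X]setTI.
  by apply: (measurable_fun_ltr (f := cst L)) => //; exact: measurableT_comp.
- by move=> w /=; exact: le_lt_trans.
Qed.

Lemma tight_finite (Z : 'I_m -> T -> R) : (forall i, measurable_fun setT (Z i)) ->
  forall e, 0 < e -> exists2 L, 0 < L &
    forall i, (P [set w | (L < `|Z i w|)%R] <= e%:E)%E.
Proof.
move=> mZ e e0.
have /choice[L LP] i : exists L, 0 < L /\ (P [set w | (L < `|Z i w|)%R] <= e%:E)%E.
  by have [L L0 LP] := tail_cvg0 P (mZ i) e0; exists L.
exists (1 + \sum_(i < m) L i).
  by rewrite ltr_wpDr// sumr_ge0// => i _; rewrite ltW// (LP i).1.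
move=> i; apply: le_trans (LP i).2; apply: tail_le => //.
rewrite (bigD1 i)//= ler_wpDl// lerDl sumr_ge0// => j _.
by rewrite ltW// (LP j).1.
Qed.

End weak_convergence.

Section weak_convergence_criterion.
Variables (R : realType) (m : nat).
Context d (T : measurableType d) (P : probability T R).
Context d' (T' : measurableType d') (P' : probability T' R).

Lemma weak_cvg_of_cos (Z : nat -> 'I_m -> T -> R) (Y : 'I_m -> T' -> R) :
  (forall k i, measurable_fun setT (Z k i)) ->
  (forall i, measurable_fun setT (Y i)) ->
  (forall e, 0 < e -> exists2 L, 0 < L &
    forall k i, (P [set w | (L < `|Z k i w|)%R] <= e%:E)%E) ->
  (forall (b : 'I_m -> R) c,
    (\int[P]_w cos (\sum_(i < m) b i * Z k i w + c))%R @[k --> \oo] -->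
    (\int[P']_w cos (\sum_(i < m) b i * Y i w + c))%R) ->
  forall f : 'rV[R]_m -> R, continuous f -> bounded_real f ->
  (\int[P]_w f (\row_i Z k i w))%R @[k --> \oo] -->
  (\int[P']_w f (\row_i Y i w))%R.
Proof.
move=> mZ mY tZ ZY f cf [M0 fM0]; apply/cvgrPdist_le => e e0.
pose M := Num.max 1 M0.
have M1 : 1 <= M by rewrite le_max lexx.
have fM x : `|f x| <= M by rewrite (le_trans (fM0 x))// le_max lexx orbT.
(* The tails then cost at most e / 8. With another e / 8 for the approximation on the box, each of
   the two expectations moves by e / 4, which leaves e / 2 for the convergence of the cosine
   integrals. The successor [m.+1] keeps [q] positive when [m] is 0. *)
pose q := e / (16 * M * m.+1%:R).
have Mm0 : 0 < 16 * M * m.+1%:R by rewrite !mulr_gt0// (lt_le_trans ltr01).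
have q0 : 0 < q by rewrite divr_gt0.
have mq : 2 * M * (m%:R * q) <= e / 8.
  rewrite /q mulrCA mulrA mulrA ler_pdivrMr// -natr1.
  have := ler0n R m; nra.
have [L1 L10 ZL] := tZ _ q0.
have [L2 L20 YL] := tight_finite P' mY q0.
have e80 : 0 < e / 8 by rewrite divr_gt0.
have L0 : 0 < Num.max L1 L2 by rewrite lt_max L10.
have [h [ht hM fh]] := trig_poly_approx cf fM L0 e80.
have ZL' k i : (P [set w | (Num.max L1 L2 < `|Z k i w|)%R] <= q%:E)%E.
  by apply: le_trans (ZL k i); apply: tail_le => //; rewrite le_max lexx.
have YL' i : (P' [set w | (Num.max L1 L2 < `|Y i w|)%R] <= q%:E)%E.
  by apply: le_trans (YL i); apply: tail_le => //; rewrite le_max lexx orbT.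
have cZ k := Rintegral_close_on_box (mZ k) cf ht fM hM fh (ltW e80) (ZL' k).
have cY := Rintegral_close_on_box mY cf ht fM hM fh (ltW e80) YL'.
have hZY : (\int[P]_w h (\row_i Z k i w))%R @[k --> \oo] -->
    (\int[P']_w h (\row_i Y i w))%R.
  have [s hs] := ht.
  have -> : (fun k => \int[P]_w h (\row_i Z k i w)) =
      (fun k => \sum_(t <- s) t.1.1 *
        \int[P]_w cos (\sum_(i < m) t.1.2 i * Z k i w + t.2)).
    apply/funext => k; rewrite -Rintegral_trig_polyE//.
    by apply: eq_Rintegral => w _; rewrite hs.
  have -> : \int[P']_w h (\row_i Y i w) = \sum_(t <- s) t.1.1 *
        \int[P']_w cos (\sum_(i < m) t.1.2 i * Y i w + t.2).
    rewrite -Rintegral_trig_polyE//.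
    by apply: eq_Rintegral => w _; rewrite hs.
  apply: cvg_big => [|t _]; first exact: add_continuous.
  by apply: cvgMr; exact: ZY.
have e20 : 0 < e / 2 by rewrite divr_gt0.
move/cvgrPdist_le : hZY => /(_ _ e20); apply: filterS => k hk.
move: (cZ k) cY hk mq; rewrite !ler_norml; lra.
Qed.

End weak_convergence_criterion.

(** * Integrals of cosines determine the law *)

Section law_uniqueness.
Variable R : realType.
Context d (T : measurableType d) (P : probability T R).
Context d' (T' : measurableType d') (P' : probability T' R).
Variables (X : T -> R) (Y : T' -> R).
Hypotheses (mX : measurable_fun setT X) (mY : measurable_fun setT Y).
Hypothesis XYcos : forall z c,
  (\int[P]_w cos (z * X w + c))%R = (\int[P']_w cos (z * Y w + c))%R.

(** Uniqueness is the convergence criterion for a constant sequence in dimension one, followed by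
    uniqueness of limits. *)
Lemma Rintegral_continuous_of_cos (g : R -> R) : continuous g -> bounded_real g ->
  (\int[P]_w g (X w))%R = (\int[P']_w g (Y w))%R.
Proof.
move=> cg [M gM].
pose f (x : 'rV[R]_1) := g (x ord0 ord0).
have cf : continuous f.
  move=> x; apply: (@continuous_comp _ _ _ (fun x : 'rV[R]_1 => x ord0 ord0) g).
    exact: coord_continuous.
  exact: cg.
have := @weak_cvg_of_cos R 1 _ _ P _ _ P' (fun _ _ => X) (fun _ => Y)
  (fun _ _ => mX) (fun _ => mY) _ _ f cf.
have -> : (fun k : nat => (\int[P]_w f (\row_(i < 1) X w))%R) =
    fun=> (\int[P]_w g (X w))%R.
  by apply/funext => k; apply: eq_Rintegral => w _; rewrite /f mxE.
have -> : (\int[P']_w f (\row_(i < 1) Y w) = \int[P']_w g (Y w))%R.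
  by apply: eq_Rintegral => w _; rewrite /f mxE.
move=> H.
have {}H : (\int[P]_w g (X w))%R @[_ --> \oo] --> (\int[P']_w g (Y w))%R.
  apply: H; [|move=> b c|by exists M => x; exact: gM].
  move=> e e0; have [L L0 LX] := tail_cvg0 P mX e0.
    by exists L.
  have -> : (fun k : nat => (\int[P]_w cos (\sum_(i < 1) b i * X w + c))%R) =
    fun=> (\int[P']_w cos (\sum_(i < 1) b i * Y w + c))%R.
    apply/funext => k; transitivity (\int[P]_w cos (b ord0 * X w + c))%R.
      by apply: eq_Rintegral => w _; rewrite big_ord1.
    by rewrite XYcos; apply: eq_Rintegral => w _; rewrite big_ord1.
  exact: cvg_cst.
by rewrite -(cvg_lim (@Rhausdorff R) H); apply/esym/(cvg_lim (@Rhausdorff R)); exact: cvg_cst.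
Qed.

Lemma law_of_cos A : measurable A -> P (X @^-1` A) = P' (Y @^-1` A).
Proof.
pose PX : probability R R := distribution P (mfun_Sub (mem_set mX)).
pose PY : probability R R := distribution P' (mfun_Sub (mem_set mY)).
rewrite -[P (X @^-1` A)]/(PX A) -[P' (Y @^-1` A)]/(PY A) => mA.
apply: (measure_unique (@RGenCInfty.G R) (fun n => `[- n%:R, +oo[%classic)) => //.
- exact: RGenCInfty.measurableE.
- move=> _ _ [a ->] [b ->]; exists (Num.max a b).
  apply/seteqP; split => x /=; rewrite !in_itv/= !andbT ge_max.
    by move=> [-> ->].
  by move=> /andP[].
- by move=> n; exists (- n%:R).
- apply/seteqP; split => // x _; exists (Num.truncn `|x|).+1 => //=.
  rewrite in_itv/= andbT lerNl ltW// (le_lt_trans _ (truncnS_gt _))//.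
  by rewrite -normrN ler_norm.
- move=> _ [a ->].
  (* For n > 0 this ramp rises from 0 to 1 on [a - 1/n, a]; the ramps converge pointwise to the
     indicator of the closed half-line. *)
  pose g (n : nat) (x : R) : R := Num.max 0 (Num.min 1 (1 + n%:R * (x - a))).
  have gb n x : `|g n x| <= 1.
    by rewrite ger0_norm /g ?le_max ?lexx// ge_max ler01/= ge_min lexx.
  have cg n : continuous (g n).
    have cmin : continuous (fun x : R => Num.min 1 (1 + n%:R * (x - a)) : R^o).
      move=> x; apply: (@continuous_min R R (cst 1) (fun x => 1 + n%:R * (x - a)) x).
        exact: cvg_cst.
      apply: cvgD; first exact: cvg_cst.
      by apply: cvgMr; apply: cvgB; [exact: cvg_id|exact: cvg_cst].
    move=> x; apply: (@continuous_max R R (cst 0) _ x).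
      exact: cvg_cst.
    exact: cmin.
  have gcvg x : g n x @[n --> \oo] --> (\1_(`[a, +oo[) x : R).
    rewrite indicE mem_setE in_itv/= andbT; have [ax|xa] := leP a x.
      have -> : g ^~ x = fun=> 1.
        apply/funext => n; rewrite /g min_l ?max_r ?ler01//.
        by rewrite lerDl mulr_ge0// subr_ge0.
      exact: cvg_cst.
    apply: cvg_near_cst.
    near=> n; apply/eqP; rewrite /g max_l// ge_min; apply/orP; right.
    rewrite -lerBrDl sub0r -lerN2 opprK -mulrN opprB.
    rewrite -ler_pdivrMr ?subr_gt0// div1r.
    rewrite ltW// (lt_le_trans (truncnS_gt _))// ler_nat.
    by near: n; exact: nbhs_infty_ge.
  have lim d1 (U : measurableType d1) (Q : probability U R) (V : U -> R) :
      measurable_fun setT V ->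
      (\int[Q]_w g n (V w))%R @[n --> \oo] --> fine (Q (V @^-1` `[a, +oo[)).
    move=> mV.
    have -> : fine (Q (V @^-1` `[a, +oo[)) = (\int[Q]_w \1_(`[a, +oo[) (V w))%R.
      rewrite /Rintegral -[X in fine (integral _ _ X)]/(EFin \o (\1_(V @^-1` `[a, +oo[))).
      rewrite integral_indic ?setIT//.
      by rewrite -[X in measurable X]setTI; exact: mV.
    apply: (@bounded_cvg_Rintegral _ _ _ Q _ _ 1) => // n.
    by apply: measurableT_comp => //; apply: continuous_measurable_fun; exact: cg.
  have e : fine (PX `[a, +oo[%classic) = fine (PY `[a, +oo[%classic).
    rewrite -(cvg_lim (@Rhausdorff R) (lim _ _ P X mX)).
    rewrite -(cvg_lim (@Rhausdorff R) (lim _ _ P' Y mY)).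
    congr (limn _); apply/funext => n; rewrite Rintegral_continuous_of_cos//.
    by exists 1 => x; exact: gb.
  by rewrite -[LHS]fineK ?e ?fineK// fin_num_measure.
- by move=> n; rewrite (le_lt_trans (probability_le1 _ _))// ltry.
Unshelve. all: by end_near. Qed.

End law_uniqueness.

(** * The characteristic function of a centered Gaussian law *)

Section gaussian_characteristic_function.
Variables (R : realType) (s c : R).
Hypothesis s0 : s != 0.
Local Notation mu := (@lebesgue_measure R).
Local Notation k := (- (2 * s ^+ 2)^-1 : R).
Local Notation g := (fun x : R => expR (k * x ^+ 2)).

Let s2 : 0 < s ^+ 2. Proof. by rewrite exprn_even_gt0. Qed.

Let k0 : k < 0. Proof. by rewrite oppr_lt0 invr_gt0 mulr_gt0. Qed.

Let pdfE (x : R) : normal_pdf 0 s x = normal_peak s * g x.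
Proof.
rewrite normal_pdfE// /normal_fun subr0; congr (_ * expR _).
by rewrite -mulr_natl mulNr mulNr mulrC.
Qed.

Lemma is_derive_affine (a b x : R) : is_derive x (1 : R) (fun x : R => a * x + b) a.
Proof.
have -> : (fun x : R => a * x + b) = a *: (id : R -> R) + cst b by [].
by apply: is_derive_eq; rewrite /GRing.scale/= addr0 mulr1.
Qed.

Lemma is_derive_gauss (x : R) : is_derive x (1 : R) g (2 * k * x * g x).
Proof.
have H : is_derive x (1 : R) (fun x : R => k * x ^+ 2) (2 * k * x).
  have -> : (fun x : R => k * x ^+ 2) = k *: ((id : R -> R) ^+ 2) by [].
  by apply: is_derive_eq; rewrite /GRing.scale/=; ring.
have H1 := @is_derive1_comp _ expR _ x _ _ (is_derive_expR _) H.
by apply: (@is_derive_eq _ _ _ _ _ _ _ _ H1); rewrite mulrC.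
Qed.

Lemma is_derive_sin_gauss (z x : R) :
  is_derive x (1 : R) (fun x => sin (z * x + c) * g x)
    (z * (cos (z * x + c) * g x) + 2 * k * (x * sin (z * x + c) * g x)).
Proof.
have H1 := @is_derive1_comp _ sin _ x _ _ (is_derive_sin _) (is_derive_affine z c x).
have H := is_deriveM H1 (is_derive_gauss x).
apply: (@is_derive_eq _ _ _ _ _ _ _ _ H).
by rewrite /GRing.scale/=; ring.
Qed.

Lemma is_derive_cos_gauss (z x : R) :
  is_derive z (1 : R) (fun z => cos (z * x + c) * g x)
    (- (x * sin (z * x + c) * g x)).
Proof.
have A : is_derive z (1 : R) (fun z => z * x + c) x.
  have -> : (fun z => z * x + c) = fun z => x * z + c by apply/funext => y; rewrite mulrC.
  exact: is_derive_affine.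
have H1 := @is_derive1_comp _ cos _ z _ _ (is_derive_cos _) A.
have H := is_deriveM H1 (is_derive_cst (g x) z 1).
apply: (@is_derive_eq _ _ _ _ _ _ _ _ H).
by rewrite /GRing.scale/=; ring.
Qed.

(** Half of the exponent absorbs the factor [|x|], through 1 + u <= exp u. *)
Lemma gauss_moment_bound (x : R) : `|x| * g x <= `|s| * expR (k / 2 * x ^+ 2).
Proof.
have -> : k * x ^+ 2 = k / 2 * x ^+ 2 + k / 2 * x ^+ 2 by rewrite -mulrDl -splitr.
rewrite expRD mulrA ler_pM2r ?expR_gt0//.
have sn : 0 < `|s| by rewrite normr_gt0.
(* After clearing denominators this says that (2 |s| - |x|)^2 is nonnegative. *)
have H : `|x| <= `|s| * (1 + - (k / 2 * x ^+ 2)).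
  rewrite -[x ^+ 2]real_normK ?num_real// -[s ^+ 2]real_normK ?num_real//.
  set a := `|s| in sn *; set b := `|x|.
  have -> : a * (1 + - (- (2 * a ^+ 2)^-1 / 2 * b ^+ 2)) = (4 * a ^+ 2 + b ^+ 2) / (4 * a).
    by field; rewrite gt_eqF.
  rewrite ler_pdivlMr ?mulr_gt0//.
  by have := sqr_ge0 (2 * a - b); nra.
rewrite -ler_pdivlMr ?expR_gt0// -expRN (le_trans H)// ler_wpM2l//.
exact: expR_ge1Dx.
Qed.

Lemma measurable_gauss : measurable_fun setT g.
Proof.
by apply: measurableT_comp => //; apply: measurable_funM.
Qed.

Lemma integrable_gauss : mu.-integrable setT (EFin \o g).
Proof.
have := integrable_normal_pdf 0 s.
move=> /(integrableZl measurableT (normal_peak s)^-1).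
apply: eq_integrable => // x _ /=.
by rewrite pdfE -EFinM mulKf// gt_eqF// normal_peak_gt0.
Qed.

End gaussian_characteristic_function.

Section gaussian_characteristic_function.
Variables (R : realType) (s c : R).
Hypothesis s0 : s != 0.
Local Notation mu := (@lebesgue_measure R).
Local Notation k := (- (2 * s ^+ 2)^-1 : R).
Local Notation g := (fun x : R => expR (k * x ^+ 2)).

Let s2 : 0 < s ^+ 2. Proof. by rewrite exprn_even_gt0. Qed.

Let k0 : k < 0. Proof. by rewrite oppr_lt0 invr_gt0 mulr_gt0. Qed.

Lemma integrable_gauss_moment : mu.-integrable setT (EFin \o (fun x => `|x| * g x)).
Proof.
(* The Gaussian of scale [Num.sqrt 2 * s] has exactly the halved exponent left by
   [gauss_moment_bound]. *)
have t0 : Num.sqrt 2 * s != 0 by rewrite mulf_neq0// gt_eqF// sqrtr_gt0.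
apply: (integrable_le _ _ (integrableZ_real `|s| (integrable_gauss t0))).
  by apply: measurable_funM; [exact: normr_measurable|exact: measurable_gauss].
move=> x; rewrite ger0_norm ?mulr_ge0 ?expR_ge0//.
apply: (le_trans (gauss_moment_bound s0 x)) => /=.
rewrite exprMn sqr_sqrtr// le_eqVlt; apply/orP; left; apply/eqP.
by congr (_ * expR (_ * _)); field.
Qed.

Lemma measurable_sin_affine (z : R) : measurable_fun setT (fun x : R => sin (z * x + c)).
Proof.
apply: measurableT_comp; first exact: measurable_sin.
by apply: measurable_funD => //; exact: measurable_funM.
Qed.

Lemma measurable_cos_affine (z : R) : measurable_fun setT (fun x : R => cos (z * x + c)).
Proof.
apply: measurableT_comp; first exact: measurable_cos.
by apply: measurable_funD => //; exact: measurable_funM.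
Qed.

Lemma integrable_cos_gauss (z : R) :
  mu.-integrable setT (EFin \o (fun x => cos (z * x + c) * g x)).
Proof.
apply: integrable_le (integrable_gauss s0).
  by apply: measurable_funM; [exact: measurable_cos_affine|exact: measurable_gauss].
by move=> x; rewrite normrM (ger0_norm (expR_ge0 _)) ler_piMl ?expR_ge0// cos_max.
Qed.

Lemma integrable_id_sin_gauss (z : R) :
  mu.-integrable setT (EFin \o (fun x => x * sin (z * x + c) * g x)).
Proof.
apply: integrable_le integrable_gauss_moment.
  apply: measurable_funM; last exact: measurable_gauss.
  by apply: measurable_funM => //; exact: measurable_sin_affine.
move=> x; rewrite !normrM (ger0_norm (expR_ge0 _)) ler_wpM2r ?expR_ge0//.
by rewrite ler_piMr// sin_max.
Qed.

(* Integration by parts. *)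
Lemma Rintegral_id_sin_gauss (z : R) :
  \int[mu]_x (x * sin (z * x + c) * g x) =
  s ^+ 2 * z * \int[mu]_x (cos (z * x + c) * g x).
Proof.
pose F x := sin (z * x + c) * g x.
pose f x := z * (cos (z * x + c) * g x) + 2 * k * (x * sin (z * x + c) * g x).
have dF (x : R) : is_derive x (1 : R) F (f x) by exact: is_derive_sin_gauss.
have derivable_cont (h dh : R -> R) : (forall u, is_derive u (1 : R) h (dh u)) ->
    continuous h.
  move=> hdh u; apply: differentiable_continuous.
  by apply/derivable1_diffP; have [] := hdh u.
have cF := derivable_cont _ _ dF.
have cf : continuous f.
  have cg := derivable_cont _ _ (is_derive_gauss s).
  have ca := derivable_cont _ _ (is_derive_affine z c).
  move=> u; apply: cvgD; apply: cvgMr.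
    apply: cvgM; last exact: cg.
    exact: (continuous_comp (ca u) (@continuous_cos R _)).
  apply: cvgM; last exact: cg.
  by apply: cvgM; [exact: cvg_id|exact: (continuous_comp (ca u) (@continuous_sin R _))].
have intf : mu.-integrable setT (EFin \o f).
  apply: integrableD_real; apply: integrableZ_real.
    exact: integrable_cos_gauss.
  exact: integrable_id_sin_gauss.
(* By the fundamental theorem of calculus on [-(n+1), n+1] the integral reduces to boundary values
   of [F], which are O(1/n) because |x| g x is bounded. *)
have f0 : \int[mu]_x f x = 0.
  pose I n : set R := `[- n.+1%:R, n.+1%:R]%classic.
  have FTC n : \int[mu]_(x in I n) f x = F n.+1%:R - F (- n.+1%:R).
    rewrite /Rintegral (@continuous_FTC2 _ f F)//.
    - by rewrite gtrN// ltr0n.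
    - exact: continuous_subspaceT.
    - split => //.
      + by apply: cvg_at_right_filter; exact: cF.
      + by apply: cvg_at_left_filter; exact: cF.
    - by move=> x _; rewrite derive1E; apply: derive_val.
  have lim1 : (\int[mu]_(x in I n) f x) @[n --> \oo] --> \int[mu]_x f x.
    under eq_fun do rewrite Rintegral_mkcond.
    apply: (@dominated_cvg_Rintegral _ _ _ mu _ f (fun x => `|f x|)).
    - move=> n; apply: (measurable_restrictT f (measurable_itv `[- n.+1%:R, n.+1%:R])).1.
      by apply: measurable_funTS; exact: continuous_measurable_fun.
    - move=> x; apply: cvg_near_cst; near=> n.
      rewrite patchE mem_set// /I/= in_itv/= -ler_norml.
      rewrite ltW// (lt_le_trans (truncnS_gt _))// ler_nat ltnS.
      by near: n; exact: nbhs_infty_ge.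
    - exact: integrable_norm_real.
    - by move=> n x; rewrite patchE; case: ifP => //; rewrite normr0.
  have lim2 : (F n.+1%:R - F (- n.+1%:R)) @[n --> \oo] --> (0 : R).
    have Fb (x : R) (n : nat) : `|x| = n.+1%:R -> `|F x| <= `|s| * n.+1%:R^-1.
      move=> xn; rewrite ler_pdivlMr ?ltr0n// -xn normrM (ger0_norm (expR_ge0 _)) -mulrA.
      rewrite (le_trans (_ : _ <= 1 * (g x * `|x|)))//.
        by rewrite ler_wpM2r ?mulr_ge0 ?expR_ge0// sin_max.
      rewrite mul1r mulrC (le_trans (gauss_moment_bound s0 x))// ler_piMr//.
      rewrite -expR0 ler_expR -oppr_ge0 -!mulNr mulr_ge0 ?sqr_ge0//.
      by rewrite opprK divr_ge0 ?invr_ge0// mulr_ge0 ?ltW.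
    apply/cvgr0Pnorm_le => e e0; near=> n.
    rewrite (le_trans (ler_normB _ _))// (le_trans (lerD (Fb _ n _) (Fb _ n _)))//.
    - by rewrite normr_nat.
    - by rewrite normrN normr_nat.
    rewrite -mulrDl -ler_pdivlMl ?addr_gt0 ?normr_gt0//.
    rewrite ltW//; near: n.
    have e' : 0 < (`|s| + `|s|)^-1 * e by rewrite mulr_gt0 ?invr_gt0 ?addr_gt0 ?normr_gt0.
    exact: (near_infty_natSinv_lt (PosNum e')).
  rewrite -(cvg_lim (@Rhausdorff R) lim1) -(cvg_lim (@Rhausdorff R) lim2).
  by congr (limn _); apply/funext => n; exact: FTC.
move: f0; rewrite RintegralD//; last 2 first.
  by apply: integrableZ_real; exact: integrable_cos_gauss.
  by apply: integrableZ_real; exact: integrable_id_sin_gauss.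
rewrite !RintegralZl//; [|exact: integrable_id_sin_gauss|exact: integrable_cos_gauss].
set A := Rintegral _ _ _; set B := Rintegral _ _ _ => H.
have : s ^+ 2 * (z * A + 2 * k * B) = 0 by rewrite H mulr0.
have -> : s ^+ 2 * (z * A + 2 * k * B) = s ^+ 2 * z * A - B.
  by field.
by move/eqP; rewrite subr_eq0 => /eqP ->.
Unshelve. all: by end_near. Qed.

(** As a function of [z] the integral [C] solves C' = - s^2 z C: differentiation under the integral
    sign produces the integral just computed by parts. The product [h] with exp (s^2 z^2 / 2) is
    therefore constant, and is evaluated at 0. *)
Lemma Rintegral_cos_gauss (z : R) :
  \int[mu]_x (cos (z * x + c) * g x) =
  expR (- (s ^+ 2 * z ^+ 2 / 2)) * (cos c * \int[mu]_x g x).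
Proof.
pose C z := \int[mu]_x (cos (z * x + c) * g x).
have dC (u : R) : is_derive u (1 : R) C (- (s ^+ 2 * u * C u)).
  pose G (x : R) := `|x| * g x.
  have pE v x : partial1of2 (fun z x : R => cos (z * x + c) * g x) v x =
      - (x * sin (v * x + c) * g x).
    by rewrite partial1of2E; have H := is_derive_cos_gauss s c v x; rewrite derive_val.
  have Iu : `]u - 1, u + 1[%classic u.
    by rewrite /= in_itv/= ltrBlDr ltrDl ltr01.
  have intI v : `]u - 1, u + 1[%classic v ->
    mu.-integrable setT (EFin \o (fun x => cos (v * x + c) * g x)).
    by move=> _; exact: integrable_cos_gauss.
  have derI v x : `]u - 1, u + 1[%classic v -> setT x ->
    derivable (fun z : R => cos (z * x + c) * g x) v 1.
    by move=> _ _; have [] := is_derive_cos_gauss s c v x.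
  have G0 x : 0 <= G x by rewrite mulr_ge0 ?expR_ge0.
  have Gub v x : `]u - 1, u + 1[%classic v -> setT x ->
      `|partial1of2 (fun z x : R => cos (z * x + c) * g x) v x| <= G x.
    move=> _ _; rewrite pE normrN !normrM (ger0_norm (expR_ge0 _)).
    by rewrite ler_wpM2r ?expR_ge0// ler_piMr// sin_max.
  have D1 := @derivable_under_integral _ _ _ mu _ _ measurableT _ _ _ Iu intI derI
    G G0 integrable_gauss_moment Gub.
  have D2 := @differentiation_under_integral _ _ _ mu _ _ measurableT _ _ _ Iu intI derI
    G G0 integrable_gauss_moment Gub.
  apply: DeriveDef; first exact: D1.
  rewrite -derive1E [LHS]D2.
  rewrite -[s ^+ 2 * u * C u](Rintegral_id_sin_gauss u) -[RHS]mulN1r.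
  rewrite -[RHS]RintegralZl//; last exact: integrable_id_sin_gauss.
  by apply: eq_Rintegral => x _; rewrite pE mulN1r.
pose h u := C u * expR (s ^+ 2 / 2 * u ^+ 2).
have dh (u : R) : is_derive u (1 : R) h 0.
  have dq : is_derive u (1 : R) (fun u : R => s ^+ 2 / 2 * u ^+ 2) (s ^+ 2 * u).
    have -> : (fun u : R => s ^+ 2 / 2 * u ^+ 2) = (s ^+ 2 / 2) *: ((id : R -> R) ^+ 2) by [].
    by apply: is_derive_eq; rewrite /GRing.scale/=; field.
  have H2 := @is_derive1_comp _ expR _ u _ _ (is_derive_expR _) dq.
  apply: (@is_derive_eq _ _ _ _ _ _ _ _ (is_deriveM (dC u) H2)).
  by rewrite /GRing.scale/=; ring.
have := @is_derive_0_is_cst _ h z 0 dh.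
rewrite /h expr0n/= mulr0 expR0 mulr1 => hE.
have -> : cos c * \int[mu]_x g x = C 0.
  rewrite /C -RintegralZl//; last exact: integrable_gauss.
  by apply: eq_Rintegral => x _; rewrite mul0r add0r.
rewrite -hE -/(C z).
transitivity (C z * expR (- (s ^+ 2 * z ^+ 2 / 2) + s ^+ 2 / 2 * z ^+ 2)).
  have -> : - (s ^+ 2 * z ^+ 2 / 2) + s ^+ 2 / 2 * z ^+ 2 = 0 by field.
  by rewrite expR0 mulr1.
by rewrite expRD mulrCA.
Qed.

End gaussian_characteristic_function.

(** * Laws with a density *)

Section density.
Variable R : realType.
Context d (T : measurableType d) (P : probability T R).
Context d' (U : measurableType d') (mu : {sigma_finite_measure set U -> \bar R}).
Variables (X : T -> U) (p : U -> R).
Hypotheses (mX : measurable_fun setT X) (mp : measurable_fun setT p).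
Hypothesis Xp : forall A, measurable A ->
  P (X @^-1` A) = (\int[mu]_(x in A) (p x)%:E)%E.

Lemma null_density A : measurable A -> mu A = 0%E -> P (X @^-1` A) = 0%E.
Proof.
move=> mA A0; rewrite Xp//; apply: null_set_integral => //.
by apply: measurable_funTS; exact/measurable_EFinP.
Qed.

(** [null_density] makes the law of [X] absolutely continuous. Its Radon-Nikodym derivative has the
    same integral as [p] over every measurable set, so the two agree almost everywhere. *)
Lemma Rintegral_density (f : U -> R) M : measurable_fun setT f ->
  (forall x, `|f x| <= M) ->
  \int[P]_w f (X w) = \int[mu]_x (f x * p x).
Proof.
move=> mf fM.
pose PX : probability U R := distribution P (mfun_Sub (mem_set mX)).
have dom : PX `<< mu.
  by apply/null_content_dominatesP => A mA A0; exact: null_density.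
have intf : PX.-integrable setT (EFin \o f).
  exact: bounded_integrable_probability fM.
transitivity (\int[PX]_x f x).
  rewrite /Rintegral integral_pushforward_measurable//.
  exact/measurable_EFinP.
rewrite /Rintegral; congr fine.
rewrite -(Radon_Nikodym_change_of_variables dom measurableT intf).
apply: ae_eq_integral => //.
- apply: emeasurable_funM; first exact/measurable_EFinP.
  by apply: (measurable_int mu); exact: Radon_Nikodym_integrable.
- by apply/measurable_EFinP; exact: measurable_funM.
- under [X in ae_eq _ _ _ X]eq_fun do rewrite EFinM.
  apply: ae_eqe_mul2l.
  apply: integral_ae_eq => //.
  + exact: Radon_Nikodym_integrable.
  + exact/measurable_EFinP.
  + by move=> E _ mE; rewrite -Radon_Nikodym_integral// -Xp.
Qed.

End density.

Section centered_gaussian.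
Variable R : realType.
Context d (T : measurableType d) (P : probability T R).

Lemma Rintegral_cos_centered_gaussian (X : T -> R) (s : R) :
  measurable_fun setT X ->
  (forall A, measurable A ->
    P (X @^-1` A) = if s == 0 then dirac (0 : R) A else normal_prob 0 s A) ->
  forall z c, \int[P]_w cos (z * X w + c) = expR (- (s ^+ 2 * z ^+ 2 / 2)) * cos c.
Proof.
move=> mX; have [-> X0|s0 Xs] := eqVneq s 0 => z c.
  rewrite expr0n mul0r mul0r oppr0 expR0 mul1r.
  rewrite -[RHS](Rintegral_cst_probability P) /Rintegral; congr fine.
  apply: ae_eq_integral => //.
  - apply/measurable_EFinP; apply: measurableT_comp; first exact: measurable_cos.
    by apply: measurable_funD => //; exact: measurable_funM.
  (* Under the Dirac law this event is null, and outside it the cosine is the constant cos c. *)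
  - have mN : measurable (X @^-1` (~` [set 0])).
      by rewrite -[_ @^-1` _]setTI; apply: mX => //; exact: measurableC.
    have PN : P (X @^-1` (~` [set 0])) = 0%E.
      rewrite X0; last exact: measurableC.
      rewrite diracE memNset//; exact.
    exists (X @^-1` (~` [set 0])); split; [exact: mN|exact: PN|].
    move=> w /= H Xw; apply: H => _; have -> : X w = 0 by [].
    by rewrite mulr0 add0r.
have mc : measurable_fun setT (fun x : R => cos (z * x + c)).
  apply: measurableT_comp; first exact: measurable_cos.
  by apply: measurable_funD => //; exact: measurable_funM.
have Xp A : measurable A -> P (X @^-1` A) =
    (\int[lebesgue_measure]_(x in A) (normal_pdf 0 s x)%:E)%E.
  by move=> mA; rewrite Xs.
rewrite (@Rintegral_density _ _ _ P _ _ (@lebesgue_measure R) _ _ mX (measurable_normal_pdf 0 s) Xp _ 1 mc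
  (fun x => cos_max _)).
have gE (x : R) : normal_pdf 0 s x = normal_peak s * expR (- (2 * s ^+ 2)^-1 * x ^+ 2).
  rewrite normal_pdfE// /normal_fun subr0; congr (_ * expR _).
  by rewrite -mulr_natl mulNr mulNr mulrC.
have ig := integrable_gauss s0.
have pg1 : normal_peak s * \int[lebesgue_measure]_x expR (- (2 * s ^+ 2)^-1 * x ^+ 2) = 1.
  rewrite -RintegralZl// -[RHS]/(fine 1%E) -(integral_normal_pdf 0 s).
  by congr fine; apply: eq_integral => x _; rewrite gE.
transitivity (normal_peak s * \int[lebesgue_measure]_x
    (cos (z * x + c) * expR (- (2 * s ^+ 2)^-1 * x ^+ 2))).
  rewrite -RintegralZl//; last exact: integrable_cos_gauss.
  by apply: eq_Rintegral => x _; rewrite gE mulrCA.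
rewrite Rintegral_cos_gauss//; move: pg1; set G := Rintegral _ _ _ => pg1.
transitivity (expR (- (s ^+ 2 * z ^+ 2 / 2)) * cos c * (normal_peak s * G)).
  by ring.
by rewrite pg1 mulr1.
Qed.

End centered_gaussian.

(** * Independent pairs and expectations of products *)

Definition independent_pair d (T : measurableType d) (R : realType)
    (P : probability T R) d1 (T1 : measurableType d1) d2 (T2 : measurableType d2)
    (X : T -> T1) (Y : T -> T2) : Prop :=
  forall A B, measurable A -> measurable B ->
  P (X @^-1` A `&` Y @^-1` B) = (P (X @^-1` A) * P (Y @^-1` B))%E.

Lemma independent_pair_comp d (T : measurableType d) (R : realType)
    (P : probability T R) d1 (T1 : measurableType d1) d2 (T2 : measurableType d2)
    d3 (U1 : measurableType d3) d4 (U2 : measurableType d4)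
    (X : T -> T1) (Y : T -> T2) (F : T1 -> U1) (G : T2 -> U2) :
  independent_pair P X Y -> measurable_fun setT F -> measurable_fun setT G ->
  independent_pair P (fun w => F (X w)) (fun w => G (Y w)).
Proof.
move=> XY mF mG A B mA mB; apply: (XY (F @^-1` A) (G @^-1` B)).
  by rewrite -[X in measurable X]setTI; exact: mF.
by rewrite -[X in measurable X]setTI; exact: mG.
Qed.

Section independent_products.
Variable R : realType.
Context d (T : measurableType d) (P : probability T R).

Lemma Rintegral_indep_mul d1 (T1 : measurableType d1) d2 (T2 : measurableType d2)
    (X : T -> T1) (Y : T -> T2) (F : T1 -> R) (G : T2 -> R) :
  measurable_fun setT X -> measurable_fun setT Y -> independent_pair P X Y ->
  measurable_fun setT F -> measurable_fun setT G ->
  P.-integrable setT (EFin \o (fun w => F (X w))) ->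
  P.-integrable setT (EFin \o (fun w => G (Y w))) ->
  P.-integrable setT (EFin \o (fun w => F (X w) * G (Y w))) ->
  \int[P]_w (F (X w) * G (Y w)) = \int[P]_w F (X w) * \int[P]_w G (Y w).
Proof.
move=> mX mY XY mF mG iF iG iFG.
rewrite [LHS]/Rintegral.
have mf : measurable_fun setT (fun z : T1 * T2 => (F z.1 * G z.2)%:E).
  apply/measurable_EFinP; apply: measurable_funM; exact: measurableT_comp.
rewrite (@integral_decoupling _ _ _ P _ _ _ _ X Y mX mY XY
  (fun z => (F z.1 * G z.2)%:E) mf iFG)/=.
rewrite -RintegralZr//; congr fine; apply: eq_integral => w _.
by rewrite -EFin_Rintegral ?RintegralZl//; exact: integrableZ_real.
Qed.

Lemma Rintegral_indep_bounded_mul d1 (T1 : measurableType d1) d2 (T2 : measurableType d2)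
    (X : T -> T1) (Y : T -> T2) (F : T1 -> R) (G : T2 -> R) :
  measurable_fun setT X -> measurable_fun setT Y -> independent_pair P X Y ->
  measurable_fun setT F -> measurable_fun setT G ->
  bounded_real F -> bounded_real G ->
  \int[P]_w (F (X w) * G (Y w)) = \int[P]_w F (X w) * \int[P]_w G (Y w).
Proof.
move=> mX mY XY mF mG [M FM] [N GN].
have mFX : measurable_fun setT (fun w => F (X w)) by exact: measurableT_comp.
have mGY : measurable_fun setT (fun w => G (Y w)) by exact: measurableT_comp.
apply: Rintegral_indep_mul => //.
- exact: (@bounded_integrable_probability _ _ _ _ _ M).
- exact: (@bounded_integrable_probability _ _ _ _ _ N).
- apply: (@bounded_integrable_probability _ _ _ _ _ (M * N)).
    exact: measurable_funM.
  by move=> w; rewrite normrM ler_pM.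
Qed.

End independent_products.

(** * Lindeberg replacement for independent centered summands *)

Section gaussian_approximation.
Variable R : realType.
Context d (T : measurableType d) (P : probability T R).
Variable eta : nat -> T -> R.
Local Notation S n := (fun w => \sum_(k < n) eta k w).
Hypothesis meta : forall k, measurable_fun setT (eta k).
Hypothesis eta3 : forall k, P.-integrable setT (EFin \o (fun w => `|eta k w| ^+ 3)).
Hypothesis eta_mean : forall k, \int[P]_w eta k w = 0.
Hypothesis eta_indep : forall n, independent_pair P (S n) (eta n).

Let mS n : measurable_fun setT (S n).
Proof. exact: measurable_sum. Qed.

Let int_le (f : T -> R) k : measurable_fun setT f ->
  (forall w, `|f w| <= 1 + `|eta k w| ^+ 3) -> P.-integrable setT (EFin \o f).
Proof.
move=> mf fle; apply: (integrable_le mf fle).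
by apply: integrableD_real; [exact: integrable_cst_probability|].
Qed.

Let pow_le (x : R) : 0 <= x -> x <= 1 + x ^+ 3 /\ x ^+ 2 <= 1 + x ^+ 3.
Proof.
move=> x0; have [x1|/ltW x1] := leP x 1.
  have := exprn_ge0 2 x0; have := exprn_ge0 3 x0.
  by rewrite expr2 exprS expr2 => *; split; nra.
have := exprn_ge0 2 x0; have := exprn_ge0 3 x0.
by rewrite expr2 exprS expr2 => *; split; nra.
Qed.

Lemma integrable_summand k : P.-integrable setT (EFin \o eta k).
Proof. by apply: (@int_le _ k) => // w; have [] := pow_le (normr_ge0 (eta k w)). Qed.

Lemma integrable_summand_sqr k :
  P.-integrable setT (EFin \o (fun w => eta k w ^+ 2)).
Proof.
apply: (@int_le _ k) => [|w]; first exact: measurable_funX.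
by rewrite normrX; have [] := pow_le (normr_ge0 (eta k w)).
Qed.

Lemma integrable_sum_sqr n :
  P.-integrable setT (EFin \o (fun w => (\sum_(k < n) eta k w) ^+ 2)).
Proof.
elim: n => [|n IH].
  have -> : (fun w => (\sum_(k < 0) eta k w) ^+ 2) = cst 0.
    by apply/funext => w; rewrite big_ord0 expr0n.
  exact: integrable_cst_probability.
have int2 : P.-integrable setT (EFin \o (fun w => 2 * ((\sum_(k < n) eta k w) ^+ 2
    + eta n w ^+ 2))).
  by apply: integrableZ_real; apply: integrableD_real => //; exact: integrable_summand_sqr.
apply: integrable_le int2; first exact: measurable_funX.
move=> w; rewrite ger0_norm ?sqr_ge0// big_ord_recr/=.
by set a := \sum_(_ < _) _; have := sqr_ge0 (a - eta n w); nra.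
Qed.

(** The cross term factors, since the partial sum is independent of the next summand, and vanishes
    because the summand is centered. *)
Lemma Rintegral_sum_sqr n :
  \int[P]_w ((\sum_(k < n) eta k w) ^+ 2) = \sum_(k < n) \int[P]_w (eta k w ^+ 2).
Proof.
elim: n => [|n IH].
  rewrite big_ord0 -[RHS](Rintegral_cst_probability P).
  by apply: eq_Rintegral => w _; rewrite big_ord0 expr0n.
rewrite big_ord_recr/= -IH.
have i1 := integrable_sum_sqr n.
have i2 := integrable_summand_sqr n.
have iX : P.-integrable setT (EFin \o (fun w => (\sum_(k < n) eta k w) * eta n w)).
  apply: integrable_le (integrableD_real i1 i2); first exact: measurable_funM.
  move=> w; rewrite normrM.
  set a := \sum_(_ < _) _; rewrite -[a ^+ 2]real_normK ?num_real//.
  rewrite -[eta n w ^+ 2]real_normK ?num_real//.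
  have := sqr_ge0 (`|a| - `|eta n w|); have := normr_ge0 a; have := normr_ge0 (eta n w).
  by nra.
have cross : \int[P]_w ((\sum_(k < n) eta k w) * eta n w) = 0.
  rewrite (@Rintegral_indep_mul _ _ _ P _ _ _ _ (S n) (eta n) id id)//.
  - by rewrite eta_mean mulr0.
  - by apply: integrable_sum_real => k; exact: integrable_summand.
  - exact: integrable_summand.
transitivity (\int[P]_w ((\sum_(k < n) eta k w) ^+ 2 +
    (2 * ((\sum_(k < n) eta k w) * eta n w) + eta n w ^+ 2))).
  by apply: eq_Rintegral => w _; rewrite big_ord_recr/=; ring.
rewrite RintegralD//; last first.
  by apply: integrableD_real => //; exact: integrableZ_real.
rewrite RintegralD//; last exact: integrableZ_real.
by rewrite RintegralZl// cross mulr0 add0r.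
Qed.

(** From exp (-u) <= 1 / (1 + u), whose excess over 1 - u is u^2 / (1 + u). *)
Lemma expR_sub_le (u : R) : 0 <= u -> `|expR (- u) - (1 - u)| <= u ^+ 2.
Proof.
move=> u0; have H1 := expR_ge1Dx (- u).
rewrite ger0_norm ?subr_ge0//.
have u1 : 0 < 1 + u by rewrite ltr_wpDr.
have : expR (- u) <= (1 + u)^-1.
  by rewrite expRN lef_pV2 ?posrE ?expR_gt0//; exact: expR_ge1Dx.
move=> H2; rewrite lerBlDr (le_trans H2)//.
rewrite -div1r ler_pdivrMr//.
by have : 0 <= u ^+ 3 by [exact: exprn_ge0]; rewrite exprS expr2; nra.
Qed.

(** Both terms are compared with 1 - v / 2, the cosine at cubic cost and the exponential at cost
    v^2. *)
Lemma Rintegral_cos_summand k :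
  `|\int[P]_w cos (eta k w) - expR (- (\int[P]_w (eta k w ^+ 2) / 2))| <=
  \int[P]_w (`|eta k w| ^+ 3) + (\int[P]_w (eta k w ^+ 2)) ^+ 2.
Proof.
set v := \int[P]_w (eta k w ^+ 2).
have v0 : 0 <= v by apply: Rintegral_ge0 => w _; exact: sqr_ge0.
have i2 := integrable_summand_sqr k.
have mc : measurable_fun setT (fun w => cos (eta k w)).
  by apply: measurableT_comp => //; exact: measurable_cos.
have ic := bounded_integrable_probability P mc (fun w => cos_max (eta k w)).
have i22 : P.-integrable setT (EFin \o (fun w => 1 - 2^-1 * eta k w ^+ 2)).
  by apply: integrableB_real; [exact: integrable_cst_probability|exact: integrableZ_real].
have A : `|\int[P]_w cos (eta k w) - (1 - v / 2)| <= \int[P]_w (`|eta k w| ^+ 3).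
  have -> : 1 - v / 2 = \int[P]_w (1 - 2^-1 * eta k w ^+ 2).
    rewrite RintegralB//; last 2 first.
      exact: integrable_cst_probability.
      exact: integrableZ_real.
    by rewrite Rintegral_cst_probability RintegralZl// mulrC.
  rewrite -RintegralB//.
  apply: (le_trans (le_normr_Rintegral measurableT (integrableB_real ic i22))).
  apply: le_Rintegral => //; first exact/integrable_norm_real/integrableB_real.
  by move=> w _; rewrite [2^-1 * _]mulrC; exact: cos_taylor2_le3.
have B : `|expR (- (v / 2)) - (1 - v / 2)| <= v ^+ 2.
  rewrite (le_trans (expR_sub_le _)) ?divr_ge0//.
  by rewrite expr_div_n ler_pdivrMr ?exprn_gt0// ler_peMr ?sqr_ge0//; lra.
rewrite -(subrK (1 - v / 2) (\int[P]_w cos (eta k w))) -addrA.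
by rewrite (le_trans (ler_normD _ _))// lerD// distrC.
Qed.

(** Subtracting the vanishing mean turns sin x into sin x - x, which is of third order. *)
Lemma Rintegral_sin_summand k :
  `|\int[P]_w sin (eta k w)| <= \int[P]_w (`|eta k w| ^+ 3).
Proof.
have ms : measurable_fun setT (fun w => sin (eta k w)).
  by apply: measurableT_comp => //; exact: measurable_sin.
have is_ := bounded_integrable_probability P ms (fun w => sin_max (eta k w)).
have i1 := integrable_summand k.
rewrite -[\int[P]_w sin _]subr0 -[X in _ - X](eta_mean k) -RintegralB//.
apply: (le_trans (le_normr_Rintegral measurableT (integrableB_real is_ i1))).
apply: le_Rintegral => //; first exact/integrable_norm_real/integrableB_real.
by move=> w _; exact: sin_sub_le3.
Qed.

(* Replaces the summands one at a time by their Gaussian characteristic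
   functions; the induction needs all phases [c]. *)
Lemma Rintegral_cos_sum n c :
  `|\int[P]_w cos (\sum_(k < n) eta k w + c)
      - expR (- (\sum_(k < n) \int[P]_w (eta k w ^+ 2) / 2)) * cos c| <=
  \sum_(k < n) (2 * \int[P]_w (`|eta k w| ^+ 3) + (\int[P]_w (eta k w ^+ 2)) ^+ 2).
Proof.
elim: n c => [|n IH] c.
  rewrite !big_ord0 oppr0 expR0 mul1r.
  have -> : \int[P]_w cos (\sum_(k < 0) eta k w + c) = cos c.
    rewrite -[RHS](Rintegral_cst_probability P).
    by apply: eq_Rintegral => w _; rewrite big_ord0 add0r.
  by rewrite subrr normr0.
rewrite !big_ord_recr/=.
set v := \int[P]_w (eta n w ^+ 2); set t := \int[P]_w (`|eta n w| ^+ 3).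
set V := \sum_(k < n) _; set err := \sum_(k < n) _.
have v0 : 0 <= v by apply: Rintegral_ge0 => w _; exact: sqr_ge0.
have mc : measurable_fun setT (fun x : R => cos (x + c)).
  by apply: measurableT_comp; [exact: measurable_cos|exact: measurable_funD].
have ms : measurable_fun setT (fun x : R => sin (x + c)).
  by apply: measurableT_comp; [exact: measurable_sin|exact: measurable_funD].
have int1 (f : R -> R) (X : T -> R) : measurable_fun setT f -> measurable_fun setT X ->
    (forall x, `|f x| <= 1) -> P.-integrable setT (EFin \o (fun w => f (X w))).
  move=> mf mX f1; apply: (@bounded_integrable_probability _ _ _ _ _ 1) => //.
  exact: measurableT_comp.
(* The addition formula and independence isolate the last summand. Its sine is negligible, and its
   cosine is replaced by the Gaussian factor. *)
have -> : \int[P]_w cos (\sum_(k < n.+1) eta k w + c) =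
    \int[P]_w cos (\sum_(k < n) eta k w + c) * \int[P]_w cos (eta n w)
    - \int[P]_w sin (\sum_(k < n) eta k w + c) * \int[P]_w sin (eta n w).
  rewrite -(@Rintegral_indep_bounded_mul _ _ _ P _ _ _ _ (S n) (eta n)
    (fun x => cos (x + c)) (@cos R))//; last 3 first.
  - exact: measurable_cos.
  - by exists 1 => x; exact: cos_max.
  - by exists 1 => x; exact: cos_max.
  rewrite -(@Rintegral_indep_bounded_mul _ _ _ P _ _ _ _ (S n) (eta n)
    (fun x => sin (x + c)) (@sin R))//; last 3 first.
  - exact: measurable_sin.
  - by exists 1 => x; exact: sin_max.
  - by exists 1 => x; exact: sin_max.
  rewrite -RintegralB//; last 2 first.
  - apply: (@bounded_integrable_probability _ _ _ _ _ 1).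
      apply: measurable_funM; first exact: (measurableT_comp mc (mS n)).
      by apply: measurableT_comp => //; exact: measurable_cos.
    by move=> w; rewrite normrM mulr_ile1// cos_max.
  - apply: (@bounded_integrable_probability _ _ _ _ _ 1).
      apply: measurable_funM; first exact: (measurableT_comp ms (mS n)).
      by apply: measurableT_comp => //; exact: measurable_sin.
    by move=> w; rewrite normrM mulr_ile1// sin_max.
  by apply: eq_Rintegral => w _; rewrite [in LHS]big_ord_recr/= [in LHS]addrAC [LHS]cosD.
have bound1 (f : R -> R) : measurable_fun setT f -> (forall x, `|f x| <= 1) ->
    `|\int[P]_w f (\sum_(k < n) eta k w)| <= 1.
  move=> mf f1; have i := int1 f (S n) mf (mS n) f1.
  apply: (le_trans (le_normr_Rintegral measurableT i)).
  rewrite -[leRHS](Rintegral_cst_probability P).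
  by apply: le_Rintegral => //; [exact: integrable_norm_real|exact: integrable_cst_probability].
have bc := bound1 _ mc (fun x => cos_max _).
have bs := bound1 _ ms (fun x => sin_max _).
have e1 : expR (- (v / 2)) <= 1 by rewrite -expR0 ler_expR oppr_le0 divr_ge0.
have := IH c; have := Rintegral_cos_summand n; have := Rintegral_sin_summand n.
rewrite -/v -/t opprD expRD.
move: bc bs (expR_ge0 (- (v / 2))) e1.
set a := \int[P]_w cos _; set b := \int[P]_w sin _; set p := \int[P]_w cos _.
set q := \int[P]_w sin _; set E := expR (- (v / 2)); set F := expR _.
move=> bc bs E0 E1 H1 H2 H3.
(* The first two terms are the price of the last replacement. The third is the error of the
   induction hypothesis, multiplied by [E], which is at most 1. *)
have -> : a * p - b * q - F * E * cos c = a * (p - E) - b * q + E * (a - F * cos c) by ring.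
have ap : `|a * (p - E)| <= t + v ^+ 2.
  by rewrite normrM (le_trans _ H2)// ler_piMl.
have bq : `|b * q| <= t by rewrite normrM (le_trans _ H1)// ler_piMl.
have EF : `|E * (a - F * cos c)| <= err.
  by rewrite normrM (ger0_norm E0) (le_trans _ H3)// ler_piMl.
rewrite (le_trans (ler_normD _ _))// (le_trans (lerD (ler_normB _ _) (lexx _)))//.
by move: ap bq EF; lra.
Qed.

End gaussian_approximation.

(** The preimage splits over the countably many values of [N], on each of which the sum has fixed
    length. *)
Lemma measurable_random_sum d (T : measurableType d) (R : realType)
    (N : T -> nat) (h : nat -> T -> R) :
  measurable_fun setT N -> (forall n, measurable_fun setT (h n)) ->
  measurable_fun setT (fun w => \sum_(n < N w) h n w).
Proof.
move=> mN mh _ B mB; rewrite setTI.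
have -> : (fun w => \sum_(n < N w) h n w) @^-1` B =
    \bigcup_k ((N @^-1` [set k]) `&` (fun w => \sum_(n < k) h n w) @^-1` B).
  apply/seteqP; split => [w Bw|w [k _ [<-]]//].
  by exists (N w).
apply: bigcupT_measurable => k; apply: measurableI.
  by rewrite -[X in measurable X]setTI; exact: mN.
by rewrite -[X in measurable X]setTI; exact: measurable_sum.
Qed.

(** * Averages over a random shift *)

Definition mean_shift d (T : measurableType d) (R : realType)
    (P : probability T R) (X : T -> R) (f : R -> R) (x : R) : R :=
  \int[P]_w f (x + X w).

Section mean_shift.
Context d (T : measurableType d) (R : realType) (P : probability T R).
Variable X : T -> R.
Hypothesis mX : measurable_fun setT X.

Lemma measurable_shift (f : R -> R) x : measurable_fun setT f ->
  measurable_fun setT (fun w => f (x + X w)).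
Proof. by move=> mf; apply: measurableT_comp => //; exact: measurable_funD. Qed.

Lemma integrable_shift (f : R -> R) M x : measurable_fun setT f ->
  (forall y, `|f y| <= M) -> P.-integrable setT (EFin \o (fun w => f (x + X w))).
Proof.
move=> mf fM; apply: (@bounded_integrable_probability _ _ _ _ _ M) => //.
exact: measurable_shift.
Qed.

Lemma mean_shift_norm_le (f : R -> R) M x : measurable_fun setT f ->
  (forall y, `|f y| <= M) -> `|mean_shift P X f x| <= M.
Proof.
move=> mf fM; have i := integrable_shift x mf fM.
apply: (le_trans (le_normr_Rintegral measurableT i)).
rewrite -[leRHS](Rintegral_cst_probability P); apply: le_Rintegral => //.
  exact: integrable_norm_real.
exact: integrable_cst_probability.
Qed.

Lemma mean_shift_ge0 (f : R -> R) x : (forall y, 0 <= f y) -> 0 <= mean_shift P X f x.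
Proof. by move=> f0; apply: Rintegral_ge0. Qed.

(** Adding [M] makes the integrand nonnegative, so that measurability comes from Tonelli; the
    constant is subtracted afterwards. *)
Lemma measurable_mean_shift (f : R -> R) M : measurable_fun setT f ->
  (forall y, `|f y| <= M) -> measurable_fun setT (mean_shift P X f).
Proof.
move=> mf fM.
have mF : measurable_fun setT (fun z : R * T => (f (z.1 + X z.2) + M)%:E).
  apply/measurable_EFinP; apply: measurable_funD => //.
  apply: measurableT_comp => //; apply: measurable_funD => //.
  exact: measurableT_comp.
have F0 z : (0 <= (f (z.1 + X z.2) + M)%:E)%E.
  rewrite lee_fin; have := fM (z.1 + X z.2); rewrite ler_norml => /andP[+ _].
  by rewrite -lerBlDr sub0r.
have mG := @measurable_fun_fubini_tonelli_F _ _ _ _ _ P _ mF F0.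
have -> : mean_shift P X f = fun x =>
    fine (fubini_F P (fun z : R * T => (f (z.1 + X z.2) + M)%:E) x) - M.
  apply/funext => x; rewrite /fubini_F/=.
  rewrite -[X in _ = X - _]/(\int[P]_w (f (x + X w) + M)) RintegralD//.
  - by rewrite Rintegral_cst_probability addrK.
  - exact: integrable_shift fM.
  - exact: integrable_cst_probability.
by apply: measurable_funB => //; apply: measurableT_comp mG.
Qed.

End mean_shift.

Lemma mean_shift_law d (T : measurableType d) (R : realType) (P : probability T R)
    d' (T' : measurableType d') (P' : probability T' R) (X : T -> R) (Y : T' -> R)
    (f : R -> R) x :
  measurable_fun setT X -> measurable_fun setT Y ->
  (forall A, measurable A -> P (X @^-1` A) = P' (Y @^-1` A)) ->
  measurable_fun setT f -> mean_shift P X f x = mean_shift P' Y f x.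
Proof.
move=> mX mY XY mf; rewrite /mean_shift /Rintegral; congr fine.
have mfx : measurable_fun setT (fun y : R => (f (x + y))%:E).
  by apply/measurable_EFinP; apply: measurableT_comp => //; exact: measurable_funD.
pose PX : probability R R := distribution P (mfun_Sub (mem_set mX)).
pose PY : probability R R := distribution P' (mfun_Sub (mem_set mY)).
transitivity (\int[PX]_y (f (x + y))%:E)%E.
  by rewrite integral_pushforward_measurable.
transitivity (\int[PY]_y (f (x + y))%:E)%E.
  by apply: eq_measure_integral => A mA _; exact: XY.
by rewrite integral_pushforward_measurable.
Qed.

(** * Moments of the contribution of one cell *)

Section cluster.
Variable R : realType.
Context d (T : measurableType d) (P : probability T R).
Context d1 (TC : measurableType d1) d2 (TM : measurableType d2).
Variables (cfg : T -> TC) (mvt : T -> TM).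
Variables (N : TC -> nat) (pos : nat -> TC -> R) (mot : nat -> TM -> R).
Variable X : T -> R.
Hypotheses (mcfg : measurable_fun setT cfg) (mmvt : measurable_fun setT mvt).
Hypothesis cfg_mvt : independent_pair P cfg mvt.
Hypotheses (mN : measurable_fun setT N) (mpos : forall n, measurable_fun setT (pos n)).
Hypothesis mmot : forall n, measurable_fun setT (mot n).
Hypothesis mX : measurable_fun setT X.
Hypothesis motX : forall n A, measurable A ->
  P ((fun w => mot n (mvt w)) @^-1` A) = P (X @^-1` A).
Hypothesis mot_indep : forall n k, n != k ->
  independent_pair P (fun w => mot n (mvt w)) (fun w => mot k (mvt w)).
Hypothesis N3 : P.-integrable setT (EFin \o (fun w => (N (cfg w))%:R ^+ 3)).
Local Notation Nw := (fun w => N (cfg w)).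
Local Notation G := (mean_shift P X).

Let mmotw n : measurable_fun setT (fun w => mot n (mvt w)).
Proof. exact: measurableT_comp. Qed.

Let mNw : measurable_fun setT Nw. Proof. exact: measurableT_comp. Qed.

Lemma measurable_natr_random : measurable_fun setT (fun w => (Nw w)%:R : R).
Proof.
have -> : (fun w => (Nw w)%:R : R) = fun w => \sum_(n < Nw w) 1.
  by apply/funext => w; rewrite sumr_const card_ord.
by apply: (@measurable_random_sum _ _ _ Nw (fun=> cst 1)).
Qed.

Lemma integrable_count_pow k : (k <= 3)%N ->
  P.-integrable setT (EFin \o (fun w => (Nw w)%:R ^+ k)).
Proof.
move=> k3; have int1 := integrableD_real (integrable_cst_probability P 1) N3.
apply: integrable_le int1; first by apply: measurable_funX; exact: measurable_natr_random.
move=> w /=; rewrite ger0_norm ?exprn_ge0//.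
case: (Nw w) => [|n].
  by rewrite !expr0n addr0; case: (k == 0%N).
by rewrite ler_wpDl// ler_weXn2l// ler1n.
Qed.

Section test_function.
Variables (f : R -> R) (M : R).
Hypotheses (mf : measurable_fun setT f) (fM : forall y, `|f y| <= M).

Let M0 : 0 <= M. Proof. exact: le_trans (normr_ge0 _) (fM 0). Qed.

(** A function of the pair (configuration, motions), so that the configuration can be frozen by
    decoupling while the motions are averaged. *)
Definition cluster_sum (z : TC * TM) : R :=
  \sum_(n < N z.1) f (pos n z.1 + mot n z.2).
Local Notation xi := (fun w => cluster_sum (cfg w, mvt w)).

Lemma measurable_cluster_sum : measurable_fun setT cluster_sum.
Proof.
apply: (@measurable_random_sum _ _ _ (fun z : TC * TM => N z.1)
  (fun n z => f (pos n z.1 + mot n z.2))).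
  exact: measurableT_comp.
move=> n; apply: measurableT_comp => //.
by apply: measurable_funD; exact: measurableT_comp.
Qed.

Lemma measurable_cluster : measurable_fun setT xi.
Proof. exact: (measurableT_comp measurable_cluster_sum (measurable_fun_pair mcfg mmvt)). Qed.

Lemma cluster_sum_le z : `|cluster_sum z| <= M * (N z.1)%:R.
Proof.
rewrite (le_trans (ler_norm_sum _ _ _))// mulr_natr -[N z.1 in leRHS]card_ord.
by rewrite -sumr_const ler_sum.
Qed.

Lemma integrable_cluster_pow k : (k <= 3)%N ->
  P.-integrable setT (EFin \o (fun w => `|xi w| ^+ k)).
Proof.
move=> k3; apply: integrable_le (integrableZ_real (M ^+ k) (integrable_count_pow k3)).
  apply: measurable_funX; apply: measurableT_comp => //; exact: measurable_cluster.
move=> w; rewrite ger0_norm ?exprn_ge0//= -exprMn.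
by apply: lerXn2r; rewrite ?nnegrE ?mulr_ge0//; exact: cluster_sum_le.
Qed.

Lemma integrable_cluster : P.-integrable setT (EFin \o xi).
Proof.
apply: integrable_le (integrable_cluster_pow (isT : (1 <= 3)%N)).
  exact: measurable_cluster.
by move=> w; rewrite expr1.
Qed.

Lemma integrable_cluster_sqr : P.-integrable setT (EFin \o (fun w => xi w ^+ 2)).
Proof.
apply: integrable_le (integrable_cluster_pow (isT : (2 <= 3)%N)).
  by apply: measurable_funX; exact: measurable_cluster.
by move=> w; rewrite normrX.
Qed.

Lemma Rintegral_motion n x : \int[P]_w f (x + mot n (mvt w)) = G f x.
Proof.
apply: (mean_shift_law x (mmotw n) mX _ mf) => A mA.
exact: motX.
Qed.

Lemma integrable_motion n x :
  P.-integrable setT (EFin \o (fun w => f (x + mot n (mvt w)))).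
Proof. exact: (@integrable_shift _ _ _ P _ (mmotw n) f M x mf fM). Qed.

Lemma Rintegral_motion_sum (x : nat -> R) k :
  \int[P]_w (\sum_(n < k) f (x n + mot n (mvt w))) = \sum_(n < k) G f (x n).
Proof.
rewrite Rintegral_sum; last by move=> n; exact: integrable_motion.
by apply: eq_bigr => n _; exact: Rintegral_motion.
Qed.

Lemma Rintegral_cluster_sum_motion z1 :
  \int[P]_w cluster_sum (z1, mvt w) = \sum_(n < N z1) G f (pos n z1).
Proof. by rewrite /cluster_sum/= (Rintegral_motion_sum (fun n => pos n z1)). Qed.

Lemma integrable_motion_sum (x : nat -> R) k :
  P.-integrable setT (EFin \o (fun w => \sum_(n < k) f (x n + mot n (mvt w)))).
Proof. by apply: integrable_sum_real => n; exact: integrable_motion. Qed.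

Lemma integrable_motion_mul n k x y : P.-integrable setT
  (EFin \o (fun w => f (x + mot n (mvt w)) * f (y + mot k (mvt w)))).
Proof.
apply: (@bounded_integrable_probability _ _ _ _ _ (M * M)).
  apply: measurable_funM; exact: (measurable_shift (mmotw _) _ mf).
by move=> w; rewrite normrM ler_pM.
Qed.

(** With frozen starting points the terms are independent: the second moment is the sum of the
    variances plus the square of the mean. Integrability is carried along, because the induction
    step needs it to expand the square. *)
Lemma Rintegral_motion_sum_sqr (x : nat -> R) k :
  P.-integrable setT (EFin \o (fun w => (\sum_(n < k) f (x n + mot n (mvt w))) ^+ 2)) /\
  \int[P]_w ((\sum_(n < k) f (x n + mot n (mvt w))) ^+ 2) =
  \sum_(n < k) (G (fun y => f y ^+ 2) (x n) - G f (x n) ^+ 2)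
    + (\sum_(n < k) G f (x n)) ^+ 2.
Proof.
elim: k => [|k [IHi IH]].
  split.
    have -> : (fun w => (\sum_(n < 0) f (x n + mot n (mvt w))) ^+ 2) = cst 0.
      by apply/funext => w; rewrite big_ord0 expr0n.
    exact: integrable_cst_probability.
  rewrite !big_ord0 expr0n addr0 -[RHS](Rintegral_cst_probability P).
  by apply: eq_Rintegral => w _; rewrite big_ord0 expr0n.
pose Y n w := f (x n + mot n (mvt w)).
have E w : (\sum_(n < k.+1) Y n w) ^+ 2 = (\sum_(n < k) Y n w) ^+ 2 +
    (2 * (\sum_(n < k) Y n w * Y k w) + Y k w * Y k w).
  by rewrite big_ord_recr/= -mulr_suml; ring.
have iX : P.-integrable setT (EFin \o (fun w => \sum_(n < k) Y n w * Y k w)).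
  by apply: integrable_sum_real => n; exact: integrable_motion_mul.
have iD : P.-integrable setT (EFin \o (fun w => 2 * (\sum_(n < k) Y n w * Y k w) + Y k w * Y k w)).
  by apply: integrableD_real; [exact: integrableZ_real|exact: integrable_motion_mul].
split.
  have -> : (fun w => (\sum_(n < k.+1) Y n w) ^+ 2) = fun w => (\sum_(n < k) Y n w) ^+ 2 +
    (2 * (\sum_(n < k) Y n w * Y k w) + Y k w * Y k w) by apply/funext => w; exact: E.
  exact: integrableD_real.
transitivity (\int[P]_w ((\sum_(n < k) Y n w) ^+ 2 +
    (2 * (\sum_(n < k) Y n w * Y k w) + Y k w * Y k w))).
  by apply: eq_Rintegral => w _; exact: E.
rewrite RintegralD// IH RintegralD//; [|exact: integrableZ_real|exact: integrable_motion_mul].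
rewrite RintegralZl// Rintegral_sum; last by move=> n; exact: integrable_motion_mul.
have -> : \sum_(n < k) \int[P]_w (Y n w * Y k w) = \sum_(n < k) (G f (x n) * G f (x k)).
  apply: eq_bigr => n _; rewrite -(Rintegral_motion n) -(Rintegral_motion k).
  have bf (y : R) : bounded_real (fun u => f (y + u)) by exists M => u.
  have mfy (y : R) : measurable_fun setT (fun u => f (y + u)).
    by apply: measurableT_comp => //; exact: measurable_funD.
  apply: (@Rintegral_indep_bounded_mul _ _ _ P _ _ _ _ _ _ (fun u => f (x n + u))
    (fun u => f (x k + u))) => //.
  by apply: mot_indep; rewrite neq_ltn ltn_ord.
have -> : \int[P]_w (Y k w * Y k w) = G (fun y => f y ^+ 2) (x k).
  rewrite -(mean_shift_law (x k) (mmotw k) mX (@motX k)); last exact: measurable_funX.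
  by apply: eq_Rintegral => w _; rewrite expr2.
by rewrite !big_ord_recr/= -mulr_suml; ring.
Qed.

Lemma Rintegral_decoupled (F : TC * TM -> R) : measurable_fun setT F ->
  P.-integrable setT (EFin \o (fun w => F (cfg w, mvt w))) ->
  (forall z1, P.-integrable setT (EFin \o (fun w => F (z1, mvt w)))) ->
  \int[P]_w F (cfg w, mvt w) = \int[P]_w \int[P]_w' F (cfg w, mvt w').
Proof.
move=> mF iF iF1; rewrite [LHS]/Rintegral.
have mFE : measurable_fun setT (EFin \o F) by exact/measurable_EFinP.
rewrite (integral_decoupling mcfg mmvt cfg_mvt mFE iF).
by congr fine; apply: eq_integral => w _; rewrite -EFin_Rintegral.
Qed.

Lemma Rintegral_cluster :
  \int[P]_w xi w = \int[P]_w \sum_(n < Nw w) G f (pos n (cfg w)).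
Proof.
rewrite (Rintegral_decoupled measurable_cluster_sum integrable_cluster).
  by apply: eq_Rintegral => w _; exact: Rintegral_cluster_sum_motion.
move=> z1; rewrite /cluster_sum/=; exact: (integrable_motion_sum (fun n => pos n z1) (N z1)).
Qed.

Lemma Rintegral_cluster_sqr : \int[P]_w (xi w ^+ 2) =
  \int[P]_w (\sum_(n < Nw w) (G (fun y => f y ^+ 2) (pos n (cfg w)) - G f (pos n (cfg w)) ^+ 2)
    + (\sum_(n < Nw w) G f (pos n (cfg w))) ^+ 2).
Proof.
rewrite (@Rintegral_decoupled (fun z => cluster_sum z ^+ 2)).
- apply: eq_Rintegral => w _; rewrite /cluster_sum/=.
  exact: (Rintegral_motion_sum_sqr (fun n => pos n (cfg w)) (Nw w)).2.
- by apply: measurable_funX; exact: measurable_cluster_sum.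
- exact: integrable_cluster_sqr.
- move=> z1; rewrite /cluster_sum/=.
  exact: (Rintegral_motion_sum_sqr (fun n => pos n z1) (N z1)).1.
Qed.

End test_function.

Local Notation m k := (\int[P]_w ((Nw w)%:R ^+ k)).

Lemma cluster_moment_le (f : R -> R) (M : R) (B : set R) (Q : R) k : (k < 3)%N ->
  measurable_fun setT f -> (forall y, `|f y| <= M) -> measurable B ->
  (forall y, ~ B y -> f y = 0) -> (forall n z1, G \1_B (pos n z1) <= Q) ->
  \int[P]_w (`|cluster_sum f (cfg w, mvt w)| ^+ k.+1) <= M ^+ k.+1 * (Q * m k.+1).
Proof.
move=> k3 mf fM mB fB GQ.
have M0 : 0 <= M by exact: le_trans (normr_ge0 _) (fM 0).
have mI : measurable_fun setT (\1_B : R -> R) by exact: measurable_indic.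
have I1 y : `|\1_B y : R| <= 1 by rewrite indicE; case: (_ \in _); rewrite ?normr1 ?normr0.
have I0 y : 0 <= (\1_B y : R) by rewrite indicE.
(* Only one of the [k.+1] factors keeps the indicator of [B]; the others are bounded by the number
   of particles. The expectation is then linear in the hitting bound [Q], at the price of the moment
   of order [k.+1] of the count. *)
pose F (z : TC * TM) := (N z.1)%:R ^+ k * cluster_sum \1_B z.
have S0 z : 0 <= cluster_sum \1_B z by rewrite sumr_ge0.
have SN z : cluster_sum \1_B z <= (N z.1)%:R.
  by have := cluster_sum_le I1 z; rewrite mul1r ger0_norm.
have F0 z : 0 <= F z by rewrite mulr_ge0 ?exprn_ge0.
have mN1 : measurable_fun setT (fun z : TC => (N z)%:R : R).
  have -> : (fun z => (N z)%:R : R) = fun z => \sum_(n < N z) 1.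
    by apply/funext => w; rewrite sumr_const card_ord.
  by apply: (@measurable_random_sum _ _ _ N (fun=> cst 1)).
have mF : measurable_fun setT F.
  apply: measurable_funM; last exact: (measurable_cluster_sum mI).
  by apply: measurable_funX; exact: (measurableT_comp mN1).
have iNk := integrable_count_pow k3.
have iF : P.-integrable setT (EFin \o (fun w => F (cfg w, mvt w))).
  apply: integrable_le iNk.
    exact: (measurableT_comp mF (measurable_fun_pair mcfg mmvt)).
  by move=> w; rewrite ger0_norm// exprSr ler_wpM2l ?exprn_ge0//; exact: SN.
have iF1 z1 : P.-integrable setT (EFin \o (fun w => F (z1, mvt w))).
  exact: (integrableZ_real ((N z1)%:R ^+ k)
    (integrable_motion_sum mI I1 (fun n => pos n z1) (N z1))).
apply: (@le_trans _ _ (\int[P]_w (M ^+ k.+1 * F (cfg w, mvt w)))).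
  apply: le_Rintegral => //.
  - exact: (integrable_cluster_pow mf fM k3).
  - exact: (integrableZ_real (M ^+ k.+1) iF).
  - move=> w _; set z := (cfg w, mvt w).
    have fI : `|cluster_sum f z| <= M * cluster_sum \1_B z.
      rewrite (le_trans (ler_norm_sum _ _ _))// mulr_sumr ler_sum// => n _.
      rewrite indicE; case: (boolP (_ \in B)) => [h|]; first by rewrite mulr1.
      by rewrite notin_setE => /fB ->; rewrite normr0 mulr0.
    apply: (@le_trans _ _ ((M * cluster_sum \1_B z) ^+ k.+1)).
      by apply: lerXn2r; rewrite ?nnegrE ?mulr_ge0.
    rewrite exprMn ler_wpM2l ?exprn_ge0// exprSr ler_wpM2r//.
    by apply: lerXn2r; rewrite ?nnegrE.
rewrite RintegralZl// ler_wpM2l ?exprn_ge0//.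
rewrite (Rintegral_decoupled mF iF iF1) -RintegralZl//.
have mGI := measurable_mean_shift P mX mI I1.
have E w : \int[P]_w' F (cfg w, mvt w') =
    (Nw w)%:R ^+ k * \sum_(n < Nw w) G \1_B (pos n (cfg w)).
  rewrite /F/= RintegralZl//.
    by rewrite (Rintegral_cluster_sum_motion mI I1).
  exact: (integrable_motion_sum mI I1 (fun n => pos n (cfg w)) (Nw w)).
have le w : (Nw w)%:R ^+ k * \sum_(n < Nw w) G \1_B (pos n (cfg w)) <= Q * (Nw w)%:R ^+ k.+1.
  rewrite exprSr mulrCA ler_wpM2l ?exprn_ge0//.
  rewrite mulr_natr -[X in _ *+ X]card_ord -sumr_const ler_sum// => n _.
have GI0 y : 0 <= G \1_B y by exact: mean_shift_ge0.
rewrite (@eq_Rintegral _ _ _ P setT (fun w => (Nw w)%:R ^+ k *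
  \sum_(n < Nw w) G \1_B (pos n (cfg w)))); last by move=> w _; exact: E.
apply: le_Rintegral => //; last exact: integrableZ_real.
apply: integrable_le (integrableZ_real Q iNk).
  apply: measurable_funM.
    by apply: measurable_funX; exact: measurable_natr_random.
  apply: (@measurable_random_sum _ _ _ Nw (fun n w => G \1_B (pos n (cfg w)))) => // n.
  apply: measurableT_comp => //.
  exact: measurableT_comp.
by move=> w; rewrite ger0_norm// mulr_ge0 ?exprn_ge0 ?sumr_ge0.
Qed.

Section closeness.
Variables (f : R -> R) (M : R) (a a2 e : R).
Hypotheses (mf : measurable_fun setT f) (fM : forall y, `|f y| <= M).
Hypotheses (aM : `|a| <= M) (e0 : 0 <= e).
Hypothesis Ga : forall n z1, `|G f (pos n z1) - a| <= e.
Hypothesis Ga2 : forall n z1, `|G (fun y => f y ^+ 2) (pos n z1) - a2| <= e.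

Let M0 : 0 <= M. Proof. exact: le_trans (normr_ge0 _) (fM 0). Qed.

Let mG : measurable_fun setT (G f).
Proof. exact: (measurable_mean_shift P mX mf fM). Qed.

Let f2M y : `|f y ^+ 2| <= M ^+ 2.
Proof. by rewrite normrX lerXn2r ?nnegrE. Qed.

Let mG2 : measurable_fun setT (G (fun y => f y ^+ 2)).
Proof. by apply: (measurable_mean_shift P mX _ f2M); exact: measurable_funX. Qed.

Let GM y : `|G f y| <= M. Proof. exact: mean_shift_norm_le. Qed.

Let G2M y : `|G (fun y => f y ^+ 2) y| <= M ^+ 2.
Proof. by apply: mean_shift_norm_le => //; exact: measurable_funX. Qed.

Let iN1 := integrable_count_pow (isT : (1 <= 3)%N).
Let iN2 := integrable_count_pow (isT : (2 <= 3)%N).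

Let mposw n : measurable_fun setT (fun w => pos n (cfg w)).
Proof. exact: measurableT_comp. Qed.

Let mrs (g : R -> R) : measurable_fun setT g ->
  measurable_fun setT (fun w => \sum_(n < Nw w) g (pos n (cfg w))).
Proof.
move=> mg; apply: (@measurable_random_sum _ _ _ Nw (fun n w => g (pos n (cfg w)))) => // n.
exact: measurableT_comp.
Qed.

Let sum_le (g : R -> R) C w : (forall y, `|g y| <= C) ->
  `|\sum_(n < Nw w) g (pos n (cfg w))| <= C * (Nw w)%:R.
Proof.
move=> gC; rewrite (le_trans (ler_norm_sum _ _ _))// mulr_natr.
by rewrite -[X in _ *+ X]card_ord -sumr_const ler_sum.
Qed.

Let sum_close (g : R -> R) b C w : (forall n z1, `|g (pos n z1) - b| <= C) ->
  `|\sum_(n < Nw w) g (pos n (cfg w)) - (Nw w)%:R * b| <= C * (Nw w)%:R.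
Proof.
move=> gC; rewrite mulr_natl -[in X in `|_ - X|](card_ord (Nw w)) -sumr_const -sumrB.
rewrite (le_trans (ler_norm_sum _ _ _))// mulr_natr.
by rewrite -[X in _ *+ X]card_ord -sumr_const ler_sum.
Qed.

Lemma cluster_mean_close :
  `|\int[P]_w cluster_sum f (cfg w, mvt w) - m 1 * a| <= e * m 1.
Proof.
rewrite (Rintegral_cluster mf fM).
have i1 : P.-integrable setT (EFin \o (fun w => \sum_(n < Nw w) G f (pos n (cfg w)))).
  apply: integrable_le (integrableZ_real M iN1).
    by exact: mrs.
  by move=> w; rewrite expr1; exact: sum_le.
have i2 : P.-integrable setT (EFin \o (fun w => (Nw w)%:R ^+ 1 * a)).
  have := integrableZ_real a iN1; apply: eq_integrable => // w _ /=.
  by rewrite mulrC.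
rewrite -RintegralZr// -RintegralB//.
apply: (le_trans (le_normr_Rintegral measurableT (integrableB_real i1 i2))).
rewrite -RintegralZl//; apply: le_Rintegral => //.
- exact/integrable_norm_real/integrableB_real.
- exact: integrableZ_real.
- by move=> w _; rewrite expr1; exact: sum_close.
Qed.

(** If all particles of the cell started at one point, with [a] and [a2] the averages of [f] and
    [f ^+ 2] seen from there, the second moment would be exactly the subtracted expression: given
    the count, the sum of the variances plus the square of the mean. *)
Lemma cluster_sqr_close :
  `|\int[P]_w (cluster_sum f (cfg w, mvt w) ^+ 2) - (m 1 * (a2 - a ^+ 2) + m 2 * a ^+ 2)|
  <= e * ((1 + 2 * M) * m 1 + 2 * M * m 2).
Proof.
rewrite (Rintegral_cluster_sqr mf fM).
pose g y := G (fun y => f y ^+ 2) y - G f y ^+ 2.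
have mg : measurable_fun setT g by apply: measurable_funB => //; exact: measurable_funX.
have gM y : `|g y| <= M ^+ 2 + M ^+ 2.
  rewrite (le_trans (ler_normB _ _))// lerD// normrX lerXn2r ?nnegrE//.
have i1 : P.-integrable setT (EFin \o (fun w => \sum_(n < Nw w) g (pos n (cfg w)))).
  apply: integrable_le (integrableZ_real (M ^+ 2 + M ^+ 2) iN1).
    by exact: mrs.
  by move=> w; rewrite expr1; exact: sum_le.
have i2 : P.-integrable setT (EFin \o (fun w => (\sum_(n < Nw w) G f (pos n (cfg w))) ^+ 2)).
  apply: integrable_le (integrableZ_real (M ^+ 2) iN2).
    apply: measurable_funX.
    by exact: mrs.
  move=> w; rewrite normrX -exprMn lerXn2r ?nnegrE ?mulr_ge0//.
  exact: sum_le.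
have iL : P.-integrable setT (EFin \o (fun w => \sum_(n < Nw w) g (pos n (cfg w)) +
  (\sum_(n < Nw w) G f (pos n (cfg w))) ^+ 2)) by exact: integrableD_real.
have j1 := integrableZ_real (a2 - a ^+ 2) iN1.
have j2 := integrableZ_real (a ^+ 2) iN2.
have -> : m 1 * (a2 - a ^+ 2) + m 2 * a ^+ 2 =
    \int[P]_w ((a2 - a ^+ 2) * (Nw w)%:R ^+ 1 + a ^+ 2 * (Nw w)%:R ^+ 2).
  by rewrite RintegralD// !RintegralZl// ![_ * Rintegral _ _ _]mulrC.
have iR := integrableD_real j1 j2.
rewrite -RintegralB//.
apply: (le_trans (le_normr_Rintegral measurableT (integrableB_real iL iR))).
have k1 := integrableZ_real (1 + 2 * M) iN1.
have k2 := integrableZ_real (2 * M) iN2.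
have -> : e * ((1 + 2 * M) * m 1 + 2 * M * m 2) =
    \int[P]_w (e * ((1 + 2 * M) * (Nw w)%:R ^+ 1 + 2 * M * (Nw w)%:R ^+ 2)).
  by rewrite RintegralZl ?RintegralD ?RintegralZl//; exact: integrableD_real.
apply: le_Rintegral => //.
- exact/integrable_norm_real/integrableB_real.
- by apply: integrableZ_real; exact: integrableD_real.
move=> w _; rewrite expr1.
(* The difference of squares factors, and both [a] and [G f] are bounded by [M], whence the 2 M. *)
have gc n z1 : `|g (pos n z1) - (a2 - a ^+ 2)| <= e * (1 + 2 * M).
  have -> : g (pos n z1) - (a2 - a ^+ 2) = (G (fun y => f y ^+ 2) (pos n z1) - a2) -
    (G f (pos n z1) - a) * (G f (pos n z1) + a) by rewrite /g; ring.
  rewrite (le_trans (ler_normB _ _))// [leRHS]mulrDr mulr1 lerD// normrM ler_pM//.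
  by rewrite (le_trans (ler_normD _ _))// mulrDl mul1r lerD.
have c1 := sum_close w gc.
have c2 := sum_close w Ga.
have c3 := sum_le w GM.
set A := \sum_(n < Nw w) g _ in c1 *; set B := \sum_(n < Nw w) G f _ in c2 c3 *.
set n := (Nw w)%:R in c1 c2 c3 *.
have n0 : 0 <= n by rewrite /n.
have -> : A + B ^+ 2 - ((a2 - a ^+ 2) * n + a ^+ 2 * n ^+ 2) =
  (A - n * (a2 - a ^+ 2)) + (B - n * a) * (B + n * a) by ring.
rewrite (le_trans (ler_normD _ _))// [leRHS]mulrDr lerD//; first by rewrite mulrA.
have -> : e * (2 * M * n ^+ 2) = (e * n) * (M * n + n * M) by ring.
rewrite normrM ler_pM// (le_trans (ler_normD _ _))// lerD// normrM ger0_norm//.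
by rewrite ler_wpM2l.
Qed.

End closeness.
End cluster.

(** * Invariance of Lebesgue measure, and Fubini for random shifts *)

Section lebesgue_reflection.
Variable R : realType.
Local Notation mu := (@lebesgue_measure R).

Let refl (c : R) : measurableTypeR R -> measurableTypeR R := fun x => c - x.

Let mrefl c : measurable_fun setT (refl c).
Proof. exact: measurable_funB. Qed.

(** Uniqueness of Lebesgue measure reduces this to half-open intervals; reflection changes the
    closed end but not the length. *)
Lemma lebesgue_measure_reflect (c : R) (A : set (measurableTypeR R)) : measurable A ->
  mu ((fun x => c - x) @^-1` A) = mu A.
Proof.
move=> mA; apply/esym.
pose m' : {measure set (measurableTypeR R) -> \bar R} := pushforward mu (refl c).
rewrite (@lebesgue_measure_unique R (m' (mrefl c)))// => _ [[a b] _ <-]; rewrite /m'/=.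
rewrite /pushforward/= lebesgue_measure_itv/=.
have -> : refl c @^-1` `]a, b]%classic = `[c - b, c - a[%classic.
  apply/seteqP; split => x /=; rewrite /refl !in_itv/=; lra.
rewrite lebesgue_measure_itv/= !lte_fin.
have -> : (c - b < c - a) = (a < b) by rewrite ltrD2l ltrN2.
by case: ifP => // _; rewrite -!EFinD; congr (_%:E); ring.
Qed.

Lemma integral_reflect (c : R) (f : R -> \bar R) : measurable_fun setT f ->
  (\int[mu]_x f (c - x)%R = \int[mu]_x f x)%E.
Proof.
move=> mf.
transitivity (\int[pushforward mu (refl c)]_x f x)%E.
  by rewrite integral_pushforward_measurable.
by apply: eq_measure_integral => A mA _; exact: lebesgue_measure_reflect.
Qed.

(** A translation is the composition of two reflections. *)
Lemma integral_shift (c : R) (f : R -> \bar R) : measurable_fun setT f ->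
  (\int[mu]_x f (x + c)%R = \int[mu]_x f x)%E.
Proof.
move=> mf; rewrite -[RHS](integral_reflect c)//.
rewrite -[RHS](integral_reflect 0); last first.
  by apply: measurableT_comp => //; exact: measurable_funB.
by apply: eq_integral => x _; rewrite sub0r opprK addrC.
Qed.

Lemma Rintegral_reflect (c : R) (f : R -> R) : measurable_fun setT f ->
  \int[mu]_x f (c - x) = \int[mu]_x f x.
Proof.
move=> mf; congr fine; apply: (integral_reflect c (f := EFin \o f)).
exact/measurable_EFinP.
Qed.

Lemma Rintegral_shift (c : R) (f : R -> R) : measurable_fun setT f ->
  \int[mu]_x f (x + c) = \int[mu]_x f x.
Proof.
move=> mf; congr fine; apply: (integral_shift c (f := EFin \o f)).
exact/measurable_EFinP.
Qed.

Lemma integrable_lebesgue_shift (c : R) (f : R -> R) : mu.-integrable setT (EFin \o f) ->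
  mu.-integrable setT (EFin \o (fun x => f (x + c))).
Proof.
move=> /integrableP[mf fi]; apply/integrableP; split.
  by apply: (measurableT_comp mf); exact: measurable_funD.
rewrite (integral_shift c (f := fun x => `|(f x)%:E|%E))//.
exact: measurableT_comp.
Qed.

End lebesgue_reflection.

Lemma Rintegral_Fubini d1 (T1 : measurableType d1) d2 (T2 : measurableType d2)
    (R : realType) (m1 : {sigma_finite_measure set T1 -> \bar R})
    (m2 : {sigma_finite_measure set T2 -> \bar R}) (F : T1 * T2 -> R) :
  measurable_fun setT F ->
  (\int[m2]_y \int[m1]_x `|(F (x, y))%:E| < +oo)%E ->
  (forall x, m2.-integrable setT (EFin \o (fun y => F (x, y)))) ->
  (forall y, m1.-integrable setT (EFin \o (fun x => F (x, y)))) ->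
  \int[m1]_x \int[m2]_y F (x, y) = \int[m2]_y \int[m1]_x F (x, y).
Proof.
move=> mF Ffin F2 F1.
have mFE : measurable_fun setT (EFin \o F) by exact/measurable_EFinP.
have iF : (m1 \x m2)%E.-integrable setT (EFin \o F) by exact/integrable21ltyP.
rewrite /Rintegral; congr fine.
transitivity (\int[m1]_x \int[m2]_y (F (x, y))%:E)%E.
  by apply: eq_integral => x _; rewrite -EFin_Rintegral//.
rewrite (Fubini iF); apply: eq_integral => y _.
by rewrite -EFin_Rintegral.
Qed.

Section mean_shift_integral.
Variable R : realType.
Context d (T : measurableType d) (P : probability T R).
Variable X : T -> R.
Hypothesis mX : measurable_fun setT X.
Local Notation mu := (@lebesgue_measure R).
Local Notation G := (mean_shift P X).

Let mshift (f : R -> R) : measurable_fun setT f ->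
  measurable_fun setT (fun z : measurableTypeR R * T => f (z.1 + X z.2)).
Proof.
move=> mf; apply: measurableT_comp => //.
apply: measurable_funD; first exact: measurable_fst.
exact: measurableT_comp.
Qed.

Lemma mean_shift_abs_lty (f : R -> R) : mu.-integrable setT (EFin \o f) ->
  (\int[P]_w \int[mu]_x `|(f (x + X w)%R)%:E| < +oo)%E.
Proof.
move=> intf; have /integrableP[mf fi] := intf.
rewrite (eq_integral (fun=> \int[mu]_x `|(f x)%:E|)%E); last first.
  move=> w _; rewrite (integral_shift (X w) (f := fun x => `|(f x)%:E|%E))//.
  exact: measurableT_comp.
rewrite integral_cst//= probability_setT mule1//.
Qed.

Lemma integrable_mean_shift (f : R -> R) M : measurable_fun setT f ->
  (forall y, `|f y| <= M) ->
  mu.-integrable setT (EFin \o f) -> mu.-integrable setT (EFin \o G f).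
Proof.
move=> mf fM intf; apply/integrableP; split.
  by apply/measurable_EFinP; exact: (measurable_mean_shift P mX mf fM).
apply: le_lt_trans (mean_shift_abs_lty intf).
have mF : measurable_fun setT (fun z : measurableTypeR R * T => `|(f (z.1 + X z.2)%R)%:E|%E).
  by apply: measurableT_comp => //; apply/measurable_EFinP; exact: mshift.
have F0 (z : measurableTypeR R * T) : (0 <= `|(f (z.1 + X z.2)%R)%:E|)%E by [].
rewrite -[leRHS](@fubini_tonelli _ _ _ _ _ mu P _ mF F0).
apply: ge0_le_integral => //.
- apply: measurableT_comp => //.
  by apply/measurable_EFinP; exact: (measurable_mean_shift P mX mf fM).
- exact: (@measurable_fun_fubini_tonelli_F _ _ _ _ _ P _ mF F0).
move=> x _ /=; have i := @integrable_shift _ _ _ P X mX f M x mf fM.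
rewrite /mean_shift -abse_EFin EFin_Rintegral//.
by apply: le_abse_integral => //; have /integrableP[] := i.
Qed.

Lemma Rintegral_mean_shift (f : R -> R) M : measurable_fun setT f ->
  (forall y, `|f y| <= M) -> mu.-integrable setT (EFin \o f) ->
  \int[mu]_x G f x = \int[mu]_x f x.
Proof.
move=> mf fM intf.
rewrite /mean_shift (@Rintegral_Fubini _ _ _ _ _ mu P (fun z => f (z.1 + X z.2)))/=.
- rewrite -[RHS](Rintegral_cst_probability P).
  by apply: eq_Rintegral => w _; exact: Rintegral_shift.
- exact: mshift.
- exact: mean_shift_abs_lty.
- by move=> x; exact: (@integrable_shift _ _ _ P X mX f M x mf fM).
- by move=> w; exact: integrable_lebesgue_shift.
Qed.

End mean_shift_integral.

(** * Series over cells as Lebesgue integrals *)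

Section cell_series.
Variable R : realType.
Local Notation mu := (@lebesgue_measure R).
Variables (e : nat -> int) (c : R).
Hypotheses (e_bij : bijective e) (c0 : 0 < c).

Definition cell (j : int) : set (measurableTypeR R) :=
  `[c^-1 * j%:~R, c^-1 * (j + 1)%:~R[%classic.

Lemma cell_floor x j : cell j x <-> Num.floor (c * x) = j.
Proof.
rewrite /cell/= in_itv/= ler_pdivrMl// ltr_pdivlMl//; split.
  by move=> h; apply/eqP; rewrite floor_eq.
by move=> <-; exact: floor_itv.
Qed.

Lemma lebesgue_measure_cell j : mu (cell j) = (c^-1)%:E.
Proof.
rewrite /cell lebesgue_measure_itv/= lte_fin ltr_pM2l ?invr_gt0// ltr_int ltrDl ltr01.
by rewrite -EFinD -mulrBr rmorphD/= addrAC subrr add0r mulr1.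
Qed.

Lemma measurable_floor_comp (V : int -> R) :
  measurable_fun setT (fun x : measurableTypeR R => V (Num.floor (c * x))).
Proof.
move=> _ B mB; rewrite setTI.
have -> : (fun x => V (Num.floor (c * x))) @^-1` B =
    \bigcup_(k in [set k | B (V (e k))]) cell (e k).
  apply/seteqP; split => [x Bx|x [k Bk /cell_floor]].
    have [e' ee' e'e] := e_bij.
    exists (e' (Num.floor (c * x))); first by rewrite /= e'e.
    by apply/cell_floor; rewrite e'e.
  by move=> /= ->.
by apply: bigcup_measurable => k _; exact: measurable_itv.
Qed.

(** The integrand is constant on each cell, the cells partition the line, and each has length
    [c^-1]. *)
Lemma cell_series_integral (V : int -> R) : (forall j, 0 <= V j) ->
  (\int[mu]_x (V (Num.floor (c * x)%R))%:E = \sum_(k <oo) (c^-1 * V (e k))%R%:E)%E.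
Proof.
move=> V0.
have covers : \bigcup_k cell (e k) = setT.
  apply/seteqP; split => // x _; have [e' ee' e'e] := e_bij.
  by exists (e' (Num.floor (c * x))) => //; apply/cell_floor; rewrite e'e.
have disj : trivIset setT (fun k => cell (e k)).
  move=> k l _ _ [x [/cell_floor kx /cell_floor lx]].
  by apply: (bij_inj e_bij); rewrite -kx -lx.
rewrite -covers ge0_integral_bigcup//.
- apply: eq_eseriesr => k _.
  rewrite (eq_integral (fun=> (V (e k))%:E)); last first.
    by move=> x /set_mem /cell_floor ->.
  rewrite integral_cst; last exact: measurable_itv.
  transitivity ((V (e k))%:E * (c^-1)%:E)%E; last by rewrite -EFinM mulrC.
  congr (_ * _)%E; exact: lebesgue_measure_cell.
- by move=> k; exact: measurable_itv.
- by rewrite covers; apply/measurable_EFinP; exact: measurable_floor_comp.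
- by move=> x _; rewrite lee_fin.
Qed.

Variables (V : int -> R) (q : R -> R).
Hypothesis V0 : forall j, 0 <= V j.
Hypothesis Vq : forall j x, cell j x -> V j <= q x.
Hypothesis iq : mu.-integrable setT (EFin \o q).

Lemma floor_comp_le x : `|V (Num.floor (c * x))| <= q x.
Proof. by rewrite ger0_norm//; apply: Vq; apply/cell_floor. Qed.

Lemma integrable_floor_comp :
  mu.-integrable setT (EFin \o (fun x => V (Num.floor (c * x)))).
Proof.
apply: integrable_le iq; first exact: measurable_floor_comp.
exact: floor_comp_le.
Qed.

Lemma cell_series_cvg : (\sum_(k < n) c^-1 * V (e k)) @[n --> \oo] -->
  \int[mu]_x V (Num.floor (c * x)).
Proof.
have t0 k : (0 <= (c^-1 * V (e k))%R%:E)%E by rewrite lee_fin mulr_ge0// invr_ge0 ltW.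
have : (\sum_(0 <= k < n) (c^-1 * V (e k))%R%:E)%E @[n --> \oo] -->
    (\int[mu]_x V (Num.floor (c * x)))%:E.
  rewrite EFin_Rintegral; last exact: integrable_floor_comp.
  rewrite cell_series_integral//.
  by apply: is_cvg_nneseries => k _ _.
move=> /fine_cvgP[_]; apply: cvg_trans; apply: near_eq_cvg; apply: nearW => n /=.
by rewrite sumEFin/= big_mkord.
Qed.

(** The right-hand side involves neither the number of cells nor their length, which is the source
    of all uniform bounds below. *)
Lemma cell_series_le n : \sum_(k < n) c^-1 * V (e k) <= \int[mu]_x q x.
Proof.
apply: (@le_trans _ _ (\int[mu]_x V (Num.floor (c * x)))); last first.
  apply: le_Rintegral => //; first exact: integrable_floor_comp.
  by move=> x _; rewrite (le_trans _ (floor_comp_le x))// ler_norm.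
have nd : {homo (fun n => \sum_(k < n) c^-1 * V (e k)) : i j / (i <= j)%N >-> i <= j}.
  apply/nondecreasing_seqP => i; rewrite big_ord_recr/= lerDl mulr_ge0//.
  by rewrite invr_ge0 ltW.
rewrite -(cvg_lim (@Rhausdorff R) cell_series_cvg).
apply: (nondecreasing_cvgn_le nd).
by apply/cvg_ex; eexists; exact: cell_series_cvg.
Qed.

End cell_series.

(** * Joint independence of the cells and the motions *)

Section particle_system.
Context d (Omega : measurableType d) (R : realType) (P : probability Omega R).
Variables (theta : int -> {RV P >-> nat})
  (rho : int -> forall k : nat, 'I_k -> {RV P >-> R})
  (vartheta : int -> nat -> R -> {RV P >-> R}).

(** These events lie both in the sigma-algebra of cell [j], to which [hcells] applies, and in that
    of the configuration, to which [hmotions] applies. They see only the vector whose length is the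
    actual count. *)
Definition cell_events (j : int) : set (set Omega) :=
  [set A | exists (k : nat) (B : 'I_k -> set R), (forall i, measurable (B i)) /\
     A = [set w | theta j w = k /\ forall i, B i (rho j i w)]].

(** One index type for all sources of randomness: [(j, None)] is the configuration of cell [j] and
    [(j, Some n)] is the motion of its particle [n]. *)
Definition source_events (i : int * option nat) : set (set Omega) :=
  if i.2 is Some n then sigma_process (vartheta i.1 n) else <<s cell_events i.1 >>.

Lemma sigma_algebra_source_events i : sigma_algebra setT (source_events i).
Proof. by case: i => j [n|]; exact: smallest_sigma_algebra. Qed.

Lemma cell_eventE j k (B : 'I_k -> set R) :
  [set w | theta j w = k /\ forall i, B i (rho j i w)] =
  theta j @^-1` [set k] `&` \big[setI/setT]_(i < k) (rho j i @^-1` B i).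
Proof.
apply/seteqP; split => w /=.
  by move=> [tk Bw]; split => //; apply/bigsetI_seqP => i _; exact: Bw.
move=> [tk /bigsetI_seqP Bw]; split => // i.
by apply: Bw; exact: mem_index_enum.
Qed.

Lemma cell_events_sub (G : set (set Omega)) j :
  (forall k, <<s G >> (theta j @^-1` [set k])) ->
  (forall k (i : 'I_k) B, measurable B -> <<s G >> (rho j i @^-1` B)) ->
  <<s cell_events j >> `<=` <<s G >>.
Proof.
move=> Gt Gr; apply: smallest_sub; first exact: smallest_sigma_algebra.
move=> _ [k [B [mB ->]]]; rewrite cell_eventE.
have := @measurableI _ (g_sigma_algebraType G) _ _ (Gt k)
  (@bigsetI_measurable _ (g_sigma_algebraType G) _ (index_enum 'I_k) xpredT
    (fun i => rho j i @^-1` B i) _).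
by apply => i _; exact: Gr.
Qed.

Lemma cell_events_sub_cell j : <<s cell_events j >> `<=` sigma_cell theta rho j.
Proof.
apply: cell_events_sub => [k|k i B mB].
  apply: sub_sigma_algebra; left; exists [set k] => //; by rewrite setTI.
apply: sub_sigma_algebra; right; exists k => //; exists i => //.
by exists B => //; rewrite setTI.
Qed.

Lemma cell_events_sub_config j : <<s cell_events j >> `<=` sigma_config theta rho.
Proof.
by apply: sub_sigma_algebra2 => A [k [B [mB ->]]]; exists j, k, B.
Qed.

Lemma source_events_measurable i : source_events i `<=` measurable.
Proof.
case: i => j [n|].
  apply: sigma_sub_measurable => A [t _ [B mB <-]]; rewrite setTI.
  exact: measurable_funPTI.
apply: sigma_sub_measurable => A [k [B [mB ->]]]; rewrite cell_eventE.
apply: measurableI; first exact: measurable_funPTI.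
by apply: bigsetI_measurable => i _; exact: measurable_funPTI.
Qed.

Hypothesis hcells : mutual_indep P (sigma_cell theta rho).
Hypothesis hmotions : independent_motions theta rho vartheta.

(** [hmotions] separates the motions from each other and from the intersection of all cell events,
    which is a single event of the configuration. [hcells] then factors that intersection. *)
Lemma mutual_indep_source_events : mutual_indep P source_events.
Proof.
move=> s A us sA.
pose cells := [seq i.1 | i <- s & i.2 == None].
pose motion (i : int * option nat) : option (int * nat) := omap (pair i.1) i.2.
pose motions := [seq motion i | i <- s & i.2 != None].
pose A1 j := A (j, None).
(* At index [None] all selected cell events are merged into one. *)
pose A2 (a : option (int * nat)) :=
  if a is Some (j, n) then A (j, Some n) else \big[setI/setT]_(j <- cells) A1 j.
have splitE (T : Type) (x : T) (op : Monoid.com_law x) (G : int * option nat -> T) :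
    \big[op/x]_(i <- s) G i =
    op (\big[op/x]_(j <- cells) G (j, None))
      (\big[op/x]_(a <- motions) (if a is Some (j, n) then G (j, Some n) else x)).
  rewrite (bigID (fun i => i.2 == None))/= /cells /motions !big_map !big_filter.
  congr (op _ _); apply: eq_bigr => -[j [n|]]//.
have umotions : uniq (None :: motions).
  rewrite /= map_inj_in_uniq ?filter_uniq ?andbT//.
    by apply/mapP => -[[j [n|]]]//; rewrite mem_filter.
  move=> [j [n|]] [k [l|]]; rewrite !mem_filter//= => _ _ [-> ->]//.
have ucells : uniq cells.
  rewrite map_inj_in_uniq ?filter_uniq//.
  by move=> [j [n|]] [k [l|]]; rewrite !mem_filter//= => _ _ ->.
have cA j : j \in cells -> <<s cell_events j >> (A1 j).
  move=> /mapP[[k [n|]]]; rewrite mem_filter//= => ks ->.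
  by have := sA _ ks.
have bigE : \big[setI/setT]_(i <- s) A i =
    \big[setI/setT]_(a <- None :: motions) A2 a.
  rewrite splitE big_cons/=; congr (_ `&` _).
  rewrite big_seq [RHS]big_seq; apply: eq_bigr => -[[j n]//|].
  by move=> Nm; move: umotions; rewrite /= Nm.
rewrite bigE hmotions//; last first.
  move=> [[j n]|] /=; rewrite inE.
    move=> /= /mapP[[k [l|]]]; rewrite mem_filter//= => ks [-> ->].
    by have := sA _ ks.
  move=> _; rewrite big_seq.
  apply: (@bigsetI_measurable _ (g_sigma_algebraType _)) => j /cA.
  exact: cell_events_sub_config.
rewrite big_cons splitE/= hcells//; last by move=> j /cA; exact: cell_events_sub_cell.
congr (_ * _)%E; rewrite big_seq [RHS]big_seq; apply: eq_bigr => -[[j n]//|].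
by move=> Nm; move: umotions; rewrite /= Nm.
Qed.

(** [Omega] with the sigma-algebra generated by these events is the target of the identity map. A
    group of sources thus becomes one random element, to which independence and decoupling apply. *)
Definition joint_events (K : set (int * option nat)) : set (set Omega) :=
  \bigcup_(i in K) source_events i.

Local Notation sources K := (g_sigma_algebraType (joint_events K)).

Lemma source_events_sources K i A : K i -> source_events i A ->
  measurable (A : set (sources K)).
Proof. by move=> Ki iA; apply: sub_sigma_algebra; exists i. Qed.

Lemma measurable_to_sources K : measurable_fun setT (id : Omega -> sources K).
Proof.
move=> _ A mA; rewrite setTI; apply: sigma_sub_measurable mA.
by move=> B [i _]; exact: source_events_measurable.
Qed.

Lemma independent_sources K1 K2 : (forall i, K1 i -> ~ K2 i) ->
  independent_pair P (id : Omega -> sources K1) (id : Omega -> sources K2).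
Proof.
move=> K12 A B mA mB.
apply: (mutual_indep_groups sigma_algebra_source_events source_events_measurable
  mutual_indep_source_events K12) => //.
Qed.

Lemma measurable_motion K j n t : 0 <= t -> K (j, Some n) ->
  measurable_fun setT (vartheta j n t : sources K -> R).
Proof.
move=> t0 Kj _ B mB; rewrite setTI; apply: (source_events_sources Kj).
apply: sub_sigma_algebra; exists t => //.
by exists B => //; rewrite setTI.
Qed.

Lemma measurable_count K j : K (j, None) ->
  measurable_fun setT (theta j : sources K -> nat).
Proof.
move=> Kj _ B _; rewrite setTI.
pose E k : set (sources K) := [set w : Omega | theta j w = k /\
    forall i : 'I_k, [set: R] (rho j i w)].
have -> : theta j @^-1` B = \bigcup_(k in B) E k.
  apply/seteqP; split => [w Bw|w [k Bk [tk _]]]; first by exists (theta j w).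
  by rewrite /preimage/= tk.
have mE k : B k -> measurable (E k).
  move=> _; apply: (source_events_sources Kj).
  by apply: sub_sigma_algebra; exists k, (fun=> setT).
exact: (bigcup_measurable mE).
Qed.

(* The position, before rescaling, of the [n]-th particle of cell [j], set to
  the left end of the cell if there is no such particle. *)
Definition particle_site (j : int) (n : nat) (w : Omega) : R :=
  if insub n is Some i then rho j (i : 'I_(theta j w)) w else j%:~R.

Lemma measurable_particle_site K j n : K (j, None) ->
  measurable_fun setT (particle_site j n : sources K -> R).
Proof.
move=> Kj _ B mB; rewrite setTI.
pose C k (i : 'I_k) : set R := if (i : nat) == n then B else setT.
pose E k : set (sources K) :=
  [set w : Omega | theta j w = k /\ forall i : 'I_k, C k i (rho j i w)].
have -> : particle_site j n @^-1` B = \bigcup_(k in [set k | (k <= n)%N -> B j%:~R]) E k.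
  apply/seteqP; split => [w|w [_ /[swap] [[<-]]]].
    rewrite /particle_site/=; case: insubP => [i _ iE|]/= Bw.
      exists (theta j w); first by rewrite /= leqNgt -iE ltn_ord.
      split => // i'; rewrite /C; case: eqP => // i'n.
      by have -> : i' = i by apply/val_inj; rewrite /= i'n iE.
    move=> Bj; exists (theta j w) => //; split => // i.
    rewrite /C; case: eqP => // iE; move: Bw; rewrite -leqNgt leqNgt -iE.
    by rewrite ltn_ord.
  rewrite /particle_site/= => Cw kB; case: insubP => [i _ iE|]/=.
    by have := Cw i; rewrite /C iE eqxx.
  by rewrite -leqNgt => /kB.
have mE k : [set k | (k <= n)%N -> B j%:~R] k -> measurable (E k).
  move=> _; apply: (source_events_sources Kj).
  apply: sub_sigma_algebra; exists k, (@C k); split => // i.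
  by rewrite /C; case: ifP.
exact: (bigcup_measurable mE).
Qed.

End particle_system.

Lemma cube_add_le (R : realType) (a b : R) : 0 <= a -> 0 <= b ->
  (a + b) ^+ 3 <= 4 * (a ^+ 3 + b ^+ 3).
Proof.
move=> a0 b0; rewrite -subr_ge0.
have -> : 4 * (a ^+ 3 + b ^+ 3) - (a + b) ^+ 3 = 3 * ((a + b) * (a - b) ^+ 2) by ring.
by apply: mulr_ge0 => //; apply: mulr_ge0; [exact: addr_ge0|exact: sqr_ge0].
Qed.

(** * Bounds for the cell sums, uniform in the scale *)

Section particle_cells.
Context d (Omega : measurableType d) (R : realType) (P : probability Omega R).
Variables (theta : int -> {RV P >-> nat})
  (rho : int -> forall k : nat, 'I_k -> {RV P >-> R})
  (vartheta : int -> nat -> R -> {RV P >-> R}) (X : {RV P >-> R}) (m : nat -> R).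
Hypothesis hrho : forall (j : int) (k : nat) (i : 'I_k) (w : Omega),
  j%:~R <= rho j i w < (j + 1)%:~R.
Hypothesis hcells : mutual_indep P (sigma_cell theta rho).
Hypothesis hmotions : independent_motions theta rho vartheta.
Hypothesis hlaw : forall j n A, measurable A ->
  P (vartheta j n 1 @^-1` A) = P (X @^-1` A).
Hypothesis theta3 : forall j,
  P.-integrable setT (EFin \o (fun w => (theta j w)%:R ^+ 3 : R)).
Hypothesis theta_moment : forall j k, \int[P]_w ((theta j w)%:R ^+ k) = m k.

Local Notation sources K := (g_sigma_algebraType (joint_events theta rho vartheta K)).
Local Notation G := (mean_shift P X).
Local Notation site := (particle_site theta rho).

Lemma site_bounds j n w : j%:~R <= site j n w <= (j + 1)%:~R.
Proof.
rewrite /particle_site; case: insubP => [i _ _|_].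
  by have /andP[-> /ltW ->] := hrho j i w.
by rewrite lexx ler_int lerDl.
Qed.

(** Sites are numbered by naturals rather than by ordinals below the random count, so that each of
    them is a random variable on all of [Omega]. *)
Definition cell_sum (T : R) (f : R -> R) (j : int) (w : Omega) : R :=
  \sum_(n < theta j w) f (T^-1 * site j n w + vartheta j n 1 w).

Let one_cell (j : int) (K : set (int * option nat)) : Prop := forall o, K (j, o).

Lemma measurable_cell_sum_sources T f j K : measurable_fun setT f -> one_cell j K ->
  measurable_fun setT (cell_sum T f j : sources K -> R).
Proof.
move=> mf jK.
apply: (@measurable_random_sum _ (sources K) _ (theta j)
  (fun n w => f (T^-1 * site j n w + vartheta j n 1 w))).
  exact: measurable_count.
move=> n; apply: measurableT_comp => //; apply: measurable_funD.
  by apply: measurable_funM => //; exact: measurable_particle_site.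
exact: measurable_motion.
Qed.

Lemma measurable_cell_sum T f j : measurable_fun setT f ->
  measurable_fun setT (cell_sum T f j).
Proof.
move=> mf; have mid := @measurable_to_sources _ Omega R P theta rho vartheta setT.
have H : measurable_fun setT (cell_sum T f j : sources setT -> R).
  exact: measurable_cell_sum_sources.
exact: (measurableT_comp H mid).
Qed.

Lemma independent_cells T f (e : nat -> int) (n : nat) (a b : nat -> R) :
  injective e -> measurable_fun setT f ->
  independent_pair P (fun w => \sum_(k < n) (a k * (cell_sum T f (e k) w - b k)))
    (fun w => a n * (cell_sum T f (e n) w - b n)).
Proof.
move=> e_inj mf.
pose K1 : set (int * option nat) := [set i | exists2 k, (k < n)%N & i.1 = e k].
pose K2 : set (int * option nat) := [set i | i.1 = e n].
have K12 i : K1 i -> ~ K2 i.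
  move=> [k kn i1] i2; have kE : k = n by apply: e_inj; rewrite -i1 -i2.
  by rewrite kE ltnn in kn.
have ind := independent_sources hcells hmotions K12.
have m1 : measurable_fun setT
    (fun w : sources K1 => \sum_(k < n) (a k * (cell_sum T f (e k) w - b k))).
  apply: measurable_sum => k; apply: measurable_funM => //; apply: measurable_funB => //.
  by apply: measurable_cell_sum_sources => // o; exists k.
have m2 : measurable_fun setT
    (fun w : sources K2 => a n * (cell_sum T f (e n) w - b n)).
  apply: measurable_funM => //; apply: measurable_funB => //.
  exact: measurable_cell_sum_sources.
exact: (independent_pair_comp ind m1 m2).
Qed.

Section test_function.
Variables (f : R -> R) (M K T : R).
Hypotheses (mf : measurable_fun setT f) (fM : forall y, `|f y| <= M).
Hypotheses (fK : forall y, K < `|y| -> f y = 0) (T1 : 1 <= T).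

Let T0 : 0 < T. Proof. exact: lt_le_trans T1. Qed.
Let M0 : 0 <= M. Proof. exact: le_trans (normr_ge0 _) (fM 0). Qed.

(** The abstract cluster is instantiated with identity maps into two sigma-algebras: that of the
    configuration of cell [j], and that of its motions. *)
Let KC j : set (int * option nat) := [set (j, None)].
Let KM j : set (int * option nat) := [set i | exists n, i = (j, Some n)].

Let mcfg j := @measurable_to_sources _ Omega R P theta rho vartheta (KC j).
Let mmvt j := @measurable_to_sources _ Omega R P theta rho vartheta (KM j).

Let cfg_mvt j : independent_pair P (id : Omega -> sources (KC j)) (id : Omega -> sources (KM j)).
Proof. by apply: independent_sources => // i -> [n]. Qed.

Let mN j : measurable_fun setT (theta j : sources (KC j) -> nat).
Proof. exact: measurable_count. Qed.

Let pos j n (w : sources (KC j)) : R := T^-1 * site j n w.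

Let mpos j n : measurable_fun setT (@pos j n).
Proof. by apply: measurable_funM => //; exact: measurable_particle_site. Qed.

Let mot j n : sources (KM j) -> R := vartheta j n 1.

Let mmot j n : measurable_fun setT (@mot j n).
Proof. by apply: measurable_motion => //; exists n. Qed.

Let mot_indep j n k : n != k ->
  independent_pair P (fun w => @mot j n (id w)) (fun w => @mot j k (id w)).
Proof.
move=> nk.
pose Kn l : set (int * option nat) := [set (j, Some l)].
have Knk i : Kn n i -> ~ Kn k i.
  by move=> -> [nkE]; move: nk; rewrite nkE eqxx.
have ind := independent_sources hcells hmotions Knk.
have mv l : measurable_fun setT (vartheta j l 1 : sources (Kn l) -> R).
  exact: measurable_motion.
exact: (independent_pair_comp ind (mv n) (mv k)).
Qed.

Let cellE g j : cell_sum T g j =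
  fun w => cluster_sum (theta j) (@pos j) (@mot j) g (id w, id w).
Proof. by []. Qed.

Let law j n A : measurable A ->
  P ((fun w : Omega => @mot j n (id w)) @^-1` A) = P (X @^-1` A).
Proof. exact: hlaw. Qed.

Let mX : measurable_fun setT X. Proof. by []. Qed.

Lemma cell_pos_dist j x : cell T j x ->
  forall n w, `|T^-1 * site j n w - x| <= T^-1.
Proof.
rewrite /cell/= in_itv/= => /andP[x1 x2] n w.
have /andP[s1 s2] := site_bounds j n w.
have i0 : 0 <= T^-1 by rewrite invr_ge0 ltW.
have := ler_wpM2l i0 s1; have := ler_wpM2l i0 s2.
by rewrite intrD mulrDr mulr1 in x2 *; rewrite ler_norml; lra.
Qed.

(** The probability that a particle started at [x] ends within distance 1 of [-K, K]. As T >= 1,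
    cells have length at most 1, so this value at any point of a cell controls all particles of the
    cell, and it does not depend on [T]. *)
Definition window_prob (x : R) : R := G \1_`[- (K + 1), K + 1] x.

Lemma window_prob_bounds x : 0 <= window_prob x <= 1.
Proof.
apply/andP; split.
  by apply: mean_shift_ge0 => y; rewrite indicE.
apply: le_trans (ler_norm _) _; apply: mean_shift_norm_le => //.
by move=> y; rewrite indicE; case: (_ \in _); rewrite ?normr1 ?normr0.
Qed.

Lemma mean_shift_window j x n w : cell T j x ->
  G \1_`[- K, K] (T^-1 * site j n w) <= window_prob x.
Proof.
move=> jx; apply: le_Rintegral => //.
- apply: (@integrable_shift _ _ _ P X _ _ 1) => //.
  by move=> y; rewrite indicE; case: (_ \in _); rewrite ?normr1 ?normr0.
- apply: (@integrable_shift _ _ _ P X _ _ 1) => //.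
  by move=> y; rewrite indicE; case: (_ \in _); rewrite ?normr1 ?normr0.
move=> w' _; rewrite !indicE.
have := cell_pos_dist jx n w; set y := T^-1 * _ => yx.
have Ti : T^-1 <= 1 by rewrite invf_le1.
case: (boolP (_ + _ \in _)) => //.
rewrite !inE/= !in_itv/= => /andP[h1 h2].
suff -> : x + X w' \in `[- (K + 1), K + 1]%classic by [].
by rewrite inE/= in_itv/=; move: yx; rewrite ler_norml; lra.
Qed.

Lemma cell_sum_moment_le j x k : (k < 3)%N -> cell T j x ->
  \int[P]_w (`|cell_sum T f j w| ^+ k.+1) <= M ^+ k.+1 * (window_prob x * m k.+1).
Proof.
move=> k3 jx; rewrite -(theta_moment j) cellE.
have mB : measurable (`[- K, K]%classic : set R) by exact: measurable_itv.
have fB y : ~ `[- K, K]%classic y -> f y = 0.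
  by rewrite /= in_itv/= -ler_norml => /negP; rewrite -ltNge; exact: fK.
have GB n w : G \1_`[- K, K] (@pos j n w) <= window_prob x by exact: mean_shift_window.
have H := cluster_moment_le (@mcfg j) (@mmvt j) (@cfg_mvt j) (@mN j) (@mpos j) (@mmot j)
  mX (@law j) (theta3 j) k3 mf fM mB fB GB.
exact: H.
Qed.

Lemma integrable_cell_sum_pow j k : (k <= 3)%N ->
  P.-integrable setT (EFin \o (fun w => `|cell_sum T f j w| ^+ k)).
Proof.
rewrite cellE; exact: (integrable_cluster_pow (@mcfg j) (@mmvt j) (@mN j) (@mpos j)
  (@mmot j) (theta3 j) mf fM).
Qed.

Lemma cell_mean_close j a e :
  (forall n w, `|G f (T^-1 * site j n w) - a| <= e) ->
  `|\int[P]_w cell_sum T f j w - m 1 * a| <= e * m 1.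
Proof.
move=> Ga; rewrite -(theta_moment j) cellE.
exact: (cluster_mean_close (@mcfg j) (@mmvt j) (@cfg_mvt j) (@mN j) (@mpos j) (@mmot j)
  mX (@law j) (theta3 j) mf fM Ga).
Qed.

Lemma cell_sqr_close j a a2 e : `|a| <= M ->
  (forall n w, `|G f (T^-1 * site j n w) - a| <= e) ->
  (forall n w, `|G (fun y => f y ^+ 2) (T^-1 * site j n w) - a2| <= e) ->
  `|\int[P]_w (cell_sum T f j w ^+ 2) - (m 1 * (a2 - a ^+ 2) + m 2 * a ^+ 2)|
    <= e * ((1 + 2 * M) * m 1 + 2 * M * m 2).
Proof.
move=> aM Ga Ga2; rewrite -!(theta_moment j) cellE.
exact: (cluster_sqr_close (@mcfg j) (@mmvt j) (@cfg_mvt j) (@mN j) (@mpos j) (@mmot j)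
  mX (@law j) (@mot_indep j) (theta3 j) mf fM aM Ga Ga2).
Qed.

Lemma integrable_cell_sum j : P.-integrable setT (EFin \o cell_sum T f j).
Proof.
apply: integrable_le (integrable_cell_sum_pow j (isT : (1 <= 3)%N)).
  exact: measurable_cell_sum.
by move=> w; rewrite expr1.
Qed.

Lemma integrable_cell_sum_sqr j :
  P.-integrable setT (EFin \o (fun w => cell_sum T f j w ^+ 2)).
Proof.
apply: integrable_le (integrable_cell_sum_pow j (isT : (2 <= 3)%N)).
  by apply: measurable_funX; exact: measurable_cell_sum.
by move=> w; rewrite normrX.
Qed.

Lemma moment_ge0 k : 0 <= m k.
Proof. by rewrite -(theta_moment 0); apply: Rintegral_ge0 => w _; exact: exprn_ge0. Qed.

Local Notation mean j := (\int[P]_w cell_sum T f j w).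

Definition cell_var (j : int) : R := \int[P]_w ((cell_sum T f j w - mean j) ^+ 2).

Definition cell_dev3 (j : int) : R := \int[P]_w (`|cell_sum T f j w - mean j| ^+ 3).

Lemma integrable_cell_centered_sqr j :
  P.-integrable setT (EFin \o (fun w => (cell_sum T f j w - mean j) ^+ 2)).
Proof.
have i2 := integrable_cell_sum_sqr j.
apply: (integrable_le _ _ (integrableD_real (integrableZ_real 2 i2)
  (integrable_cst_probability P (2 * mean j ^+ 2)))).
  by apply: measurable_funX; apply: measurable_funB => //; exact: measurable_cell_sum.
move=> w /=; rewrite ger0_norm ?sqr_ge0//.
by have := sqr_ge0 (cell_sum T f j w + mean j); nra.
Qed.

Lemma cell_varE j : cell_var j = \int[P]_w (cell_sum T f j w ^+ 2) - mean j ^+ 2.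
Proof.
have i1 := integrable_cell_sum j; have i2 := integrable_cell_sum_sqr j.
rewrite /cell_var.
transitivity (\int[P]_w (cell_sum T f j w ^+ 2 +
    (mean j ^+ 2 - 2 * mean j * cell_sum T f j w))).
  by apply: eq_Rintegral => w _; ring.
have i3 := integrableZ_real (2 * mean j) i1.
have i4 := integrable_cst_probability P (mean j ^+ 2).
rewrite RintegralD//; last exact: integrableB_real.
have -> : \int[P]_w (mean j ^+ 2 - 2 * mean j * cell_sum T f j w) =
    \int[P]_w (mean j ^+ 2) - 2 * mean j * mean j.
  by rewrite RintegralB//; congr (_ - _); exact: RintegralZl.
by rewrite Rintegral_cst_probability; ring.
Qed.

Lemma cell_var_ge0 j : 0 <= cell_var j.
Proof. by apply: Rintegral_ge0 => w _; exact: sqr_ge0. Qed.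

Lemma cell_var_le j x : cell T j x -> cell_var j <= M ^+ 2 * (window_prob x * m 2).
Proof.
move=> jx; rewrite cell_varE (le_trans (_ : _ <= \int[P]_w (cell_sum T f j w ^+ 2)))//.
  by rewrite lerBlDr lerDl sqr_ge0.
rewrite (le_trans _ (cell_sum_moment_le (isT : (1 < 3)%N) jx))// le_eqVlt; apply/orP; left.
by apply/eqP; apply: eq_Rintegral => w _; rewrite real_normK ?num_real.
Qed.

Lemma cell_mean_abs_le j x : cell T j x ->
  \int[P]_w `|cell_sum T f j w| <= M * (window_prob x * m 1).
Proof.
move=> jx; rewrite -[M in leRHS]expr1.
rewrite (le_trans _ (cell_sum_moment_le (isT : (0 < 3)%N) jx))//.
Qed.

Lemma norm_cell_mean_le j x : cell T j x -> `|mean j| <= M * (window_prob x * m 1).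
Proof.
move=> jx; apply: le_trans (cell_mean_abs_le jx).
by apply: le_normr_Rintegral => //; exact: integrable_cell_sum.
Qed.

Lemma integrable_cell_centered_3 j :
  P.-integrable setT (EFin \o (fun w => `|cell_sum T f j w - mean j| ^+ 3)).
Proof.
have i3 := integrable_cell_sum_pow j (isT : (3 <= 3)%N).
apply: (integrable_le _ _ (integrableD_real (integrableZ_real 4 i3)
  (integrable_cst_probability P (4 * `|mean j| ^+ 3)))).
  apply: measurable_funX; apply: measurableT_comp => //.
  by apply: measurable_funB => //; exact: measurable_cell_sum.
move=> w /=; rewrite ger0_norm ?exprn_ge0// -mulrDr.
apply: (@le_trans _ _ ((`|cell_sum T f j w| + `|mean j|) ^+ 3)).
  by apply: lerXn2r; rewrite ?nnegrE ?addr_ge0// ler_normB.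
exact: cube_add_le.
Qed.

Lemma cell_dev3_le j x : cell T j x ->
  cell_dev3 j <= 4 * M ^+ 3 * (m 3 + m 1 ^+ 3) * window_prob x.
Proof.
move=> jx; have /andP[q0 q1] := window_prob_bounds x.
have i3 := integrable_cell_sum_pow j (isT : (3 <= 3)%N).
have h3 := cell_sum_moment_le (isT : (2 < 3)%N) jx.
have h1 := norm_cell_mean_le jx.
have m10 := moment_ge0 1.
apply: (@le_trans _ _ (4 * (\int[P]_w (`|cell_sum T f j w| ^+ 3) + `|mean j| ^+ 3))).
  rewrite -[X in _ + X](Rintegral_cst_probability P) -RintegralD//; last first.
    exact: integrable_cst_probability.
  rewrite -RintegralZl//; last first.
    by apply: integrableD_real => //; exact: integrable_cst_probability.
  apply: le_Rintegral => //; first exact: integrable_cell_centered_3.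
    apply: integrableZ_real; apply: integrableD_real => //.
    exact: integrable_cst_probability.
  move=> w _; apply: (@le_trans _ _ ((`|cell_sum T f j w| + `|mean j|) ^+ 3)).
    by apply: lerXn2r; rewrite ?nnegrE ?addr_ge0// ler_normB.
  exact: cube_add_le.
(* The cube of the window probability is weakened to its first power, since only the latter is
   needed for summation over the cells. *)
have h1' : `|mean j| ^+ 3 <= M ^+ 3 * (window_prob x * m 1 ^+ 3).
  apply: (@le_trans _ _ ((M * (window_prob x * m 1)) ^+ 3)).
    by apply: lerXn2r; rewrite ?nnegrE ?mulr_ge0.
  rewrite !exprMn ler_wpM2l ?exprn_ge0// ler_wpM2r ?exprn_ge0//.
  by rewrite -[leRHS]expr1 ler_wiXn2l.
have -> : 4 * M ^+ 3 * (m 3 + m 1 ^+ 3) * window_prob x =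
  4 * (M ^+ 3 * (window_prob x * m 3) + M ^+ 3 * (window_prob x * m 1 ^+ 3)) by ring.
by rewrite ler_wpM2l// lerD.
Qed.

Local Notation mu := (@lebesgue_measure R).

Definition window_mass : R := \int[mu]_x (\1_`[- (K + 1), K + 1] x : R).

Lemma integrable_window : mu.-integrable setT (EFin \o (\1_`[- (K + 1), K + 1] : R -> R)).
Proof.
apply/integrableP; split.
  by apply/measurable_EFinP; exact: measurable_indic.
under eq_integral do rewrite gee0_abs ?lee_fin//.
rewrite integral_indic ?setIT; [|exact: measurableT|exact: measurable_itv].
by rewrite [X in (X < _)%E]lebesgue_measure_itv; case: ifP => _; rewrite ?ltry// -EFinB ltry.
Qed.

Let window_le1 (y : R) : `|\1_`[- (K + 1), K + 1] y : R| <= 1.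
Proof. by rewrite indicE; case: (_ \in _); rewrite ?normr1 ?normr0. Qed.

Let measurable_window : measurable_fun setT (\1_`[- (K + 1), K + 1] : R -> R).
Proof. exact: measurable_indic. Qed.

Lemma integrable_window_prob : mu.-integrable setT (EFin \o window_prob).
Proof. exact: (integrable_mean_shift P mX measurable_window window_le1 integrable_window). Qed.

Lemma Rintegral_window_prob : \int[mu]_x window_prob x = window_mass.
Proof. exact: (Rintegral_mean_shift P mX measurable_window window_le1 integrable_window). Qed.

Lemma window_mass_ge0 : 0 <= window_mass.
Proof. by apply: Rintegral_ge0 => x _; rewrite indicE. Qed.

Variable e : nat -> int.
Hypothesis e_bij : bijective e.

(** Smoothing preserves the integral, so the window probabilities integrate to the length of the
    window; the resulting bound is free of [T] and [n]. *)
Lemma window_series_le (V : int -> R) C n : (forall j, 0 <= V j) ->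
  (forall j x, cell T j x -> V j <= C * window_prob x) ->
  \sum_(k < n) T^-1 * V (e k) <= C * window_mass.
Proof.
move=> V0 VC; rewrite -Rintegral_window_prob -RintegralZl//; last first.
  exact: integrable_window_prob.
apply: (cell_series_le e_bij T0 V0 VC).
exact: (integrableZ_real C integrable_window_prob).
Qed.

Lemma cell_var_le_window j x : cell T j x -> cell_var j <= M ^+ 2 * m 2 * window_prob x.
Proof. by move=> /cell_var_le H; apply: (le_trans H); rewrite -mulrA (mulrC (m 2)). Qed.

Lemma cell_var_series_le n :
  \sum_(k < n) T^-1 * cell_var (e k) <= M ^+ 2 * m 2 * window_mass.
Proof.
by apply: window_series_le; [exact: cell_var_ge0|exact: cell_var_le_window].
Qed.

Lemma cell_var_series_cvg : (\sum_(k < n) T^-1 * cell_var (e k)) @[n --> \oo] -->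
  \int[mu]_x cell_var (Num.floor (T * x)).
Proof.
apply: (cell_series_cvg e_bij T0 cell_var_ge0 cell_var_le_window).
exact: (integrableZ_real _ integrable_window_prob).
Qed.

Lemma cell_mean_abs_series_le n :
  \sum_(k < n) T^-1 * \int[P]_w `|cell_sum T f (e k) w| <= M * m 1 * window_mass.
Proof.
apply: (window_series_le (V := fun j => \int[P]_w `|cell_sum T f j w|)).
  by move=> j; exact: Rintegral_ge0.
move=> j x /cell_mean_abs_le H; apply: (le_trans H).
by rewrite -mulrA (mulrC (m 1)).
Qed.

Lemma cell_var_bound j : cell_var j <= M ^+ 2 * m 2.
Proof.
have jx : cell T j (T^-1 * j%:~R).
  by apply/(cell_floor T0); rewrite mulrA divff ?gt_eqF// mul1r intrKfloor.
have /andP[_ q1] := window_prob_bounds (T^-1 * j%:~R).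
apply: (le_trans (cell_var_le_window jx)).
by rewrite ler_piMr// mulr_ge0 ?sqr_ge0// moment_ge0.
Qed.

Local Notation s := (Num.sqrt T)^-1.
Local Notation eta k w := (s * (cell_sum T f (e k) w - mean (e k))).

Let s0 : 0 <= s. Proof. by rewrite invr_ge0 sqrtr_ge0. Qed.

Let s2 : s ^+ 2 = T^-1.
Proof. by rewrite exprVn sqr_sqrtr// ltW. Qed.

Let s_le1 : s <= 1.
Proof. by rewrite invf_le1 ?sqrtr_gt0// -sqrtr1 ler_wsqrtr. Qed.

Lemma measurable_scaled_cell k : measurable_fun setT (fun w => eta k w).
Proof.
by apply: measurable_funM => //; apply: measurable_funB => //; exact: measurable_cell_sum.
Qed.

Lemma Rintegral_scaled_cell_sqr k : \int[P]_w (eta k w ^+ 2) = T^-1 * cell_var (e k).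
Proof.
rewrite -s2 -RintegralZl//; last exact: integrable_cell_centered_sqr.
by apply: eq_Rintegral => w _; rewrite exprMn.
Qed.

Let scaled3 k w : `|eta k w| ^+ 3 = s ^+ 3 * `|cell_sum T f (e k) w - mean (e k)| ^+ 3.
Proof. by rewrite normrM (ger0_norm s0) exprMn. Qed.

Let integrable_scaled3 k : P.-integrable setT (EFin \o (fun w => `|eta k w| ^+ 3)).
Proof.
have -> : (fun w => `|eta k w| ^+ 3) = fun w => s ^+ 3 *
  `|cell_sum T f (e k) w - mean (e k)| ^+ 3 by apply/funext => w; exact: scaled3.
exact: (integrableZ_real _ (integrable_cell_centered_3 (e k))).
Qed.

Let scaled_mean0 k : \int[P]_w eta k w = 0.
Proof.
have i1 := integrable_cell_sum (e k).
have ic := integrable_cst_probability P (mean (e k)).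
rewrite RintegralZl//; last exact: integrableB_real.
by rewrite RintegralB// Rintegral_cst_probability subrr mulr0.
Qed.

Let scaled_indep n :
  independent_pair P (fun w => \sum_(k < n) eta k w) (fun w => eta n w).
Proof.
exact: (independent_cells T n (fun=> s) (fun k => mean (e k)) (bij_inj e_bij) mf).
Qed.

Lemma scaled_cell_sum_sqr_le n :
  \int[P]_w ((\sum_(k < n) eta k w) ^+ 2) <= M ^+ 2 * m 2 * window_mass.
Proof.
rewrite (@Rintegral_sum_sqr _ _ _ P (fun k w => eta k w) measurable_scaled_cell
  integrable_scaled3 scaled_mean0 scaled_indep).
under eq_bigr do rewrite Rintegral_scaled_cell_sqr.
exact: cell_var_series_le.
Qed.

Lemma integrable_scaled_cell_sum_sqr n :
  P.-integrable setT (EFin \o (fun w => (\sum_(k < n) eta k w) ^+ 2)).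
Proof.
exact: (@integrable_sum_sqr _ _ _ P (fun k w => eta k w) measurable_scaled_cell
  integrable_scaled3).
Qed.

(** The third moments carry s^3 = s T^-1, and T^-1 is consumed by the sum over the cells, so one
    factor [s] remains. For the squared variances one factor T^-1 = s^2 is weakened to [s] by T >=
    1. The 8 is the 2 of the replacement bound times the 4 of [cube_add_le]. *)
Lemma scaled_cell_sum_cos n c :
  `|\int[P]_w cos (\sum_(k < n) eta k w + c)
    - expR (- ((\sum_(k < n) T^-1 * cell_var (e k)) / 2)) * cos c| <=
  s * ((8 * M ^+ 3 * (m 3 + m 1 ^+ 3) + (M ^+ 2 * m 2) ^+ 2) * window_mass).
Proof.
have := @Rintegral_cos_sum _ _ _ P (fun k w => eta k w) measurable_scaled_cell
  integrable_scaled3 scaled_mean0 scaled_indep n c.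
have -> : \sum_(k < n) \int[P]_w (eta k w ^+ 2) / 2 =
    (\sum_(k < n) T^-1 * cell_var (e k)) / 2.
  by rewrite mulr_suml; apply: eq_bigr => k _; rewrite Rintegral_scaled_cell_sqr.
move=> H; apply: (le_trans H); rewrite big_split/= mulrDl mulrDr lerD//.
  have -> : \sum_(k < n) 2 * \int[P]_w (`|eta k w| ^+ 3) =
      s * (2 * \sum_(k < n) T^-1 * cell_dev3 (e k)).
    rewrite mulrA mulr_sumr; apply: eq_bigr => k _.
    rewrite -s2 -mulrA mulrCA; congr (_ * _).
    rewrite mulrA -exprS -RintegralZl//; last exact: integrable_cell_centered_3.
    by apply: eq_Rintegral => w _; exact: scaled3.
  rewrite ler_wpM2l//.
  have := @window_series_le cell_dev3 (4 * M ^+ 3 * (m 3 + m 1 ^+ 3)) n _ _.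
  have d0 j : 0 <= cell_dev3 j by apply: Rintegral_ge0 => w _; exact: exprn_ge0.
  by move=> /(_ d0 cell_dev3_le); lra.
have C0 : 0 <= M ^+ 2 * m 2 by rewrite mulr_ge0 ?sqr_ge0// moment_ge0.
apply: (@le_trans _ _ (\sum_(k < n) s * (M ^+ 2 * m 2) * (T^-1 * cell_var (e k)))).
  apply: ler_sum => k _; rewrite Rintegral_scaled_cell_sqr expr2.
  have Ti0 : 0 <= T^-1 by rewrite invr_ge0 ltW.
  rewrite ler_wpM2r ?mulr_ge0 ?cell_var_ge0//.
  apply: ler_pM => //; [exact: cell_var_ge0| |exact: cell_var_bound].
  by rewrite -s2 expr2 ler_piMl.
rewrite -mulr_sumr.
have -> : s * ((M ^+ 2 * m 2) ^+ 2 * window_mass) =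
  s * (M ^+ 2 * m 2) * (M ^+ 2 * m 2 * window_mass) by ring.
apply: ler_wpM2l; first exact: mulr_ge0.
exact: cell_var_series_le.
Qed.

End test_function.
End particle_cells.

(** * Series of positive and negative parts *)

Lemma nneseries_cvg_fine (R : realType) (u : nat -> R) : (forall k, 0 <= u k) ->
  (\sum_(0 <= k <oo) (u k)%:E < +oo)%E ->
  (\sum_(k < n) u k) @[n --> \oo] --> fine (\sum_(0 <= k <oo) (u k)%:E)%E.
Proof.
move=> u0 fin.
have e0 k : (0 <= (u k)%:E)%E by rewrite lee_fin.
have lim0 : (0 <= \sum_(0 <= k <oo) (u k)%:E)%E by apply: nneseries_ge0.
have : (\sum_(0 <= k < n) (u k)%:E)%E @[n --> \oo] --> (\sum_(0 <= k <oo) (u k)%:E)%E.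
  exact: (is_cvg_nneseries (fun k _ _ => e0 k)).
rewrite -[X in _ --> X]fineK; last by rewrite ge0_fin_numE.
move=> /fine_cvgP[_ H]; apply: cvg_trans H.
by apply: near_eq_cvg; near=> n; rewrite /= sumEFin/= big_mkord.
Unshelve. all: by end_near. Qed.

Section signed_series.
Context d (Omega : measurableType d) (R : realType) (P : probability Omega R).
Variables (a b : nat -> Omega -> R) (C : R).
Hypotheses (ma : forall k, measurable_fun setT (a k)) (mb : forall k, measurable_fun setT (b k)).
Hypotheses (a0 : forall k w, 0 <= a k w) (b0 : forall k w, 0 <= b k w).
Hypothesis iab : forall k, P.-integrable setT (EFin \o (fun w => a k w + b k w)).
Hypothesis abC : forall n, \sum_(k < n) \int[P]_w (a k w + b k w) <= C.

Let A w := (\sum_(0 <= k <oo) (a k w)%:E)%E.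
Let B w := (\sum_(0 <= k <oo) (b k w)%:E)%E.
Let D w := (\sum_(0 <= k <oo) (a k w + b k w)%:E)%E.
Let S w : R := fine (A w - B w)%E.

Let mseries (f : nat -> Omega -> R) : (forall k, measurable_fun setT (f k)) ->
  (forall k w, 0 <= f k w) ->
  measurable_fun setT (fun w => \sum_(0 <= k <oo) (f k w)%:E)%E.
Proof.
move=> mf f0.
apply: (@ge0_emeasurable_sum _ _ _ _ (fun k w => (f k w)%:E) xpredT).
  by move=> k w _ _; rewrite lee_fin.
by move=> k _; apply/measurable_EFinP.
Qed.

Lemma measurable_signed_series : measurable_fun setT S.
Proof.
apply: measurableT_comp; first exact: fine_measurable.
by apply: emeasurable_funB; exact: mseries.
Qed.

Let ab0 k w : 0 <= a k w + b k w. Proof. exact: addr_ge0. Qed.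

Let iD : P.-integrable setT D.
Proof.
apply/integrableP; split.
  by apply: mseries => // k; exact: measurable_funD.
have D0 w : (0 <= D w)%E by apply: nneseries_ge0 => k _ _; rewrite lee_fin.
under eq_integral do rewrite gee0_abs//.
rewrite integral_nneseries//; last 2 first.
  by move=> k; apply/measurable_EFinP; exact: measurable_funD.
  by move=> k w _; rewrite lee_fin.
apply: (@le_lt_trans _ _ C%:E); last by rewrite ltry.
apply: lime_le.
  by apply: is_cvg_nneseries => k _ _; apply: integral_ge0 => w _; rewrite lee_fin.
near=> n; rewrite big_mkord.
under eq_bigr do rewrite -EFin_Rintegral//.
by rewrite sumEFin lee_fin.
Unshelve. all: by end_near. Qed.

(** The series [D] of absolute sizes has expectation at most [C], so it is finite almost everywhere.
    There the difference of the two series is not of the form oo - oo, and [fine] loses nothing. *)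
Lemma ae_cvg_signed_series :
  {ae P, forall w, (\sum_(k < n) (a k w - b k w)) @[n --> \oo] --> S w}.
Proof.
have := integrable_ae measurableT iD; apply: filterS => w /(_ I) Dfin.
have Dlt : (D w < +oo)%E by rewrite -ge0_fin_numE//; apply: nneseries_ge0 => k _ _; rewrite lee_fin.
have Alt : (A w < +oo)%E.
  by apply: le_lt_trans Dlt; apply: lee_nneseries => k *; rewrite lee_fin// lerDl.
have Blt : (B w < +oo)%E.
  by apply: le_lt_trans Dlt; apply: lee_nneseries => k *; rewrite lee_fin// lerDr.
have A0 : (0 <= A w)%E by apply: nneseries_ge0 => k _ _; rewrite lee_fin.
have B0 : (0 <= B w)%E by apply: nneseries_ge0 => k _ _; rewrite lee_fin.
rewrite /S fineB ?ge0_fin_numE//.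
under eq_fun do rewrite sumrB.
by apply: cvgB; apply: nneseries_cvg_fine.
Qed.

(** [D] dominates all partial sums, so dominated convergence exchanges the sum with the
    expectation. *)
Lemma signed_series_integral : P.-integrable setT (EFin \o S) /\
  (\sum_(k < n) \int[P]_w (a k w - b k w)) @[n --> \oo] --> \int[P]_w S w.
Proof.
have iB k : P.-integrable setT (EFin \o (fun w => a k w - b k w)).
  apply: integrable_le (iab k) => [|w]; first exact: measurable_funB.
  by rewrite (le_trans (ler_normB _ _))// !ger0_norm.
have mpart n : measurable_fun setT (fun w => \sum_(k < n) (a k w - b k w)).
  by apply: measurable_sum => k; exact: measurable_funB.
have [//|||||iS _ cS] := @dominated_convergence _ _ _ P setT measurableT
  (fun n w => (\sum_(k < n) (a k w - b k w))%:E) (EFin \o S) D.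
- by move=> n; apply/measurable_EFinP.
- by apply/measurable_EFinP; exact: measurable_signed_series.
- move: ae_cvg_signed_series; apply: filterS => w H _ /=.
  by apply: cvg_EFin => //; exact: nearW.
- exact: iD.
- apply: aeW => w n _; rewrite abse_EFin.
  apply: (@le_trans _ _ (\sum_(0 <= k < n) (a k w + b k w)%:E)%E); last first.
    by apply: nneseries_lim_ge => k _ _; rewrite lee_fin.
  rewrite big_mkord sumEFin lee_fin (le_trans (ler_norm_sum _ _ _))//.
  by apply: ler_sum => k _; rewrite (le_trans (ler_normB _ _))// !ger0_norm.
split => //.
have -> : (fun n => \sum_(k < n) \int[P]_w (a k w - b k w)) =
    (fun n => \int[P]_w (\sum_(k < n) (a k w - b k w))).
  by apply/funext => n; rewrite Rintegral_sum.
apply/fine_cvg; rewrite fineK ?integrable_fin_num//; exact: cS.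
Qed.

End signed_series.

(** The order 0, -1, 1, -2, ... of the integers; it turns the unordered sum over cells into a series
    with partial sums. *)
Definition int_enum (k : nat) : int := if odd k then Negz k./2 else Posz k./2.

Lemma int_enum_bij : bijective int_enum.
Proof.
exists (fun j : int => match j with Posz n => n.*2 | Negz n => n.*2.+1 end).
  move=> k; rewrite /int_enum; case: ifPn => ok; have := odd_double_half k.
    by rewrite ok add1n.
  by rewrite (negbTE ok) add0n.
by case=> n; rewrite /int_enum/= odd_double/= ?doubleK// uphalf_double.
Qed.

Lemma esum_int_enum (R : realType) (a : int -> \bar R) : (forall j, 0 <= a j)%E ->
  (\esum_(j in [set: int]) a j = \sum_(0 <= k <oo) a (int_enum k))%E.
Proof.
move=> a0; rewrite nneseries_esumT//.
apply: reindex_esum; split => //.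
  by move=> x y _ _; exact: (bij_inj int_enum_bij).
move=> j _; have [g _ gK] := int_enum_bij.
by exists (g j).
Qed.

(** * The rescaled pairing as an almost sure limit of finite sums *)

Section particle_pairing.
Context d (Omega : measurableType d) (R : realType) (P : probability Omega R).
Variables (theta : int -> {RV P >-> nat})
  (rho : int -> forall k : nat, 'I_k -> {RV P >-> R})
  (vartheta : int -> nat -> R -> {RV P >-> R}) (X : {RV P >-> R}) (m : nat -> R).
Hypothesis hrho : forall (j : int) (k : nat) (i : 'I_k) (w : Omega),
  j%:~R <= rho j i w < (j + 1)%:~R.
Hypothesis hcells : mutual_indep P (sigma_cell theta rho).
Hypothesis hmotions : independent_motions theta rho vartheta.
Hypothesis hlaw : forall j n A, measurable A ->
  P (vartheta j n 1 @^-1` A) = P (X @^-1` A).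
Hypothesis theta3 : forall j,
  P.-integrable setT (EFin \o (fun w => (theta j w)%:R ^+ 3 : R)).
Hypothesis theta_moment : forall j k, \int[P]_w ((theta j w)%:R ^+ k) = m k.

Local Notation cell_sum := (cell_sum theta rho vartheta).
Local Notation pairing_N := (pairing_N theta rho vartheta).
Local Notation pairing_XT := (pairing_XT theta rho vartheta).
Local Notation e := int_enum.

Lemma cell_sum_kappa T f j w :
  \sum_(n < theta j w) f (kappa rho T n + vartheta j n 1 w) = cell_sum T f j w.
Proof.
apply: eq_bigr => n _; congr (f (_ * _ + _)).
rewrite /particle_site insubT//= => nj.
by congr (rho j _ w); exact: val_inj.
Qed.

Lemma cell_sum_ge0 T f j w : (forall y, 0 <= f y) -> 0 <= cell_sum T f j w.
Proof. by move=> f0; exact: sumr_ge0. Qed.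

Lemma particle_sumE T f w : (forall y, 0 <= f y) ->
  particle_sum theta rho vartheta T 1 f w = (\sum_(0 <= k <oo) (cell_sum T f (e k) w)%:E)%E.
Proof.
move=> f0; rewrite /particle_sum.
under eq_esum do rewrite cell_sum_kappa.
by rewrite esum_int_enum// => j; rewrite lee_fin cell_sum_ge0.
Qed.

Lemma pairing_NE T f : pairing_N T 1 f = fun w =>
  fine ((\sum_(0 <= k <oo) (cell_sum T (f^\+)%R (e k) w)%:E)
        - (\sum_(0 <= k <oo) (cell_sum T (f^\-)%R (e k) w)%:E))%E.
Proof.
by apply/funext => w; rewrite /pairing_N !particle_sumE.
Qed.

Lemma cell_sumB T f g j w : cell_sum T f j w - cell_sum T g j w = cell_sum T (f \- g) j w.
Proof. by rewrite /cell_sum -sumrB. Qed.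

Lemma cell_sumD T f g j w : cell_sum T f j w + cell_sum T g j w = cell_sum T (f \+ g) j w.
Proof. by rewrite /cell_sum -big_split. Qed.

Lemma cell_sum_comb T (n : nat) (b : 'I_n -> R) (f : 'I_n -> R -> R) j w :
  cell_sum T (fun y => \sum_i b i * f i y) j w = \sum_i b i * cell_sum T (f i) j w.
Proof.
rewrite /cell_sum exchange_big; apply: eq_bigr => i _.
by rewrite mulr_sumr.
Qed.

Section test_function.
Variables (f : R -> R) (M K T : R).
Hypotheses (mf : measurable_fun setT f) (fM : forall y, `|f y| <= M).
Hypotheses (fK : forall y, K < `|y| -> f y = 0) (T1 : 1 <= T).

Let T0 : 0 < T. Proof. exact: lt_le_trans T1. Qed.

Let a (k : nat) (w : Omega) := cell_sum T (f^\+)%R (e k) w.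
Let b (k : nat) (w : Omega) := cell_sum T (f^\-)%R (e k) w.

Let abE k w : a k w + b k w = cell_sum T (fun y => `|f y|) (e k) w.
Proof. by rewrite cell_sumD -[f^\+ \+ f^\-]/(f^\+ + f^\-)%R funrposDneg. Qed.

Let aBb k w : a k w - b k w = cell_sum T f (e k) w.
Proof. by rewrite cell_sumB -[f^\+ \- f^\-]/(f^\+ - f^\-)%R funrposBneg. Qed.

Let ma k : measurable_fun setT (a k).
Proof. by apply: measurable_cell_sum => //; exact: measurable_funrpos. Qed.

Let mb k : measurable_fun setT (b k).
Proof. by apply: measurable_cell_sum => //; exact: measurable_funrneg. Qed.

Let a0 k w : 0 <= a k w. Proof. by apply: cell_sum_ge0 => y; exact: funrpos_ge0. Qed.
Let b0 k w : 0 <= b k w. Proof. by apply: cell_sum_ge0 => y; exact: funrneg_ge0. Qed.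

Let mnf : measurable_fun setT (fun y => `|f y|).
Proof. exact: measurableT_comp. Qed.
Let nfM y : `| `|f y| | <= M. Proof. by rewrite normr_id. Qed.
Let nfK y : K < `|y| -> `|f y| = 0. Proof. by move=> /fK ->; rewrite normr0. Qed.

Let iab k : P.-integrable setT (EFin \o (fun w => a k w + b k w)).
Proof.
under [X in EFin \o X]eq_fun do rewrite abE.
exact: (integrable_cell_sum rho vartheta theta3 T mnf nfM (e k)).
Qed.

Let abC n : \sum_(k < n) \int[P]_w (a k w + b k w) <=
  T * (M * m 1 * window_mass K).
Proof.
rewrite -ler_pdivrMl// mulr_sumr.
rewrite (le_trans _ (cell_mean_abs_series_le hrho hcells hmotions hlaw theta3 theta_moment mnf nfM nfK T1 int_enum_bij n))//.
apply: ler_sum => k _; apply: ler_wpM2l; first by rewrite invr_ge0 ltW.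
rewrite le_eqVlt; apply/orP; left; apply/eqP; apply: eq_Rintegral => w _.
by rewrite -abE ger0_norm// addr_ge0.
Qed.

Lemma measurable_pairing_N : measurable_fun setT (pairing_N T 1 f).
Proof. by rewrite pairing_NE; exact: measurable_signed_series. Qed.

Lemma integrable_pairing_N : P.-integrable setT (EFin \o pairing_N T 1 f).
Proof. by rewrite pairing_NE; have [] := signed_series_integral ma mb a0 b0 iab abC. Qed.

Lemma measurable_pairing_XT : measurable_fun setT (pairing_XT T 1 f).
Proof.
by apply: measurable_funM => //; apply: measurable_funB => //; exact: measurable_pairing_N.
Qed.

Lemma ae_cvg_pairing_XT : {ae P, forall w,
  (\sum_(k < n) (Num.sqrt T)^-1 * (cell_sum T f (e k) w - \int[P]_v cell_sum T f (e k) v))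
    @[n --> \oo] --> pairing_XT T 1 f w}.
Proof.
have [_ cN] := signed_series_integral ma mb a0 b0 iab abC.
have := ae_cvg_signed_series ma mb a0 b0 iab abC; apply: filterS => w cw.
rewrite /pairing_XT expectation_Rintegral ?integrable_pairing_N//= pairing_NE.
under eq_fun do rewrite -mulr_sumr sumrB.
apply: cvgMr; apply: cvgB.
  by move: cw; under eq_fun do under eq_bigr do rewrite aBb.
by move: cN; under eq_fun do under eq_bigr do under eq_Rintegral do rewrite aBb.
Qed.

Local Notation eta k w :=
  ((Num.sqrt T)^-1 * (cell_sum T f (e k) w - \int[P]_v cell_sum T f (e k) v)).
Local Notation XT := (pairing_XT T 1 f).

Let mS n : measurable_fun setT (fun w => \sum_(k < n) eta k w).
Proof. by apply: measurable_sum => k; exact: measurable_scaled_cell. Qed.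

(** The estimate for finitely many cells is uniform in their number, so it survives the limit over
    the cells at fixed [T]. *)
Lemma pairing_XT_cos c :
  `|\int[P]_w cos (XT w + c)
    - expR (- ((\int[lebesgue_measure]_x cell_var theta rho vartheta f T (Num.floor (T * x)))
               / 2)) * cos c| <=
  (Num.sqrt T)^-1 *
    ((8 * M ^+ 3 * (m 3 + m 1 ^+ 3) + (M ^+ 2 * m 2) ^+ 2) * window_mass K).
Proof.
have H n := scaled_cell_sum_cos hrho hcells hmotions hlaw theta3 theta_moment
  mf fM fK T1 int_enum_bij n c.
have cV := cell_var_series_cvg hrho hcells hmotions hlaw theta3 theta_moment
  mf fM fK T1 int_enum_bij.
have cC : (\int[P]_w cos (\sum_(k < n) eta k w + c)) @[n --> \oo] -->
    \int[P]_w cos (XT w + c).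
  apply: (@ae_dominated_cvg_Rintegral _ _ _ _ _ _ (cst 1)).
  - move=> n; apply: measurableT_comp; first exact: measurable_cos.
    exact: measurable_funD.
  - apply: measurableT_comp; first exact: measurable_cos.
    by apply: measurable_funD => //; exact: measurable_pairing_XT.
  - apply: filterS ae_cvg_pairing_XT => w cw.
    apply: continuous_cvg; first exact: continuous_cos.
    by apply: cvgD => //; exact: cvg_cst.
  - exact: integrable_cst_probability.
  - by move=> n w; exact: cos_max.
have cE : expR (- ((\sum_(k < n) T^-1 * cell_var theta rho vartheta f T (e k)) / 2)) * cos c
    @[n --> \oo] --> expR (- ((\int[lebesgue_measure]_x
       cell_var theta rho vartheta f T (Num.floor (T * x))) / 2)) * cos c.
  apply: cvgMl; apply: continuous_cvg; first exact: continuous_expR.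
  by apply: cvgN; apply: cvgMl.
apply: (ler_cvg_to (cvg_norm (cvgB cC cE)) (cvg_cst _)); apply: nearW => n.
exact: H.
Qed.

Lemma pairing_XT_tail L : 0 < L ->
  (P [set w | (L < `|XT w|)%R] <= (L ^- 2 * (M ^+ 2 * m 2 * window_mass K))%:E)%E.
Proof.
move=> L0; set B := M ^+ 2 * _ * _.
have H n := scaled_cell_sum_sqr_le hrho hcells hmotions hlaw theta3 theta_moment
  mf fM fK T1 int_enum_bij n.
have iS n := integrable_scaled_cell_sum_sqr rho vartheta theta3 T mf fM e n.
have mX := measurable_pairing_XT.
(* Truncating the square makes bounded convergence applicable to the partial sums; [g] still
   dominates L^2 times the indicator of the tail, which is all that Chebyshev requires. *)
pose g (y : R) := Num.min (y ^+ 2) (L ^+ 2).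
have cg : continuous g.
  move=> y; apply: (@continuous_min _ _ (fun y : R => y ^+ 2) (cst (L ^+ 2))).
    exact: exprn_continuous.
  exact: cst_continuous.
have g0 y : 0 <= g y by rewrite le_min !sqr_ge0.
have gL y : `|g y| <= L ^+ 2 by rewrite ger0_norm// ge_min lexx orbT.
have mg : measurable_fun setT g by exact: continuous_measurable_fun.
have mgX : measurable_fun setT (fun w => g (XT w)) by exact: measurableT_comp.
have cI : (\int[P]_w g (\sum_(k < n) eta k w)) @[n --> \oo] --> \int[P]_w g (XT w).
  apply: (@ae_dominated_cvg_Rintegral _ _ _ _ _ _ (cst (L ^+ 2))).
  - by move=> n; exact: measurableT_comp.
  - exact: mgX.
  - by apply: filterS ae_cvg_pairing_XT => w cw; apply: continuous_cvg; first exact: cg.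
  - exact: integrable_cst_probability.
  - by move=> n w; exact: gL.
have gB : \int[P]_w g (XT w) <= B.
  apply: (ler_cvg_to cI (cvg_cst _)); apply: nearW => n.
  apply: le_trans (H n); apply: le_Rintegral => //.
  - by apply: (@bounded_integrable_probability _ _ _ _ _ (L ^+ 2)) => //; exact: measurableT_comp.
  - by move=> w _; rewrite /g ge_min lexx.
have mA : measurable [set w | L < `|XT w|].
  rewrite -[X in measurable X]setTI.
  have mn : measurable_fun setT (fun w => `|XT w|) by exact: measurableT_comp.
  rewrite (_ : [set w | _] = (fun w => `|XT w|) @^-1` `]L, +oo[%classic).
    by apply: mn => //; exact: measurable_itv.
  by apply/seteqP; split => w /=; rewrite in_itv/= andbT.
have PA : P [set w | (L < `|XT w|)%R] = (\int[P]_w \1_[set w | (L < `|XT w|)%R] w)%:E.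
  rewrite EFin_Rintegral; last first.
    apply: (@bounded_integrable_probability _ _ _ _ _ 1); first exact: measurable_indic.
    by move=> w; rewrite indicE; case: (_ \in _); rewrite ?normr1 ?normr0.
  by rewrite integral_indic// setIT.
rewrite PA lee_fin ler_pdivlMl ?exprn_gt0// (le_trans _ gB)//.
rewrite -RintegralZl//; last first.
  apply: (@bounded_integrable_probability _ _ _ _ _ 1); first exact: measurable_indic.
  by move=> w; rewrite indicE; case: (_ \in _); rewrite ?normr1 ?normr0.
apply: le_Rintegral => //.
- apply: (@bounded_integrable_probability _ _ _ _ _ (L ^+ 2)).
    by apply: measurable_funM => //; exact: measurable_indic.
  move=> w; rewrite normrM ger0_norm ?sqr_ge0// indicE.
  by case: (_ \in _); rewrite ?normr1 ?normr0 ?mulr1 ?mulr0 ?sqr_ge0.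
- by apply: (@bounded_integrable_probability _ _ _ _ _ (L ^+ 2)).
move=> w _; rewrite indicE; case: (boolP (w \in _)) => [/set_mem/= Lw|_]; last by rewrite mulr0.
rewrite mulr1 le_min lexx andbT.
have -> : XT w ^+ 2 = `|XT w| ^+ 2 by rewrite real_normK ?num_real.
by rewrite ler_pXn2r ?nnegrE ?normr_ge0//; exact: ltW.
Qed.

End test_function.

(** The splitting into positive and negative parts is not linear in the test function. The partial
    sums over cells are, and linearity passes to their almost sure limits. *)
Lemma ae_pairing_XT_comb (n : nat) (b : 'I_n -> R) (f : 'I_n -> R -> R) M K T :
  (forall i, measurable_fun setT (f i)) -> (forall i y, `|f i y| <= M) ->
  (forall i y, K < `|y| -> f i y = 0) -> 1 <= T ->
  {ae P, forall w, \sum_i b i * pairing_XT T 1 (f i) w =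
                   pairing_XT T 1 (fun y => \sum_i b i * f i y) w}.
Proof.
move=> mf fM fK T1.
have mF : measurable_fun setT (fun y => \sum_i b i * f i y).
  by apply: measurable_sum => i; exact: measurable_funM.
have FM y : `|\sum_i b i * f i y| <= \sum_i `|b i| * M.
  rewrite (le_trans (ler_norm_sum _ _ _))//; apply: ler_sum => i _.
  by rewrite normrM ler_wpM2l.
have FK y : K < `|y| -> \sum_i b i * f i y = 0.
  by move=> Ky; rewrite big1// => i _; rewrite fK ?mulr0.
have H1 := ae_cvg_pairing_XT mF FM FK T1.
have H2 : {ae P, forall w i,
  (\sum_(k < n) (Num.sqrt T)^-1 * (cell_sum T (f i) (e k) w -
      \int[P]_v cell_sum T (f i) (e k) v)) @[n --> \oo] --> pairing_XT T 1 (f i) w}.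
  apply: filter_forall => i; exact: (ae_cvg_pairing_XT (mf i) (fM i) (fK i) T1).
apply: filterS2 H1 H2 => w c1 c2.
apply: (cvg_unique _ _ c1); first exact: Rhausdorff.
have icell i k : P.-integrable setT (EFin \o cell_sum T (f i) (e k)).
  exact: (integrable_cell_sum rho vartheta theta3 T (mf i) (fM i) (e k)).
rewrite (_ : (fun n => _) = fun N => \sum_i b i * \sum_(k < N) (Num.sqrt T)^-1 *
    (cell_sum T (f i) (e k) w - \int[P]_v cell_sum T (f i) (e k) v)); last first.
  apply/funext => N.
  under [in RHS]eq_bigr do rewrite mulr_sumr.
  rewrite exchange_big/=; apply: eq_bigr => k _.
  have -> : \int[P]_v cell_sum T (fun y => \sum_i b i * f i y) (e k) v =
      \sum_i b i * \int[P]_v cell_sum T (f i) (e k) v.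
    under eq_Rintegral do rewrite cell_sum_comb.
    rewrite Rintegral_sum => [|i]; last exact: integrableZ_real.
    by apply: eq_bigr => i _; rewrite RintegralZl.
  rewrite cell_sum_comb -sumrB mulr_sumr; apply: eq_bigr => i _; ring.
apply: cvg_big => [|i _]; first exact: add_continuous.
exact: cvgMr.
Qed.

End particle_pairing.

(** * Test functions with countably many discontinuities *)

Section countable_discontinuities.
Variable R : realType.

(** The class is stable under squares and finite linear combinations, and its exceptional sets are
    Lebesgue null. *)
Definition countably_discontinuous (f : R -> R) : Prop :=
  exists2 N : set R, countable N & forall x, ~ N x -> {for x, continuous f}.

Lemma piecewise_continuous_countable (f : R -> R) :
  piecewise_continuous f -> countably_discontinuous f.
Proof.
move=> [H _].
have /choice[s sP] : forall n : nat, exists s : seq R, forall x,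
    - n%:R <= x <= n%:R -> x \notin s -> {for x, continuous f} by move=> n; exact: H.
exists (\bigcup_n [set` s n]).
  apply: bigcup_countable; first exact: countableP.
  by move=> n _; exact/finite_set_countable/finite_seq.
move=> x xs; apply: (sP (Num.truncn `|x|).+1); last first.
  by apply/negP => xn; apply: xs; exists (Num.truncn `|x|).+1.
by rewrite -ler_norml ltW// truncnS_gt.
Qed.

(** The preimage of an open interval differs from its interior only by discontinuity points, that
    is, by a countable set. *)
Lemma measurable_countably_discontinuous (f : R -> R) :
  countably_discontinuous f -> measurable_fun setT f.
Proof.
move=> [N cN fN]; apply: (measurability _ (RGenOpens.measurableE R)).
move=> _ [_ [a [b ->] <-]]; rewrite setTI.
set U : set R := `]a, b[%classic.
have -> : f @^-1` U = interior (f @^-1` U) `|` (N `&` f @^-1` U).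
  apply/seteqP; split => [x Ux|x [/interior_subset//|[]//]].
  have [Nx|Nx] := pselect (N x); [by right|left].
  by apply: (fN x Nx); apply: open_nbhs_nbhs; split => //; exact: interval_open.
apply: measurableU; first by apply: open_measurable; exact: open_interior.
apply: countable_measurable => //.
exact: sub_countable (subset_card_le (@subIsetl _ _ _)) cN.
Qed.

Lemma countably_discontinuous_sqr (f : R -> R) :
  countably_discontinuous f -> countably_discontinuous (fun y => f y ^+ 2).
Proof.
move=> [N cN fN]; exists N => // x /fN cf.
by apply: (@continuous_comp _ _ _ f (fun y => y ^+ 2)) => //; exact: exprn_continuous.
Qed.

Lemma countably_discontinuous_comb (n : nat) (b : 'I_n -> R) (f : 'I_n -> R -> R) :
  (forall i, countably_discontinuous (f i)) ->
  countably_discontinuous (fun y => \sum_i b i * f i y).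
Proof.
move=> /(_ _)/cid2 H.
pose N i := projT1 (H i).
exists (\bigcup_i N i).
  apply: bigcup_countable; first exact: countableP.
  by move=> i _; rewrite /N; case: (H i).
move=> x Nx; apply: cvg_big => [|i _]; first exact: add_continuous.
apply: cvgMr; have : ~ N i x by move=> Ni; apply: Nx; exists i.
by rewrite /N; case: (H i) => M cM fM /= /fM.
Qed.

Lemma compact_support_vanish (f : R -> R) : compact_support f ->
  exists2 K, 0 < K & forall y, K < `|y| -> f y = 0.
Proof.
move=> /compact_bounded[K0 [_ HK]].
exists (Num.max K0 0 + 1); first by rewrite ltr_pwDr// le_max lexx orbT.
move=> y Ky; apply/eqP/negPn/negP => fy.
have := HK (Num.max K0 0 + 1); rewrite ltr_pwDr ?le_max ?lexx// => /(_ isT y).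
by move=> /(_ (@subset_closure _ [set x | f x != 0] y fy))/=; rewrite leNgt Ky.
Qed.

End countable_discontinuities.

Section smoothing.
Context d (Omega : measurableType d) (R : realType) (P : probability Omega R).
Variables (X : Omega -> R) (p : R -> R).
Hypotheses (mX : measurable_fun setT X) (mp : measurable_fun setT p).
Hypothesis Xp : forall A : set R, measurable A ->
  P (X @^-1` A) = (\int[lebesgue_measure]_(x in A) (p x)%:E)%E.

(** The law has a density, so x + X almost surely avoids the countable exceptional set; along a
    sequence tending to [x] the integrands converge almost everywhere. *)
Lemma continuous_mean_shift f M : countably_discontinuous f -> (forall y, `|f y| <= M) ->
  continuous (mean_shift P X f).
Proof.
move=> cdf fM; have mf := measurable_countably_discontinuous cdf.
have [N cN fN] := cdf.
move=> x; apply/(@cvg_nbhsP R R^o (mean_shift P X f) x) => u ux.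
apply: (@ae_dominated_cvg_Rintegral _ _ _ _ _ _ (cst M)).
- by move=> n; exact: measurable_shift.
- exact: measurable_shift.
- pose B := [set y | N (x + y)].
  have cB : countable B.
    have -> : B = (fun y => y - x) @` N.
      apply/seteqP; split => [y Ny|_ [y Ny <-]]; last by rewrite /B/= addrC subrK.
      by exists (x + y) => //; rewrite addrC addKr.
    exact: sub_countable (card_image_le _ _) cN.
  have mB : measurable B by exact: countable_measurable.
  exists (X @^-1` B); split.
  + by rewrite -[X in measurable X]setTI; exact: mX.
  + apply: (@null_density _ _ _ P _ _ (@lebesgue_measure R) X p mp Xp B mB).
    exact: countable_lebesgue_measure0.
  + move=> w /= Hw; apply: contrapT => Bw; apply: Hw.
    apply: continuous_cvg; first exact: fN.
    by apply: cvgD => //; exact: cvg_cst.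
- exact: integrable_cst_probability.
- by move=> n w; exact: fM.
Qed.

End smoothing.

Lemma cvg_dist_le_scale (R : realType) (v : nat -> R) l C :
  (forall e, 0 < e -> \forall k \near \oo, `|v k - l| <= e * C) ->
  v k @[k --> \oo] --> l.
Proof.
move=> H; apply/cvgrPdist_le => e e0.
have C0 : 0 < `|C| + 1 by rewrite ltr_wpDl.
have := H (e / (`|C| + 1)) (divr_gt0 e0 C0); apply: filterS => k Hk.
rewrite distrC (le_trans Hk)// mulrAC ler_pdivrMr// ler_wpM2l ?ltW//.
by rewrite (le_lt_trans (ler_norm C))// ltrDl.
Qed.

(** * The limit of the variance *)

Section variance_limit.
Context d (Omega : measurableType d) (R : realType) (P : probability Omega R).
Variables (theta : int -> {RV P >-> nat})
  (rho : int -> forall k : nat, 'I_k -> {RV P >-> R})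
  (vartheta : int -> nat -> R -> {RV P >-> R}) (X : {RV P >-> R}) (m : nat -> R).
Hypothesis hrho : forall (j : int) (k : nat) (i : 'I_k) (w : Omega),
  j%:~R <= rho j i w < (j + 1)%:~R.
Hypothesis hcells : mutual_indep P (sigma_cell theta rho).
Hypothesis hmotions : independent_motions theta rho vartheta.
Hypothesis hlaw : forall j n A, measurable A ->
  P (vartheta j n 1 @^-1` A) = P (X @^-1` A).
Hypothesis theta3 : forall j,
  P.-integrable setT (EFin \o (fun w => (theta j w)%:R ^+ 3 : R)).
Hypothesis theta_moment : forall j k, \int[P]_w ((theta j w)%:R ^+ k) = m k.
Variables (f : R -> R) (M K : R).
Hypotheses (mf : measurable_fun setT f) (fM : forall y, `|f y| <= M).
Hypotheses (fK : forall y, K < `|y| -> f y = 0).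
Local Notation G := (mean_shift P X).
Local Notation G2 := (G (fun y => f y ^+ 2)).
Local Notation mu := (@lebesgue_measure R).
Hypotheses (cG : continuous (G f)) (cG2 : continuous G2).
Variable u : nat -> R.
Hypotheses (u1 : forall k, 1 <= u k) (uoo : u k @[k --> \oo] --> +oo%R).

Let mX : measurable_fun setT X. Proof. by []. Qed.

(** All sites of the cell of [x] are within [(u k)^-1] of [x], whatever the configuration, so
    continuity at [x] gives closeness uniformly in the particle and the outcome. The 2 in [2 / r]
    provides a strict inequality. *)
Let near_scale (g : R -> R) : continuous g -> forall x e, 0 < e ->
  \forall k \near \oo, forall n w,
    `|g ((u k)^-1 * particle_site theta rho (Num.floor (u k * x)) n w) - g x| <= e.
Proof.
move=> cg x e e0.
have /cvgrPdist_le/(_ e e0)/nbhs_ballP[r /= r0 Hr] := cg x.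
have /cvgryPge/(_ (2 / r)) := uoo; apply: filterS => k uk n w.
have uk0 : 0 < u k by exact: lt_le_trans (u1 k).
rewrite distrC; apply: Hr; rewrite /ball/= distrC.
have cx : cell (u k) (Num.floor (u k * x)) x by exact/cell_floor.
apply: (le_lt_trans (cell_pos_dist theta hrho (u1 k) cx n w)).
rewrite invf_plt ?posrE// (lt_le_trans _ uk)// mulrC ltr_pMr ?invr_gt0//.
exact: ltr1n.
Qed.

Let GM x : `|G f x| <= M.
Proof. exact: mean_shift_norm_le. Qed.

Let near_both x e : 0 < e -> \forall k \near \oo,
  (forall n w, `|G f ((u k)^-1 * particle_site theta rho (Num.floor (u k * x)) n w) - G f x|
     <= e) /\
  (forall n w, `|G2 ((u k)^-1 * particle_site theta rho (Num.floor (u k * x)) n w) - G2 x|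
     <= e).
Proof.
move=> e0; apply: filterS2 (near_scale cG x e0) (near_scale cG2 x e0) => k.
by split.
Qed.

Let mean_cvg x :
  \int[P]_w cell_sum theta rho vartheta (u k) f (Num.floor (u k * x)) w @[k --> \oo]
  --> m 1 * G f x.
Proof.
apply: (@cvg_dist_le_scale _ _ _ (m 1)) => e e0.
apply: filterS (near_both x e0) => k [H _].
exact: (cell_mean_close hcells hmotions hlaw theta3 theta_moment mf fM H).
Qed.

Let sqr_cvg x :
  \int[P]_w (cell_sum theta rho vartheta (u k) f (Num.floor (u k * x)) w ^+ 2)
    @[k --> \oo] --> m 1 * (G2 x - G f x ^+ 2) + m 2 * G f x ^+ 2.
Proof.
apply: (@cvg_dist_le_scale _ _ _ ((1 + 2 * M) * m 1 + 2 * M * m 2)) => e e0.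
apply: filterS (near_both x e0) => k [H H2].
exact: (cell_sqr_close hcells hmotions hlaw theta3 theta_moment mf fM (GM x) H H2).
Qed.

Lemma cell_var_integral_cvg :
  \int[mu]_x cell_var theta rho vartheta f (u k) (Num.floor (u k * x)) @[k --> \oo] -->
  \int[mu]_x (m 1 * G2 x + (m 2 - m 1 - m 1 ^+ 2) * G f x ^+ 2).
Proof.
(* The majorant is a multiple of the window probability, free of [k]. The pointwise limit is that of
   the second moment minus the square of that of the mean. *)
apply: (@dominated_cvg_Rintegral _ _ _ mu
  (fun k x => cell_var theta rho vartheta f (u k) (Num.floor (u k * x)))
  (fun x => m 1 * G2 x + (m 2 - m 1 - m 1 ^+ 2) * G f x ^+ 2)
  (fun x => M ^+ 2 * m 2 * window_prob X K x)).
- move=> k; apply: (measurable_floor_comp int_enum_bij _ (cell_var theta rho vartheta f (u k))).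
  exact: lt_le_trans (u1 k).
- move=> x.
  under eq_fun do rewrite (cell_varE rho vartheta theta3 _ mf fM).
  rewrite (_ : m 1 * G2 x + _ = m 1 * (G2 x - G f x ^+ 2) + m 2 * G f x ^+ 2
    - m 1 * G f x * (m 1 * G f x)); last by ring.
  exact: (cvgB (@sqr_cvg x) (cvgM (@mean_cvg x) (@mean_cvg x))).
- exact: (integrableZ_real _ (integrable_window_prob X K)).
- move=> k x; have uk0 : 0 < u k by exact: lt_le_trans (u1 k).
  rewrite ger0_norm; last exact: cell_var_ge0.
  apply: (cell_var_le_window hrho hcells hmotions hlaw theta3 theta_moment mf fM fK (u1 k)).
  exact/cell_floor.
Qed.

End variance_limit.

(** * Adjoint and composition of random shifts *)

Section smoothing_identities.
Variable R : realType.
Context d (T : measurableType d) (P : probability T R).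
Local Notation mu := (@lebesgue_measure R).

(** One factor is integrable and the other bounded: by translation invariance the absolute integral
    over the line is, for every outcome, at most [N] times that of [f]. *)
Lemma Fubini_translates (U V : T -> R) (f g : R -> R) M N :
  measurable_fun setT U -> measurable_fun setT V ->
  measurable_fun setT f -> (forall y, `|f y| <= M) -> mu.-integrable setT (EFin \o f) ->
  measurable_fun setT g -> (forall y, `|g y| <= N) ->
  \int[mu]_x \int[P]_w (f (x + U w) * g (x + V w)) =
  \int[P]_w \int[mu]_x (f (x + U w) * g (x + V w)).
Proof.
move=> mU mV mf fM intf mg gN.
have N0 : 0 <= N by exact: le_trans (normr_ge0 _) (gN 0).
have mF : measurable_fun setT
    (fun z : measurableTypeR R * T => f (z.1 + U z.2) * g (z.1 + V z.2)).
  by apply: measurable_funM; apply: measurableT_comp => //; apply: measurable_funD => //;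
    exact: measurableT_comp.
have ifg (c b : R) : mu.-integrable setT (EFin \o (fun x => f (x + c) * g (x + b))).
  have := integrableZ_real N (integrable_norm_real (integrable_lebesgue_shift c intf)).
  apply: integrable_le => [|x].
    by apply: measurable_funM; apply: measurableT_comp => //; exact: measurable_funD.
  by rewrite normrM mulrC ler_wpM2r.
apply: (@Rintegral_Fubini _ _ _ _ _ mu P
  (fun z => f (z.1 + U z.2) * g (z.1 + V z.2)) mF); last 2 first.
- move=> x; apply: (@bounded_integrable_probability _ _ _ _ _ (M * N)) => [|w].
    by apply: measurable_funM; exact: measurable_shift.
  by rewrite normrM ler_pM.
- by move=> w; exact: (ifg (U w) (V w)).
have mB : measurable_fun setT
    (fun z : measurableTypeR R * T => `|(f (z.1 + U z.2)%R * g (z.1 + V z.2)%R)%:E|%E).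
  by apply: measurableT_comp => //; apply/measurable_EFinP.
apply: (@le_lt_trans _ _ (\int[P]_w (N * \int[mu]_x `|f x|)%:E)%E); last first.
  by rewrite integral_cst//= probability_setT mule1 ltry.
apply: ge0_le_integral => //.
- by move=> w _; exact: integral_ge0.
- exact: (@measurable_fun_fubini_tonelli_G _ _ _ _ _ mu _ mB).
move=> w _; rewrite (_ : (fun x => _) = EFin \o (fun x => `|f (x + U w) * g (x + V w)|))//.
rewrite -EFin_Rintegral ?lee_fin; last exact/integrable_norm_real/ifg.
rewrite -(Rintegral_shift (U w) (measurableT_comp (@normr_measurable _ setT) mf)).
rewrite -RintegralZl//; last first.
  exact/integrable_norm_real/integrable_lebesgue_shift.
apply: le_Rintegral => //.
- exact/integrable_norm_real/ifg.
- exact/integrableZ_real/integrable_norm_real/integrable_lebesgue_shift.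
by move=> x _; rewrite normrM mulrC ler_wpM2r.
Qed.

(** For each outcome a translation of the line by [X w] moves the shift from [f] to [g], where it
    has the opposite sign. *)
Lemma mean_shift_adjoint (X : T -> R) (f g : R -> R) M N : measurable_fun setT X ->
  measurable_fun setT f -> (forall y, `|f y| <= M) -> mu.-integrable setT (EFin \o f) ->
  measurable_fun setT g -> (forall y, `|g y| <= N) ->
  \int[mu]_x (mean_shift P X f x * g x) =
  \int[mu]_x (f x * mean_shift P (fun w => - X w) g x).
Proof.
move=> mX mf fM intf mg gN.
have mN : measurable_fun setT (fun w => - X w) by exact: measurableT_comp.
transitivity (\int[mu]_x \int[P]_w (f (x + X w) * g (x + cst 0 w))).
  apply: eq_Rintegral => x _; rewrite mulrC -RintegralZl//; last first.
    exact: (@integrable_shift _ _ _ P _ mX f M x mf fM).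
  by apply: eq_Rintegral => w _; rewrite addr0 mulrC.
rewrite (Fubini_translates mX _ mf fM intf mg gN)//.
transitivity (\int[P]_w \int[mu]_x (f (x + cst 0 w) * g (x - X w))).
  apply: eq_Rintegral => w _.
  rewrite -[RHS](Rintegral_shift (X w)).
    by apply: eq_Rintegral => x _; rewrite /= addrK !addr0.
  by apply: measurable_funM => //; apply: measurableT_comp => //; exact: measurable_funD.
rewrite -(Fubini_translates _ mN mf fM intf mg gN)//.
apply: eq_Rintegral => x _; rewrite /= addr0 RintegralZl//.
exact: (@integrable_shift _ _ _ P _ mN g N x mg gN).
Qed.

Lemma mean_shift_comp (X Y : T -> R) (f : R -> R) M x : measurable_fun setT X ->
  measurable_fun setT Y -> independent_pair P X Y ->
  measurable_fun setT f -> (forall y, `|f y| <= M) ->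
  mean_shift P X (mean_shift P Y f) x = mean_shift P (fun w => X w + Y w) f x.
Proof.
move=> mX mY XY mf fM.
have mXY : measurable_fun setT (fun w => X w + Y w) by exact: measurable_funD.
have i1 : P.-integrable setT (EFin \o (fun w => f (x + (X w + Y w)))).
  exact: (@integrable_shift _ _ _ P _ mXY f M x mf fM).
apply: EFin_inj; rewrite [in RHS]EFin_Rintegral//.
have mG := measurable_mean_shift P mY mf fM.
rewrite EFin_Rintegral; last first.
  by apply: (@integrable_shift _ _ _ P _ mX _ M x mG) => y; exact: mean_shift_norm_le.
rewrite (@integral_decoupling _ _ _ P _ _ _ _ X Y mX mY XY
  (fun z => (f (x + (z.1 + z.2))%R)%:E))//; last first.
  apply/measurable_EFinP; apply: measurableT_comp => //; apply: measurable_funD => //.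
  exact: measurable_funD.
apply: eq_integral => w _.
rewrite EFin_Rintegral; last exact: (@integrable_shift _ _ _ P _ mY f M _ mf fM).
by apply: eq_integral => w' _; rewrite addrA.
Qed.

End smoothing_identities.

(** Convolution with the density of [X] averages over x - X, hence the reflected variable; symmetry
    of the stable law removes the sign later. *)
Lemma convolution_density (R : realType) d (T : measurableType d) (P : probability T R)
    (X : T -> R) (q f : R -> R) M x : measurable_fun setT X -> measurable_fun setT q ->
  (forall A : set R, measurable A ->
     P (X @^-1` A) = (\int[lebesgue_measure]_(y in A) (q y)%:E)%E) ->
  measurable_fun setT f -> (forall y, `|f y| <= M) ->
  \int[lebesgue_measure]_y (q (x - y) * f y) = mean_shift P (fun w => - X w) f x.
Proof.
move=> mX mq Xq mf fM.
have mxB : measurable_fun setT (fun y : R => x - y) by exact: measurable_funB.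
rewrite /mean_shift.
rewrite (@Rintegral_density _ _ _ P _ _ (@lebesgue_measure R) X q mX mq Xq
  (fun y => f (x - y)) M)//; last exact: measurableT_comp.
rewrite -[LHS](Rintegral_reflect x).
  by apply: eq_Rintegral => y _; rewrite subKr mulrC.
by apply: measurable_funM => //; exact: measurableT_comp.
Qed.

(** * Stable laws and their semigroup *)

Section stable_laws.
Context (R : realType) d (Omega : measurableType d) (P : probability Omega R) (alpha : R).

Lemma stable_cos_shift (X : R -> {RV P >-> R}) t z c :
  standard_stable_process alpha X -> 0 <= t ->
  \int[P]_w cos (z * X t w + c) = expR (- (t * `|z| `^ alpha)) * cos c.
Proof.
move=> sX t0.
have mc : measurable_fun setT (fun w => cos (z * X t w)).
  by apply: measurableT_comp; [exact: measurable_cos|exact: measurable_funM].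
have ms : measurable_fun setT (fun w => sin (z * X t w)).
  by apply: measurableT_comp; [exact: measurable_sin|exact: measurable_funM].
have ic := bounded_integrable_probability P mc (fun w => cos_max _).
have is_ := bounded_integrable_probability P ms (fun w => sin_max _).
have := stable_cos sX z t0; rewrite expectation_Rintegral// => -[cE].
have := stable_sin sX z t0; rewrite expectation_Rintegral// => -[sE].
transitivity (\int[P]_w (cos c * cos (z * X t w) - sin c * sin (z * X t w))).
  by apply: eq_Rintegral => w _; rewrite cosD mulrC [X in _ - X]mulrC.
rewrite RintegralB//; [|exact: integrableZ_real..].
by rewrite !RintegralZl// cE sE mulr0 subr0 mulrC.
Qed.

Lemma stable_same_law (X Y : R -> {RV P >-> R}) t : standard_stable_process alpha X ->
  standard_stable_process alpha Y -> 0 <= t ->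
  forall A, measurable A -> P (X t @^-1` A) = P (Y t @^-1` A).
Proof.
move=> sX sY t0 A mA; apply: law_of_cos => // z c.
by rewrite !stable_cos_shift.
Qed.

Lemma stable_symmetric (X : R -> {RV P >-> R}) t : standard_stable_process alpha X ->
  0 <= t -> forall A, measurable A -> P ((fun w => - X t w) @^-1` A) = P (X t @^-1` A).
Proof.
move=> sX t0 A mA; apply: law_of_cos => //; first exact: measurableT_comp.
move=> z c; rewrite stable_cos_shift//.
under eq_Rintegral do rewrite mulrN -mulNr.
by rewrite stable_cos_shift// normrN.
Qed.

(** Two independent copies at time [t] stand for two consecutive increments of one path; their
    exponents add up to that of time [2 * t]. *)
Lemma stable_sum_law (X Y : R -> {RV P >-> R}) t : standard_stable_process alpha X ->
  standard_stable_process alpha Y -> 0 <= t -> independent_pair P (X t) (Y t) ->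
  forall A, measurable A -> P ((fun w => X t w + Y t w) @^-1` A) = P (X (2 * t) @^-1` A).
Proof.
move=> sX sY t0 XY A mA; apply: law_of_cos => //; first exact: measurable_funD.
move=> z c; rewrite stable_cos_shift// ?mulr_ge0//.
have mtrig (h : R -> R) b : measurable_fun setT h -> measurable_fun setT (fun y => h (z * y + b)).
  by move=> mh; apply: (measurableT_comp mh); exact: measurable_funD.
have mtrig0 (h : R -> R) : measurable_fun setT h -> measurable_fun setT (fun y => h (z * y)).
  by move=> mh; apply: measurableT_comp => //; exact: measurable_funM.
have mcos : measurable_fun setT (@cos R) by exact: measurable_cos.
have msin : measurable_fun setT (@sin R) by exact: measurable_sin.
have bcos : bounded_real (fun y : R => cos (z * y)) by exists 1 => y; exact: cos_max.
have bsin : bounded_real (fun y : R => sin (z * y)) by exists 1 => y; exact: sin_max.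
have bcosc : bounded_real (fun y : R => cos (z * y + c)) by exists 1 => y; exact: cos_max.
have bsinc : bounded_real (fun y : R => sin (z * y + c)) by exists 1 => y; exact: sin_max.
have sX0 : \int[P]_w sin (z * X t w) = 0.
  have ms : measurable_fun setT (fun w => sin (z * X t w)) by exact: (measurableT_comp (mtrig0 _ msin)).
  have is_ := bounded_integrable_probability P ms (fun w => sin_max _).
  by have := stable_sin sX z t0; rewrite expectation_Rintegral// => -[].
have cX0 : \int[P]_w cos (z * X t w) = expR (- (t * `|z| `^ alpha)).
  have := stable_cos_shift z 0 sX t0; rewrite cos0 mulr1 => <-.
  by apply: eq_Rintegral => w _; rewrite addr0.
transitivity (\int[P]_w (cos (z * X t w) * cos (z * Y t w + c) -
    sin (z * X t w) * sin (z * Y t w + c))).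
  by apply: eq_Rintegral => w _; rewrite mulrDr -addrA cosD.
rewrite RintegralB//; last 2 first.
- apply: (@bounded_integrable_probability _ _ _ _ _ 1) => [|w].
    by apply: measurable_funM; [exact: (measurableT_comp (mtrig0 _ mcos))|
      exact: (measurableT_comp (mtrig _ c mcos))].
  by rewrite normrM mulr_ile1 ?cos_max.
- apply: (@bounded_integrable_probability _ _ _ _ _ 1) => [|w].
    by apply: measurable_funM; [exact: (measurableT_comp (mtrig0 _ msin))|
      exact: (measurableT_comp (mtrig _ c msin))].
  by rewrite normrM mulr_ile1 ?sin_max.
rewrite (@Rintegral_indep_bounded_mul _ _ _ P _ _ _ _ _ _ (fun y => cos (z * y))
  (fun y => cos (z * y + c)) _ _ XY)//; [|exact: mtrig0|exact: mtrig].
rewrite (@Rintegral_indep_bounded_mul _ _ _ P _ _ _ _ _ _ (fun y => sin (z * y))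
  (fun y => sin (z * y + c)) _ _ XY)//; [|exact: mtrig0|exact: mtrig].
rewrite sX0 mul0r subr0 cX0 stable_cos_shift// mulrA -expRD.
by congr (expR _ * _); ring.
Qed.

End stable_laws.

Lemma independent_stable_motions d (Omega : measurableType d) (R : realType)
    (P : probability Omega R) (theta : int -> {RV P >-> nat})
    (rho : int -> forall k : nat, 'I_k -> {RV P >-> R})
    (vartheta : int -> nat -> R -> {RV P >-> R}) j n k t :
  mutual_indep P (sigma_cell theta rho) -> independent_motions theta rho vartheta ->
  0 <= t -> n != k -> independent_pair P (vartheta j n t) (vartheta j k t).
Proof.
move=> hcells hmotions t0 nk.
pose Kn l : set (int * option nat) := [set (j, Some l)].
have Knk i : Kn n i -> ~ Kn k i.
  by move=> -> [nkE]; move: nk; rewrite nkE eqxx.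
have ind := independent_sources hcells hmotions Knk.
have mv l : measurable_fun setT
    (vartheta j l t : g_sigma_algebraType (joint_events theta rho vartheta (Kn l)) -> R).
  exact: measurable_motion.
exact: (independent_pair_comp ind (mv n) (mv k)).
Qed.

Section semigroup.
Context (R : realType) (alpha : R) d (Omega : measurableType d) (P : probability Omega R).
Variables (X Y : R -> {RV P >-> R}) (p : R -> R -> R).
Hypotheses (sX : standard_stable_process alpha X) (sY : standard_stable_process alpha Y).
Hypotheses (Xp : transition_density X p) (XY : independent_pair P (X 1) (Y 1)).
Local Notation mu := (@lebesgue_measure R).

Lemma stable_semigroupE (t : R) (f : R -> R) (M : R) : 0 < t -> measurable_fun setT f -> (forall y, `|f y| <= M) ->
  stable_semigroup p t f = mean_shift P (X t) f.
Proof.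
move=> t0 mf fM; apply/funext => x.
have [mp _ pE] := Xp t0.
have mX : measurable_fun setT (X t) by [].
rewrite /stable_semigroup (convolution_density x mX mp pE mf fM).
apply: mean_shift_law => //; first exact: measurableT_comp.
by move=> A mA; apply: (stable_symmetric sX) => //; exact: ltW.
Qed.

(** The adjoint moves the smoothing of [f] onto [g], and symmetry removes its sign. Replacing one of
    the two smoothings of [g] by that of the independent copy [Y] makes them composable. *)
Lemma Rintegral_semigroup_mul (f g : R -> R) (M N : R) : measurable_fun setT f -> (forall y, `|f y| <= M) ->
  mu.-integrable setT (EFin \o f) -> measurable_fun setT g -> (forall y, `|g y| <= N) ->
  \int[mu]_x (mean_shift P (X 1) f x * mean_shift P (X 1) g x) =
  \int[mu]_x (f x * stable_semigroup p 2 g x).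
Proof.
move=> mf fM intf mg gN.
have mX1 : measurable_fun setT (X 1) by [].
rewrite (mean_shift_adjoint P mX1 mf fM intf (measurable_mean_shift P mX1 mg gN)
  (fun y => mean_shift_norm_le P mX1 y mg gN)).
rewrite (stable_semigroupE _ mg gN)//; apply: eq_Rintegral => x _; congr (_ * _).
have mG := measurable_mean_shift P mX1 mg gN.
rewrite (@mean_shift_law _ _ _ P _ _ P (fun w => - X 1 w) (X 1) _ x _ _ _ mG)//; last 2 first.
- exact: measurableT_comp.
- by move=> A mA; exact: (stable_symmetric sX).
have -> : mean_shift P (X 1) g = mean_shift P (Y 1) g.
  apply/funext => y; apply: mean_shift_law => // A mA.
  exact: (stable_same_law sX sY).
rewrite (mean_shift_comp x mX1 _ XY mg gN)//.
apply: mean_shift_law => //; first exact: measurable_funD.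
by move=> A mA; rewrite (stable_sum_law sX sY _ XY mA)// mulr1.
Qed.

End semigroup.

(** * Moments of the number of particles in a cell *)

Section count_moments.
Context (R : realType) d0 (Omega0 : measurableType d0) (P0 : probability Omega0 R).
Variable theta0 : {RV P0 >-> nat}.
Hypothesis htheta0 : ('E_P0[fun w => ((theta0 w)%:R ^+ 3)%R] < +oo)%E.

Lemma measurable_nat_fun (g : nat -> R) : measurable_fun setT g.
Proof. by []. Qed.

Let mpow k : measurable_fun setT (fun w => (theta0 w)%:R ^+ k : R).
Proof. exact: (measurableT_comp (measurable_nat_fun (fun n => n%:R ^+ k))). Qed.

Lemma integrable_count_cube : P0.-integrable setT (EFin \o (fun w => (theta0 w)%:R ^+ 3 : R)).
Proof.
apply/integrableP; split; first exact/measurable_EFinP.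
move: htheta0; rewrite unlock; congr (_ < _)%E.
by apply: eq_integral => w _; rewrite abse_EFin ger0_norm// exprn_ge0.
Qed.

Let pow_le (n k : nat) : (k <= 3)%N -> `|n%:R ^+ k : R| <= 1 + n%:R ^+ 3.
Proof.
move=> k3; rewrite ger0_norm ?exprn_ge0//.
case: n => [|n].
  by rewrite !expr0n/= addr0 lern1 leq_b1.
by rewrite ler_wpDl// ler_weXn2l// ler1n.
Qed.

Lemma integrable_count_moment k : (k <= 3)%N ->
  P0.-integrable setT (EFin \o (fun w => (theta0 w)%:R ^+ k : R)).
Proof.
move=> k3; apply: integrable_le (integrableD_real (integrable_cst_probability P0 1)
  integrable_count_cube) => // w.
exact: pow_le.
Qed.

Let m k : R := \int[P0]_w ((theta0 w)%:R ^+ k).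

Lemma count_mean : fine 'E_P0[fun w => (theta0 w)%:R%R]%E = m 1.
Proof.
rewrite expectation_Rintegral//=; exact: (integrable_count_moment (isT : (1 <= 3)%N)).
Qed.

Lemma count_variance : fine 'V_P0[fun w => (theta0 w)%:R%R]%E = m 2 - m 1 ^+ 2.
Proof.
have i1 := integrable_count_moment (isT : (1 <= 3)%N).
have i2 := integrable_count_moment (isT : (2 <= 3)%N).
rewrite /variance unlock count_mean.
have iB : P0.-integrable setT (EFin \o (fun w => (theta0 w)%:R ^+ 2 - 2 * m 1 * (theta0 w)%:R ^+ 1)).
  by apply: integrableB_real => //; exact: integrableZ_real.
have iC := integrable_cst_probability P0 (m 1 ^+ 2).
have E : ((fun w => (theta0 w)%:R : R) \- cst (m 1)) * ((fun w => (theta0 w)%:R) \- cst (m 1)) =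
    (fun w => (theta0 w)%:R ^+ 2 - 2 * m 1 * (theta0 w)%:R ^+ 1 + cst (m 1 ^+ 2) w).
  by apply/funext => w; rewrite /= [LHS]/GRing.mul/=; ring.
rewrite E expectation_Rintegral; last exact: integrableD_real.
rewrite [fine _]/= RintegralD// RintegralB//; last exact: integrableZ_real.
rewrite RintegralZl// Rintegral_cst_probability -!/(m _).
by ring.
Qed.

Context d (Omega : measurableType d) (P : probability Omega R).
Variable theta : {RV P >-> nat}.
Hypothesis htheta : forall A : set nat, measurable A ->
  distribution P theta A = distribution P0 theta0 A.

Let integral_count (g : nat -> R) : (forall n, 0 <= g n) ->
  (\int[P]_w (g (theta w))%:E = \int[P0]_w (g (theta0 w))%:E)%E.
Proof.
move=> g0.
have mg : measurable_fun setT (EFin \o g) by apply/measurable_EFinP.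
rewrite -(ge0_integral_distribution theta mg)//.
rewrite -(ge0_integral_distribution theta0 mg)//.
by apply: eq_measure_integral => A mA _; exact: htheta.
Qed.

Lemma count_moment k : \int[P]_w ((theta w)%:R ^+ k) = m k.
Proof.
rewrite /m /Rintegral; congr fine.
exact: (integral_count (fun n => exprn_ge0 k (ler0n R n))).
Qed.

Lemma integrable_count_cube_law :
  P.-integrable setT (EFin \o (fun w => (theta w)%:R ^+ 3 : R)).
Proof.
apply/integrableP; split.
  by apply/measurable_EFinP; exact: (measurableT_comp (measurable_nat_fun (fun n => n%:R ^+ 3))).
move/integrableP : integrable_count_cube => [_]; congr (_ < _)%E.
have E := integral_count (fun n => normr_ge0 (n%:R ^+ 3 : R)).
exact: (esym E).
Qed.

End count_moments.

(** * Convergence in square mean, and Gaussian second moments *)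

Section square_mean_convergence.
Context d (T : measurableType d) (R : realType) (mu : {measure set T -> \bar R}).

Definition sqr_cvg (U_ : nat -> T -> R) (U : T -> R) : Prop :=
  (\int[mu]_x ((U_ k x - U x) ^+ 2)%:E)%E @[k --> \oo] --> 0%E.

Lemma integrable_mul (f g : T -> R) : measurable_fun setT f -> measurable_fun setT g ->
  mu.-integrable setT (EFin \o (fun x => f x ^+ 2)) ->
  mu.-integrable setT (EFin \o (fun x => g x ^+ 2)) ->
  mu.-integrable setT (EFin \o (fun x => f x * g x)).
Proof.
move=> mf mg f2 g2; apply: integrable_le (integrableD_real f2 g2) => [|x].
  exact: measurable_funM.
rewrite normrM -(real_normK (num_real (f x))) -(real_normK (num_real (g x))).
have := sqr_ge0 (`|f x| - `|g x|); have := normr_ge0 (f x); have := normr_ge0 (g x).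
by nra.
Qed.

(** [sqr_cvg] speaks of extended reals; convergence to 0 makes the integrals finite eventually, and
    only then is the real-valued integral meaningful. *)
Lemma sqr_cvg_near (U_ : nat -> T -> R) (U : T -> R) : (forall k, measurable_fun setT (U_ k)) ->
  measurable_fun setT U -> sqr_cvg U_ U -> forall e, 0 < e -> \forall k \near \oo,
    mu.-integrable setT (EFin \o (fun x => (U_ k x - U x) ^+ 2)) /\
    \int[mu]_x ((U_ k x - U x) ^+ 2) <= e.
Proof.
move=> mU_ mU /fine_cvgP[fin cv] e e0.
have /cvgrPdist_le/(_ e e0) H := cv.
apply: filterS2 fin H => k fk Hk.
have i0 : (0 <= \int[mu]_x ((U_ k x - U x) ^+ 2)%:E)%E.
  by apply: integral_ge0 => x _; rewrite lee_fin sqr_ge0.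
split.
  apply/integrableP; split.
    by apply/measurable_EFinP; apply: measurable_funX; exact: measurable_funB.
  under eq_integral => x _ do rewrite [X in `|X|%E]/= abse_EFin ger0_norm ?sqr_ge0//.
  by rewrite ltey_eq fk.
move: Hk; rewrite sub0r normrN; apply: le_trans.
exact: ler_norm.
Qed.

Lemma sqr_cvg_integrable (U_ : nat -> T -> R) (U : T -> R) :
  (forall k, measurable_fun setT (U_ k)) -> measurable_fun setT U -> sqr_cvg U_ U ->
  (forall k, mu.-integrable setT (EFin \o (fun x => U_ k x ^+ 2))) ->
  mu.-integrable setT (EFin \o (fun x => U x ^+ 2)).
Proof.
move=> mU_ mU cU iU.
have [k _ /(_ k (leqnn k))[ik _]] := sqr_cvg_near mU_ mU cU ltr01.
apply: integrable_le (integrableD_real (integrableZ_real 2 ik) (integrableZ_real 2 (iU k))).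
  exact: measurable_funX.
move=> x; rewrite ger0_norm ?sqr_ge0//.
by have := sqr_ge0 (U_ k x - U x + U_ k x); nra.
Qed.

Lemma sqr_cvg_mul (U_ V_ : nat -> T -> R) (U V : T -> R) :
  (forall k, measurable_fun setT (U_ k)) -> measurable_fun setT U -> sqr_cvg U_ U ->
  mu.-integrable setT (EFin \o (fun x => U x ^+ 2)) ->
  (forall k, measurable_fun setT (V_ k)) -> measurable_fun setT V -> sqr_cvg V_ V ->
  mu.-integrable setT (EFin \o (fun x => V x ^+ 2)) ->
  (\int[mu]_x (U_ k x * V_ k x)) @[k --> \oo] --> \int[mu]_x (U x * V x).
Proof.
move=> mU_ mU cU iU mV_ mV cV iV.
pose u := \int[mu]_x (U x ^+ 2); pose v := \int[mu]_x (V x ^+ 2).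
apply: (@cvg_dist_le_scale _ _ _ (2 + (u + v) / 2)) => e e0.
(* The weighted inequality [young] charges the errors with the factor e^-1, paid by the bound e^2;
   the product of the two errors is paid by the bound [e]. The fixed functions [U] and [V] only
   enter with the factor e / 2. *)
pose e' := Num.min e (e ^+ 2).
have e'0 : 0 < e' by rewrite lt_min e0 exprn_gt0.
apply: filterS2 (sqr_cvg_near mU_ mU cU e'0) (sqr_cvg_near mV_ mV cV e'0).
move=> k [iA] /[swap] [[iB]].
set b := \int[mu]_x _; rewrite /e' le_min => /andP[b1 b2].
set a := \int[mu]_x _; rewrite le_min => /andP[a1 a2].
pose A x := U_ k x - U x; pose B x := V_ k x - V x.
have mA : measurable_fun setT A by exact: measurable_funB.
have mB : measurable_fun setT B by exact: measurable_funB.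
have iUV := integrable_mul mU mV iU iV.
have iAB := integrable_mul mA mB iA iB.
have iAV := integrable_mul mA mV iA iV.
have iUB := integrable_mul mU mB iU iB.
have E x : U_ k x * V_ k x = U x * V x + (A x * B x + A x * V x + U x * B x).
  by rewrite /A /B; ring.
have iS : mu.-integrable setT (EFin \o (fun x => A x * B x + A x * V x + U x * B x)).
  by do 2 apply: integrableD_real => //.
under eq_Rintegral do rewrite E.
rewrite RintegralD// addrAC subrr add0r.
apply: (le_trans (le_normr_Rintegral measurableT iS)).
pose D x := ((1 + e^-1) / 2) * (A x ^+ 2) + (((1 + e^-1) / 2) * (B x ^+ 2) +
  ((e / 2) * (U x ^+ 2) + (e / 2) * (V x ^+ 2))).
have iZA := integrableZ_real ((1 + e^-1) / 2) iA.
have iZB := integrableZ_real ((1 + e^-1) / 2) iB.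
have iZU := integrableZ_real (e / 2) iU.
have iZV := integrableZ_real (e / 2) iV.
have iUV2 := integrableD_real iZU iZV.
have iBUV := integrableD_real iZB iUV2.
have iD : mu.-integrable setT (EFin \o D) by exact: (integrableD_real iZA iBUV).
have young p q : `|p * q| <= e^-1 / 2 * p ^+ 2 + e / 2 * q ^+ 2.
  rewrite normrM -(real_normK (num_real p)) -(real_normK (num_real q)).
  have ee : e^-1 * e = 1 by rewrite mulVf ?gt_eqF.
  have ei0 : 0 < e^-1 by rewrite invr_gt0.
  rewrite -subr_ge0 (_ : _ - _ = e / 2 * (e^-1 * `|p| - `|q|) ^+ 2).
    by rewrite mulr_ge0 ?sqr_ge0// divr_ge0// ltW.
  by field; rewrite gt_eqF.
have bound x : `|A x * B x + A x * V x + U x * B x| <= D x.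
  rewrite (le_trans (ler_normD _ _))// (le_trans (lerD (ler_normD _ _) (lexx _)))//.
  have y1 := young (A x) (V x).
  have y2 := young (B x) (U x); rewrite mulrC in y2.
  have y3 : `|A x * B x| <= (A x ^+ 2 + B x ^+ 2) / 2.
    rewrite normrM -(real_normK (num_real (A x))) -(real_normK (num_real (B x))).
    by have := sqr_ge0 (`|A x| - `|B x|); nra.
  by rewrite /D; lra.
apply: (@le_trans _ _ (\int[mu]_x D x)).
  by apply: le_Rintegral => //; exact: integrable_norm_real.
rewrite /D RintegralD// RintegralD// RintegralD// !RintegralZl//.
rewrite -/a -/b -/u -/v.
have ei0 : 0 < e^-1 by rewrite invr_gt0.
have ea : e^-1 * a <= e by rewrite ler_pdivrMl// -expr2.
have eb : e^-1 * b <= e by rewrite ler_pdivrMl// -expr2.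
by lra.
Qed.

End square_mean_convergence.

Section gaussian_variance.
Context d (T : measurableType d) (R : realType) (P : probability T R).

(* [2 (1 - cos (h x)) / h ^ 2] tends to [x ^ 2] as h tends to 0 and is dominated by [2 x ^ 2]:
  this reads the second moment off the characteristic function. *)
Lemma centered_gaussian_cos (X : T -> R) : centered_gaussian P X ->
  P.-integrable setT (EFin \o (fun w => X w ^+ 2)) ->
  forall z c, \int[P]_w cos (z * X w + c) =
    expR (- ((\int[P]_w (X w ^+ 2)) * z ^+ 2 / 2)) * cos c.
Proof.
move=> [mX [s Xs]] iX z c.
have cosX := Rintegral_cos_centered_gaussian mX Xs.
suff -> : \int[P]_w (X w ^+ 2) = s ^+ 2 by exact: cosX.
have [h [h0 h1 hcvg]] : exists h : nat -> R,
    [/\ forall n, 0 < h n, forall n, h n <= 1 & h n @[n --> \oo] --> 0].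
  exists (fun n => n.+1%:R^-1); split => [n|n|]; last exact: cvg_harmonic.
    by rewrite invr_gt0.
  by rewrite invf_le1// ler1n.
pose f n (x : R) : R := 2 * (1 - cos (h n * x)) / h n ^+ 2.
have mf n : measurable_fun setT (f n).
  apply: measurable_funM => //; apply: measurable_funM => //; apply: measurable_funB => //.
  apply: measurableT_comp; first exact: measurable_cos.
  exact: measurable_funM.
have fcvg x : f n x @[n --> \oo] --> x ^+ 2.
  apply: (@cvg_dist_le_scale _ _ _ (2 * `|x| ^+ 3)) => e e0.
  have /cvgrPdist_le/(_ e e0) := hcvg; apply: filterS => n; rewrite sub0r normrN gtr0_norm// => hn.
  have H := cos_taylor2_le3 (h n * x).
  have hh : h n * (h n)^-1 = 1 by rewrite divff ?gt_eqF.
  have -> : f n x - x ^+ 2 = - (2 / h n ^+ 2 * (cos (h n * x) - (1 - (h n * x) ^+ 2 / 2))).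
    by rewrite /f; field; rewrite gt_eqF.
  rewrite normrN normrM ger0_norm; last by rewrite divr_ge0// sqr_ge0.
  apply: (@le_trans _ _ (2 / h n ^+ 2 * `|h n * x| ^+ 3)).
    by rewrite ler_wpM2l// divr_ge0// sqr_ge0.
  rewrite normrM gtr0_norm// (_ : _ * _ = h n * (2 * `|x| ^+ 3)).
    by rewrite ler_wpM2r// mulr_ge0// exprn_ge0.
  by field; rewrite gt_eqF.
have fbound n x : `|f n x| <= 2 * x ^+ 2.
  rewrite /f normrM normfV [`|h n ^+ 2|]ger0_norm ?sqr_ge0// ler_pdivrMr ?exprn_gt0//.
  have := cos_sub1_le (h n * x); rewrite normrM distrC ger0_norm// exprMn; nra.
have lim1 : \int[P]_w f n (X w) @[n --> \oo] --> \int[P]_w (X w ^+ 2).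
  apply: (@dominated_cvg_Rintegral _ _ _ P (fun n w => f n (X w)) _ (fun w => 2 * X w ^+ 2)) => //.
    by move=> n; exact: (measurableT_comp (mf n)).
  exact: integrableZ_real.
have fE n : \int[P]_w f n (X w) = 2 * (1 - expR (- (s ^+ 2 * h n ^+ 2 / 2))) / h n ^+ 2.
  have mc : measurable_fun setT (fun w => cos (h n * X w)).
    by apply: measurableT_comp; [exact: measurable_cos|exact: measurable_funM].
  have ic := bounded_integrable_probability P mc (fun w => cos_max _).
  have i1 := integrable_cst_probability P 1.
  transitivity (\int[P]_w ((2 / h n ^+ 2) * (1 - cos (h n * X w)))).
    by apply: eq_Rintegral => w _; rewrite /f mulrAC.
  rewrite RintegralZl//; last exact: integrableB_real.
  rewrite RintegralB// Rintegral_cst_probability.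
  have := cosX (h n) 0; rewrite cos0 mulr1 => <-.
  by under [X in _ = 2 * (1 - X) / _]eq_Rintegral do rewrite addr0; rewrite mulrAC.
have lim2 : \int[P]_w f n (X w) @[n --> \oo] --> s ^+ 2.
  apply: (@cvg_dist_le_scale _ _ _ (s ^+ 4 / 2)) => e e0.
  have /cvgrPdist_le/(_ e e0) := hcvg; apply: filterS => n; rewrite sub0r normrN gtr0_norm// => hn.
  have u0 : 0 <= s ^+ 2 * h n ^+ 2 / 2 by rewrite divr_ge0// mulr_ge0 ?sqr_ge0.
  have H := expR_sub_le u0.
  rewrite fE; set E := expR _ in H *.
  have -> : 2 * (1 - E) / h n ^+ 2 - s ^+ 2 = - (2 / h n ^+ 2 * (E - (1 - s ^+ 2 * h n ^+ 2 / 2))).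
    by field; rewrite gt_eqF.
  rewrite normrN normrM ger0_norm; last by rewrite divr_ge0// sqr_ge0.
  apply: (@le_trans _ _ (2 / h n ^+ 2 * (s ^+ 2 * h n ^+ 2 / 2) ^+ 2)).
    by rewrite ler_wpM2l// divr_ge0// sqr_ge0.
  rewrite [leLHS](_ : _ = h n ^+ 2 * (s ^+ 4 / 2)); last by field; rewrite gt_eqF.
  rewrite ler_wpM2r ?divr_ge0 ?exprn_even_ge0//.
  by rewrite (le_trans _ hn)// expr2 ler_piMr// ltW.
exact: (cvg_unique _ lim1 lim2).
Qed.

Lemma centered_gaussian_of_cos (Y : T -> R) V : measurable_fun setT Y -> 0 <= V ->
  (forall z c, \int[P]_w cos (z * Y w + c) = expR (- (V * z ^+ 2 / 2)) * cos c) ->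
  centered_gaussian P Y.
Proof.
move=> mY V0 YV; split => //; exists (Num.sqrt V) => A mA.
set s := Num.sqrt V.
have Vs : s ^+ 2 = V by rewrite sqr_sqrtr.
(* The comparison variable is the identity of the line under the target law, Dirac or normal. *)
have mid : measurable_fun setT (id : R -> R) by [].
have [s0|s0] := eqVneq s 0.
  pose Q : probability R R := dirac (0 : R).
  apply: (@law_of_cos _ _ _ P _ _ Q Y id mY mid _ A mA) => z c.
  rewrite YV -Vs; symmetry; apply: Rintegral_cos_centered_gaussian => // B mB.
  by rewrite s0 eqxx.
pose Q : probability (measurableTypeR R) R := normal_prob 0 s.
apply: (@law_of_cos _ _ _ P _ _ Q Y id mY mid _ A mA) => z c.
rewrite YV -Vs; symmetry; apply: Rintegral_cos_centered_gaussian => // B mB.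
by rewrite (negbTE s0).
Qed.

End gaussian_variance.

(** * Schwartz functions and linearity of tempered functionals *)

Section schwartz_functions.
Variable R : realType.

Lemma schwartz_bounded (phi : R -> R) : schwartz phi -> bounded_real phi.
Proof.
move=> [_ /(_ 0%N 0%N)[M HM]]; exists M => x.
by have := HM x; rewrite expr0 mul1r derive1n0.
Qed.

Lemma schwartz_continuous (phi : R -> R) : schwartz phi -> continuous phi.
Proof.
move=> [H _] x; apply: differentiable_continuous; apply/derivable1_diffP.
by have := H 0%N x; rewrite derive1n0.
Qed.

Lemma schwartz_measurable (phi : R -> R) : schwartz phi -> measurable_fun setT phi.
Proof. by move=> /schwartz_continuous; exact: continuous_measurable_fun. Qed.

Let derive1n_comb a (phi psi : R -> R) n :
  (forall n x, derivable (derive1n n phi) x 1) -> (forall n x, derivable (derive1n n psi) x 1) ->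
  derive1n n (fun x => a * phi x + psi x) = fun x => a * derive1n n phi x + derive1n n psi x.
Proof.
move=> dphi dpsi; elim: n => [|n IH]; first by rewrite !derive1n0.
rewrite !derive1nS IH; apply/funext => x; rewrite !derive1E.
exact: (@derive_val _ _ _ _ _ _ _ (is_deriveD (is_deriveZ a (derivableP (dphi n x)))
  (derivableP (dpsi n x)))).
Qed.

Lemma schwartz_comb a (phi psi : R -> R) : schwartz phi -> schwartz psi ->
  schwartz (fun x => a * phi x + psi x).
Proof.
move=> [dphi bphi] [dpsi bpsi]; split => [n x|m n].
  rewrite derive1n_comb//.
  exact: (@ex_derive _ _ _ _ _ _ _ (is_deriveD (is_deriveZ a (derivableP (dphi n x)))
    (derivableP (dpsi n x)))).
have [M HM] := bphi m n; have [N HN] := bpsi m n.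
exists (`|a| * M + N) => x; rewrite derive1n_comb// mulrDr mulrCA.
by rewrite (le_trans (ler_normD _ _))// lerD// normrM ler_wpM2l.
Qed.

Lemma schwartz0 : schwartz (fun=> 0 : R).
Proof.
have D0 n : derive1n n (fun=> 0 : R) = (fun=> 0 : R).
  by elim: n => [|n IH]; rewrite ?derive1n0// derive1nS IH; apply/funext => x; exact: derive1_cst.
split => [n x|m n]; first by rewrite D0; exact: derivable_cst.
by exists 0 => x; rewrite D0 mulr0 normr0.
Qed.

Lemma schwartz_sum (n : nat) (a : 'I_n -> R) (phi : 'I_n -> R -> R) :
  (forall i, schwartz (phi i)) -> schwartz (fun x => \sum_i a i * phi i x).
Proof.
elim: n a phi => [|n IH] a phi sphi.
  by under eq_fun do rewrite big_ord0; exact: schwartz0.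
by under eq_fun do rewrite big_ord_recl; apply: schwartz_comb => //; exact: IH.
Qed.

Lemma tempered_sum (u : (R -> R) -> R) (n : nat) (a : 'I_n -> R) (phi : 'I_n -> R -> R) :
  tempered u -> (forall i, schwartz (phi i)) ->
  u (fun x => \sum_i a i * phi i x) = \sum_i a i * u (phi i).
Proof.
move=> [ulin _]; elim: n a phi => [|n IH] a phi sphi.
  under eq_fun do rewrite big_ord0; rewrite big_ord0.
  (* The combination is again the zero function, and the coefficient -1 makes the right-hand side
     cancel, so [u] vanishes at zero. *)
  have := ulin (-1) _ _ schwartz0 schwartz0.
  by rewrite mulr0 addr0 mulN1r addNr.
under eq_fun do rewrite big_ord_recl; rewrite big_ord_recl ulin//; last exact: schwartz_sum.
by rewrite IH.
Qed.

End schwartz_functions.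

Lemma Rintegral_comb_sqr d (T : measurableType d) (R : realType)
    (mu : {measure set T -> \bar R}) (m : nat) (a : 'I_m -> R) (Z : 'I_m -> T -> R) :
  (forall i, measurable_fun setT (Z i)) ->
  (forall i, mu.-integrable setT (EFin \o (fun w => Z i w ^+ 2))) ->
  \int[mu]_w ((\sum_i a i * Z i w) ^+ 2) =
  \sum_i \sum_j a i * a j * \int[mu]_w (Z i w * Z j w).
Proof.
move=> mZ iZ.
have iZZ i j := integrable_mul (mZ i) (mZ j) (iZ i) (iZ j).
transitivity (\int[mu]_w (\sum_i \sum_j a i * a j * (Z i w * Z j w))).
  apply: eq_Rintegral => w _; rewrite expr2 mulr_suml; apply: eq_bigr => i _.
  by rewrite mulr_sumr; apply: eq_bigr => j _; ring.
rewrite Rintegral_sum => [|i]; last by apply: integrable_sum_real => j; exact: integrableZ_real.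
apply: eq_bigr => i _; rewrite Rintegral_sum => [|j]; last exact: integrableZ_real.
by apply: eq_bigr => j _; rewrite RintegralZl.
Qed.

(** * Pairings of the Gaussian field with the test functions *)

Section gaussian_field.
Context d (Omega : measurableType d) (R : realType) (P : probability Omega R).
Variables (X : Omega -> (R -> R) -> R) (B : (R -> R) -> (R -> R) -> R).
Hypothesis hX : centered_gaussian_tempered P X.
Hypothesis hB : forall phi psi, schwartz phi -> schwartz psi ->
  'E_P[fun w => (X w phi * X w psi)%R]%E = (B phi psi)%:E.
Local Notation mu := (@lebesgue_measure R).

Let mX phi : schwartz phi -> measurable_fun setT (fun w => X w phi).
Proof. by move=> sphi; have [] := hX.2 phi sphi. Qed.

Let iX phi : schwartz phi -> P.-integrable setT (EFin \o (fun w => X w phi ^+ 2)).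
Proof.
move=> sphi; apply/integrableP; split.
  by apply/measurable_EFinP; apply: measurable_funX; exact: mX.
have := hB sphi sphi; rewrite unlock => E.
rewrite (_ : (\int[P]_w _)%E = (B phi phi)%:E) ?ltry// -E.
by apply: eq_integral => w _; rewrite abse_EFin ger0_norm ?sqr_ge0// expr2.
Qed.

Let BE phi psi : schwartz phi -> schwartz psi -> \int[P]_w (X w phi * X w psi) = B phi psi.
Proof. by move=> sphi spsi; have := hB sphi spsi; rewrite unlock /Rintegral => ->. Qed.

Variables (m : nat) (psi : 'I_m -> R -> R) (Y : 'I_m -> Omega -> R).
Hypothesis mY : forall i, measurable_fun setT (Y i).
Hypothesis hY : forall i, L2_pairing P X (psi i) (Y i).
Hypothesis Bcvg : forall i j (phi_ phi'_ : nat -> R -> R),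
  (forall k, schwartz (phi_ k)) -> (forall k, schwartz (phi'_ k)) ->
  sqr_cvg mu phi_ (psi i) -> sqr_cvg mu phi'_ (psi j) ->
  B (phi_ k) (phi'_ k) @[k --> \oo] --> B (psi i) (psi j).

Let approx : {phi : 'I_m -> nat -> R -> R | forall i,
  [/\ forall k, schwartz (phi i k), sqr_cvg mu (phi i) (psi i)
    & sqr_cvg P (fun k w => X w (phi i k)) (Y i)]}.
Proof.
apply/cid; have /choice[phi H] := hY; exists phi => i.
have [s c1 c2] := H i; split => //.
by move: c2; rewrite unlock.
Qed.

Let phi := projT1 approx.
Let sphi i k : schwartz (phi i k). Proof. by have [] := projT2 approx i. Qed.
Let phi_psi i : sqr_cvg mu (phi i) (psi i). Proof. by have [] := projT2 approx i. Qed.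
Let X_Y i : sqr_cvg P (fun k w => X w (phi i k)) (Y i).
Proof. by have [] := projT2 approx i. Qed.

Lemma integrable_pairing_sqr i : P.-integrable setT (EFin \o (fun w => Y i w ^+ 2)).
Proof.
exact: (sqr_cvg_integrable (fun k => mX (sphi i k)) (mY i) (X_Y i) (fun k => iX (sphi i k))).
Qed.

(** The covariances of the approximations converge to both sides: to the left by square mean
    convergence of the pairings, to the right by the continuity [Bcvg] of the covariance form. *)
Lemma Rintegral_pairing_mul i j : \int[P]_w (Y i w * Y j w) = B (psi i) (psi j).
Proof.
have c1 := sqr_cvg_mul (fun k => mX (sphi i k)) (mY i) (X_Y i) (integrable_pairing_sqr i)
  (fun k => mX (sphi j k)) (mY j) (X_Y j) (integrable_pairing_sqr j).
have c2 := Bcvg (sphi i) (sphi j) (phi_psi i) (phi_psi j).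
have E : (fun k => \int[P]_w (X w (phi i k) * X w (phi j k))) =
    (fun k => B (phi i k) (phi j k)) by apply/funext => k; rewrite BE.
rewrite E in c1; exact: (cvg_unique _ c1 c2).
Qed.

Section combination.
Variable a : 'I_m -> R.

Let V : R := \sum_i \sum_j a i * a j * B (psi i) (psi j).

Let mcomb (Z : 'I_m -> Omega -> R) : (forall i, measurable_fun setT (Z i)) ->
  measurable_fun setT (fun w => \sum_i a i * Z i w).
Proof. by move=> mZ; apply: measurable_sum => i; exact: measurable_funM. Qed.

Let V_cvg : (\sum_i \sum_j a i * a j * B (phi i k) (phi j k)) @[k --> \oo] --> V.
Proof.
apply: cvg_big => [|i _]; first exact: add_continuous.
apply: cvg_big => [|j _]; first exact: add_continuous.
by apply: cvgMr; exact: Bcvg.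
Qed.

Let XcombE k w : X w (fun x => \sum_i a i * phi i k x) = \sum_i a i * X w (phi i k).
Proof. by apply: tempered_sum => //; exact: hX.1. Qed.

Let V_k k : \int[P]_w (X w (fun x => \sum_i a i * phi i k x) ^+ 2) =
  \sum_i \sum_j a i * a j * B (phi i k) (phi j k).
Proof.
under eq_Rintegral do rewrite XcombE.
rewrite (@Rintegral_comb_sqr _ _ _ P _ a (fun i w => X w (phi i k))).
- by apply: eq_bigr => i _; apply: eq_bigr => j _; rewrite BE.
- by move=> i; exact: mX.
- by move=> i; exact: iX.
Qed.

Lemma pairing_variance_ge0 : 0 <= V.
Proof.
apply: (ler_cvg_to (cvg_cst 0) V_cvg); apply: nearW => k.
by rewrite -V_k; apply: Rintegral_ge0 => w _; exact: sqr_ge0.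
Qed.

(** Joint Gaussianity comes from linearity: a combination of the approximating pairings is the field
    at a single Schwartz function, hence a centered Gaussian variable. *)
Lemma pairing_comb_cos c :
  \int[P]_w cos (\sum_i a i * Y i w + c) = expR (- (V / 2)) * cos c.
Proof.
pose S k w := \sum_i a i * X w (phi i k).
have mS k : measurable_fun setT (S k) by apply: mcomb => i; exact: mX.
have mT : measurable_fun setT (fun w => \sum_i a i * Y i w) by exact: mcomb.
have Scos k : \int[P]_w cos (S k w + c) =
    expR (- ((\sum_i \sum_j a i * a j * B (phi i k) (phi j k)) / 2)) * cos c.
  have sk : schwartz (fun x => \sum_i a i * phi i k x) by exact: schwartz_sum.
  have := centered_gaussian_cos (hX.2 _ sk) (iX sk) 1 c.
  rewrite V_k expr1n mulr1 => <-; apply: eq_Rintegral => w _.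
  by rewrite mul1r XcombE.
have lim1 : \int[P]_w cos (S k w + c) @[k --> \oo] --> expR (- (V / 2)) * cos c.
  under eq_fun do rewrite Scos.
  apply: cvgMl; apply: continuous_cvg; first exact: continuous_expR.
  by apply: cvgN; apply: cvgMl; exact: V_cvg.
have lim2 : \int[P]_w cos (S k w + c) @[k --> \oo] --> \int[P]_w cos (\sum_i a i * Y i w + c).
  apply: (@cvg_dist_le_scale _ _ _ (\sum_(i < m) `|a i|)) => e e0.
  have : \forall k \near \oo, forall i,
      P.-integrable setT (EFin \o (fun w => (X w (phi i k) - Y i w) ^+ 2)) /\
      \int[P]_w ((X w (phi i k) - Y i w) ^+ 2) <= e ^+ 2.
    apply: filter_forall => i.
    apply: (sqr_cvg_near (fun k => mX (sphi i k)) (mY i) (X_Y i)).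
    exact: exprn_gt0.
  apply: filterS => k Hk.
  have mc (Z : Omega -> R) : measurable_fun setT Z -> measurable_fun setT (fun w => cos (Z w + c)).
    move=> mZ; apply: measurableT_comp; first exact: measurable_cos.
    exact: measurable_funD.
  have ic (Z : Omega -> R) : measurable_fun setT Z ->
      P.-integrable setT (EFin \o (fun w => cos (Z w + c))).
    by move=> mZ; exact: (bounded_integrable_probability P (mc _ mZ) (fun w => cos_max _)).
  rewrite -RintegralB//; [|exact: ic..].
  apply: (le_trans (le_normr_Rintegral measurableT (integrableB_real (ic _ (mS k)) (ic _ mT)))).
  have mD i : measurable_fun setT (fun w => X w (phi i k) - Y i w).
    by apply: measurable_funB => //; exact: mX.
  have iD i : P.-integrable setT (EFin \o (fun w => `|X w (phi i k) - Y i w|)).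
    apply: integrable_norm_real.
    apply: integrable_le (integrableD_real (integrable_cst_probability P 1) (proj1 (Hk i))) => // w.
    rewrite -(real_normK (num_real (X w (phi i k) - Y i w))) /=.
    by have := sqr_ge0 (`|X w (phi i k) - Y i w| - 1); have := normr_ge0 (X w (phi i k) - Y i w); nra.
  have iS : P.-integrable setT (EFin \o (fun w => \sum_i `|a i| * `|X w (phi i k) - Y i w|)).
    by apply: integrable_sum_real => i; exact: integrableZ_real.
  apply: (@le_trans _ _ (\int[P]_w (\sum_i `|a i| * `|X w (phi i k) - Y i w|))).
    apply: le_Rintegral => //; first exact/integrable_norm_real/integrableB_real/ic/mT/ic/mS.
    move=> w _; rewrite (le_trans (dist_cos _ _))// opprD addrACA subrr addr0 /S -sumrB.
    rewrite (le_trans (ler_norm_sum _ _ _))//; apply: ler_sum => i _.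
    by rewrite -mulrBr normrM.
  rewrite Rintegral_sum => [|i]; last exact: integrableZ_real.
  rewrite mulr_sumr; apply: ler_sum => i _; rewrite RintegralZl// mulrC ler_wpM2r//.
  have [i2 le2] := Hk i.
  (* Here |x| <= e / 2 + x^2 / (2 e) turns the square mean bound e^2 into the bound [e] for the
     first absolute moment. *)
  apply: (@le_trans _ _ (\int[P]_w (e / 2 + e^-1 / 2 * (X w (phi i k) - Y i w) ^+ 2))).
    apply: le_Rintegral => //.
      by apply: integrableD_real; [exact: integrable_cst_probability|exact: integrableZ_real].
    move=> w _; rewrite -(real_normK (num_real (X w (phi i k) - Y i w))).
    set x := `|_|; rewrite -subr_ge0 (_ : _ - _ = e^-1 / 2 * (x - e) ^+ 2).
      by rewrite mulr_ge0 ?sqr_ge0// divr_ge0// invr_ge0 ltW.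
    by field; rewrite gt_eqF.
  rewrite RintegralD//; [|exact: integrable_cst_probability|exact: integrableZ_real].
  rewrite Rintegral_cst_probability RintegralZl//.
  have : e^-1 * \int[P]_w ((X w (phi i k) - Y i w) ^+ 2) <= e.
    by rewrite ler_pdivrMl// -expr2.
  lra.
exact: (cvg_unique _ lim2 lim1).
Qed.

End combination.

Lemma pairing_comb_gaussian (a : 'I_m -> R) : centered_gaussian P (fun w => \sum_i a i * Y i w).
Proof.
apply: (centered_gaussian_of_cos (V := \sum_i \sum_j a i * a j * B (psi i) (psi j))).
- by apply: measurable_sum => i; exact: measurable_funM.
- exact: pairing_variance_ge0.
move=> z c; have := pairing_comb_cos (fun i => z * a i) c.
have -> : \sum_i \sum_j z * a i * (z * a j) * B (psi i) (psi j) =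
    (\sum_i \sum_j a i * a j * B (psi i) (psi j)) * z ^+ 2.
  rewrite mulr_suml; apply: eq_bigr => i _; rewrite mulr_suml; apply: eq_bigr => j _; ring.
move=> <-; apply: eq_Rintegral => w _; rewrite mulr_sumr.
by under eq_bigr do rewrite mulrA.
Qed.

End gaussian_field.

(** * Smoothing as a contraction in square mean; the limit covariance *)

Section square_mean_smoothing.
Context d (Omega : measurableType d) (R : realType) (P : probability Omega R).
Variable X : Omega -> R.
Hypothesis mX : measurable_fun setT X.
Local Notation mu := (@lebesgue_measure R).
Local Notation G := (mean_shift P X).

Let iG (f : R -> R) M x : measurable_fun setT f -> (forall y, `|f y| <= M) ->
  P.-integrable setT (EFin \o (fun w => f (x + X w))).
Proof. by move=> mf fM; exact: (@integrable_shift _ _ _ P X mX f M x mf fM). Qed.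

Let sqr_bound (f : R -> R) M : (forall y, `|f y| <= M) -> forall y, `|f y ^+ 2| <= M ^+ 2.
Proof. by move=> fM y; rewrite normrX lerXn2r ?nnegrE// (le_trans (normr_ge0 _) (fM y)). Qed.

(** This is the nonnegativity of the variance of f(x + X). *)
Lemma mean_shift_sqr_le (f : R -> R) M x : measurable_fun setT f -> (forall y, `|f y| <= M) ->
  G f x ^+ 2 <= G (fun y => f y ^+ 2) x.
Proof.
move=> mf fM; have i1 := iG x mf fM.
have mf2 : measurable_fun setT (fun y => f y ^+ 2) by exact: measurable_funX.
have i2 := iG x mf2 (sqr_bound fM).
have iZ := integrableZ_real (2 * G f x) i1.
have iC := integrable_cst_probability P (G f x ^+ 2).
have : 0 <= \int[P]_w ((f (x + X w) - G f x) ^+ 2).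
  by apply: Rintegral_ge0 => w _; exact: sqr_ge0.
rewrite (_ : \int[P]_w _ = \int[P]_w (f (x + X w) ^+ 2 - 2 * G f x * f (x + X w) + G f x ^+ 2)).
  rewrite RintegralD//; last exact: integrableB_real.
  rewrite RintegralB// RintegralZl// Rintegral_cst_probability -!/(mean_shift _ _ _ _).
  rewrite -/(G (fun y => f y ^+ 2) x) -/(G f x).
  by nra.
by apply: eq_Rintegral => w _; ring.
Qed.

Lemma integrable_mean_shift_sqr (f : R -> R) M : measurable_fun setT f ->
  (forall y, `|f y| <= M) -> mu.-integrable setT (EFin \o (fun x => f x ^+ 2)) ->
  mu.-integrable setT (EFin \o (fun x => G f x ^+ 2)).
Proof.
move=> mf fM if2.
have mf2 : measurable_fun setT (fun y => f y ^+ 2) by exact: measurable_funX.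
apply: integrable_le (integrable_mean_shift P mX mf2 (sqr_bound fM) if2).
  by apply: measurable_funX; exact: (measurable_mean_shift P mX mf fM).
by move=> x; rewrite ger0_norm ?sqr_ge0//; exact: mean_shift_sqr_le.
Qed.

(** The pointwise inequality is integrated, and smoothing preserves the integral of the square; if
    that integral is infinite there is nothing to prove. *)
Lemma mean_shift_contraction (f : R -> R) M : measurable_fun setT f ->
  (forall y, `|f y| <= M) ->
  (\int[mu]_x (G f x ^+ 2)%:E <= \int[mu]_x (f x ^+ 2)%:E)%E.
Proof.
move=> mf fM.
have mf2 : measurable_fun setT (fun y => f y ^+ 2) by exact: measurable_funX.
have [fin|] := ltP (\int[mu]_x (f x ^+ 2)%:E)%E +oo%E; last first.
  by rewrite leye_eq => /eqP ->; exact: leey.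
have if2 : mu.-integrable setT (EFin \o (fun x => f x ^+ 2)).
  apply/integrableP; split; first exact/measurable_EFinP.
  by under eq_integral => x _ do rewrite [X in `|X|%E]/= abse_EFin ger0_norm ?sqr_ge0//.
have iGf2 := integrable_mean_shift_sqr mf fM if2.
rewrite -!EFin_Rintegral// lee_fin.
rewrite -(Rintegral_mean_shift P mX mf2 (sqr_bound fM) if2).
apply: le_Rintegral => //; first exact: (integrable_mean_shift P mX mf2 (sqr_bound fM) if2).
by move=> x _; exact: mean_shift_sqr_le.
Qed.

Lemma mean_shiftB (f g : R -> R) M N x : measurable_fun setT f -> (forall y, `|f y| <= M) ->
  measurable_fun setT g -> (forall y, `|g y| <= N) ->
  G (fun y => f y - g y) x = G f x - G g x.
Proof.
by move=> mf fM mg gN; rewrite /mean_shift RintegralB//; [exact: iG mf fM|exact: iG mg gN].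
Qed.

Lemma mean_shift_comb (m : nat) (a : 'I_m -> R) (f : 'I_m -> R -> R) M x :
  (forall i, measurable_fun setT (f i)) -> (forall i y, `|f i y| <= M) ->
  G (fun y => \sum_i a i * f i y) x = \sum_i a i * G (f i) x.
Proof.
move=> mf fM; rewrite /mean_shift Rintegral_sum => [|i].
  by apply: eq_bigr => i _; rewrite RintegralZl//; exact: iG (mf i) (fM i).
exact: (integrableZ_real _ (iG x (mf i) (fM i))).
Qed.

Lemma sqr_cvg_mean_shift (f_ : nat -> R -> R) (f : R -> R) M :
  (forall k, measurable_fun setT (f_ k)) -> (forall k, bounded_real (f_ k)) ->
  measurable_fun setT f -> (forall y, `|f y| <= M) ->
  sqr_cvg mu f_ f -> sqr_cvg mu (fun k => G (f_ k)) (G f).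
Proof.
move=> mf_ bf_ mf fM; rewrite /sqr_cvg => H.
apply: (squeeze_cvge _ (cvg_cst 0%E) H); apply: nearW => k; apply/andP; split.
  by apply: integral_ge0 => x _; rewrite lee_fin sqr_ge0.
have [N fN] := bf_ k.
under eq_integral => x _ do rewrite -(mean_shiftB x (mf_ k) fN mf fM).
apply: (@mean_shift_contraction (fun y => f_ k y - f y) (N + M)).
  exact: measurable_funB.
by move=> y; rewrite (le_trans (ler_normB _ _))// lerD.
Qed.

Variables m1 c : R.

Definition limit_covariance (phi psi : R -> R) : R :=
  m1 * \int[mu]_x (phi x * psi x) + c * \int[mu]_x (G phi x * G psi x).

Lemma limit_covariance_cvg (f g : R -> R) M (f_ g_ : nat -> R -> R) :
  measurable_fun setT f -> (forall y, `|f y| <= M) ->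
  mu.-integrable setT (EFin \o (fun x => f x ^+ 2)) ->
  measurable_fun setT g -> (forall y, `|g y| <= M) ->
  mu.-integrable setT (EFin \o (fun x => g x ^+ 2)) ->
  (forall k, schwartz (f_ k)) -> (forall k, schwartz (g_ k)) ->
  sqr_cvg mu f_ f -> sqr_cvg mu g_ g ->
  limit_covariance (f_ k) (g_ k) @[k --> \oo] --> limit_covariance f g.
Proof.
move=> mf fM if2 mg gM ig2 sf sg cf cg.
have mf_ k := schwartz_measurable (sf k).
have mg_ k := schwartz_measurable (sg k).
have mGs h : schwartz h -> measurable_fun setT (G h).
  by move=> sh; have [N hN] := schwartz_bounded sh;
    exact: (measurable_mean_shift P mX (schwartz_measurable sh) hN).
apply: cvgD; apply: cvgMr.
  exact: (@sqr_cvg_mul _ _ _ mu f_ g_ f g mf_ mf cf if2 mg_ mg cg ig2).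
apply: (@sqr_cvg_mul _ _ _ mu (fun k => G (f_ k)) (fun k => G (g_ k)) (G f) (G g)).
- by move=> k; exact: mGs.
- exact: (measurable_mean_shift P mX mf fM).
- by apply: (sqr_cvg_mean_shift mf_ _ mf fM cf) => k; exact: schwartz_bounded.
- exact: (integrable_mean_shift_sqr mf fM if2).
- by move=> k; exact: mGs.
- exact: (measurable_mean_shift P mX mg gM).
- by apply: (sqr_cvg_mean_shift mg_ _ mg gM cg) => k; exact: schwartz_bounded.
- exact: (integrable_mean_shift_sqr mg gM ig2).
Qed.

(** Smoothing preserves the integral of the square of [phi], so the limiting variance becomes a
    quadratic form in the coefficients, the same as on the side of the Gaussian field. *)
Lemma limit_covariance_comb (m : nat) (a : 'I_m -> R) (f : 'I_m -> R -> R) M :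
  (forall i, measurable_fun setT (f i)) -> (forall i y, `|f i y| <= M) ->
  (forall i, mu.-integrable setT (EFin \o (fun x => f i x ^+ 2))) ->
  let phi := fun y => \sum_i a i * f i y in
  mu.-integrable setT (EFin \o (fun x => phi x ^+ 2)) ->
  \int[mu]_x (m1 * G (fun y => phi y ^+ 2) x + c * G phi x ^+ 2) =
  \sum_i \sum_j a i * a j * limit_covariance (f i) (f j).
Proof.
move=> mf fM if2 phi ip2.
have mphi : measurable_fun setT phi by apply: measurable_sum => i; exact: measurable_funM.
have phiM y : `|phi y| <= \sum_i `|a i| * M.
  rewrite (le_trans (ler_norm_sum _ _ _))//; apply: ler_sum => i _.
  by rewrite normrM ler_wpM2l.
have mphi2 : measurable_fun setT (fun y => phi y ^+ 2) by exact: measurable_funX.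
have iG1 := integrable_mean_shift P mX mphi2 (sqr_bound phiM) ip2.
have iG2 := integrable_mean_shift_sqr mphi phiM ip2.
have mGf i : measurable_fun setT (G (f i)) by exact: (measurable_mean_shift P mX (mf i) (fM i)).
have iGf i := integrable_mean_shift_sqr (mf i) (fM i) (if2 i).
rewrite RintegralD//; [|exact: integrableZ_real..].
rewrite !RintegralZl// (Rintegral_mean_shift P mX mphi2 (sqr_bound phiM) ip2).
rewrite (@Rintegral_comb_sqr _ _ _ mu _ a f mf if2).
have -> : \int[mu]_x (G phi x ^+ 2) = \int[mu]_x ((\sum_i a i * G (f i) x) ^+ 2).
  by apply: eq_Rintegral => x _; rewrite /phi (mean_shift_comb a x mf fM).
rewrite (@Rintegral_comb_sqr _ _ _ mu _ a (fun i => G (f i)) mGf iGf).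
rewrite !mulr_sumr -big_split; apply: eq_bigr => i _.
rewrite !mulr_sumr -big_split; apply: eq_bigr => j _.
by rewrite /limit_covariance /=; ring.
Qed.

End square_mean_smoothing.

Lemma integrable_compact_sqr (R : realType) (f : R -> R) M K : measurable_fun setT f ->
  (forall y, `|f y| <= M) -> (forall y, K < `|y| -> f y = 0) ->
  (@lebesgue_measure R).-integrable setT (EFin \o (fun x => f x ^+ 2)).
Proof.
move=> mf fM fK.
apply: integrable_le (integrableZ_real (M ^+ 2) (integrable_window K)) => [|x].
  exact: measurable_funX.
rewrite ger0_norm ?sqr_ge0// indicE.
have [Kx|xK] := ltP K `|x|; first by rewrite fK// expr0n/= mulr_ge0 ?sqr_ge0.
rewrite mem_set; last by rewrite /= in_itv/= -ler_norml (le_trans xK)// lerDl.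
by rewrite mulr1 -real_normK ?num_real// lerXn2r ?nnegrE// (le_trans (normr_ge0 _) (fM x)).
Qed.

(** * Cosine integrals and tightness along a sequence of scales *)

Section limit_theorem.
Context d (Omega : measurableType d) (R : realType) (P : probability Omega R).
Variables (theta : int -> {RV P >-> nat})
  (rho : int -> forall k : nat, 'I_k -> {RV P >-> R})
  (vartheta : int -> nat -> R -> {RV P >-> R}) (X : {RV P >-> R}) (m : nat -> R) (p : R -> R).
Hypothesis hrho : forall (j : int) (k : nat) (i : 'I_k) (w : Omega),
  j%:~R <= rho j i w < (j + 1)%:~R.
Hypothesis hcells : mutual_indep P (sigma_cell theta rho).
Hypothesis hmotions : independent_motions theta rho vartheta.
Hypothesis hlaw : forall j n A, measurable A ->
  P (vartheta j n 1 @^-1` A) = P (X @^-1` A).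
Hypothesis theta3 : forall j,
  P.-integrable setT (EFin \o (fun w => (theta j w)%:R ^+ 3 : R)).
Hypothesis theta_moment : forall j k, \int[P]_w ((theta j w)%:R ^+ k) = m k.
Hypothesis mp : measurable_fun setT p.
Hypothesis Xp : forall A : set R, measurable A ->
  P (X @^-1` A) = (\int[lebesgue_measure]_(x in A) (p x)%:E)%E.
Local Notation G := (mean_shift P X).
Local Notation mu := (@lebesgue_measure R).
Local Notation pairing_XT := (pairing_XT theta rho vartheta).
Local Notation B := (limit_covariance P X (m 1) (m 2 - m 1 - m 1 ^+ 2)).

Let mX : measurable_fun setT X. Proof. by []. Qed.

Variable u : nat -> R.
Hypotheses (u1 : forall k, 1 <= u k) (uoo : u k @[k --> \oo] --> +oo%R).

Lemma pairing_XT_cos_cvg (f : R -> R) M K c : countably_discontinuous f ->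
  (forall y, `|f y| <= M) -> (forall y, K < `|y| -> f y = 0) ->
  \int[P]_w cos (pairing_XT (u k) 1 f w + c) @[k --> \oo] -->
  expR (- ((\int[mu]_x (m 1 * G (fun y => f y ^+ 2) x
     + (m 2 - m 1 - m 1 ^+ 2) * G f x ^+ 2)) / 2)) * cos c.
Proof.
move=> cdf fM fK.
have mf := measurable_countably_discontinuous cdf.
have cG := continuous_mean_shift mX mp Xp cdf fM.
have f2M y : `|f y ^+ 2| <= M ^+ 2.
  by rewrite normrX lerXn2r ?nnegrE// (le_trans (normr_ge0 _) (fM y)).
have cG2 := continuous_mean_shift mX mp Xp (countably_discontinuous_sqr cdf) f2M.
have V := cell_var_integral_cvg hrho hcells hmotions hlaw theta3 theta_moment mf fM fK
  cG cG2 u1 uoo.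
have cE : expR (- ((\int[mu]_x cell_var theta rho vartheta f (u k) (Num.floor (u k * x))) / 2))
    * cos c @[k --> \oo] --> expR (- ((\int[mu]_x (m 1 * G (fun y => f y ^+ 2) x
     + (m 2 - m 1 - m 1 ^+ 2) * G f x ^+ 2)) / 2)) * cos c.
  apply: cvgMl; apply: continuous_cvg; first exact: continuous_expR.
  by apply: cvgN; apply: cvgMl; exact: V.
have c0 : \int[P]_w cos (pairing_XT (u k) 1 f w + c) -
    expR (- ((\int[mu]_x cell_var theta rho vartheta f (u k) (Num.floor (u k * x))) / 2))
    * cos c @[k --> \oo] --> 0.
  apply: (@cvg_dist_le_scale _ _ _
    ((8 * M ^+ 3 * (m 3 + m 1 ^+ 3) + (M ^+ 2 * m 2) ^+ 2) * window_mass K)) => e e0.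
  have m0 k : 0 <= m k by exact: (moment_ge0 theta_moment).
  have M0 : 0 <= M by exact: le_trans (normr_ge0 _) (fM 0).
  (* Once the scale exceeds e^-2, its inverse square root, the rate of the Lindeberg error, is at
     most [e]. *)
  have /cvgryPge/(_ (e ^- 2)) := uoo; apply: filterS => k uk.
  rewrite subr0.
  apply: (le_trans (pairing_XT_cos hrho hcells hmotions hlaw theta3 theta_moment mf fM fK (u1 k) c)).
  apply: ler_wpM2r.
    by rewrite mulr_ge0 ?window_mass_ge0// addr_ge0 ?sqr_ge0// !mulr_ge0 ?exprn_ge0// addr_ge0 ?exprn_ge0.
  rewrite invf_ple ?posrE// ?sqrtr_gt0 ?(lt_le_trans _ (u1 k))//.
  rewrite -[leLHS]ger0_norm; last by rewrite invr_ge0 ltW.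
  by rewrite -sqrtr_sqr; apply: ler_wsqrtr; rewrite exprVn.
have := cvgD c0 cE; rewrite add0r.
rewrite [X in X x @[x --> _]](_ : _ = fun k => \int[P]_w cos (pairing_XT (u k) 1 f w + c)).
  by apply.
by apply/funext => k; exact: subrK.
Qed.

Variables (n : nat) (psi : 'I_n -> R -> R) (M K : R).
Hypothesis psi_cd : forall i, countably_discontinuous (psi i).
Hypotheses (psiM : forall i y, `|psi i y| <= M) (psiK : forall i y, K < `|y| -> psi i y = 0).

Let mpsi i := measurable_countably_discontinuous (psi_cd i).

Lemma pairing_XT_comb_cos_cvg (b : 'I_n -> R) c :
  \int[P]_w cos (\sum_i b i * pairing_XT (u k) 1 (psi i) w + c) @[k --> \oo] -->
  expR (- ((\sum_i \sum_j b i * b j * B (psi i) (psi j)) / 2)) * cos c.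
Proof.
pose f y := \sum_i b i * psi i y.
have fM y : `|f y| <= \sum_i `|b i| * M.
  rewrite (le_trans (ler_norm_sum _ _ _))//; apply: ler_sum => i _.
  by rewrite normrM ler_wpM2l.
have fK y : K < `|y| -> f y = 0 by move=> Ky; rewrite /f big1// => i _; rewrite psiK ?mulr0.
have cdf : countably_discontinuous f by exact: countably_discontinuous_comb.
have mf := measurable_countably_discontinuous cdf.
rewrite -(@limit_covariance_comb _ _ _ P X mX _ _ n b psi M mpsi psiM
  (fun i => integrable_compact_sqr (mpsi i) (psiM i) (psiK i)) (integrable_compact_sqr mf fM fK)).
have H := pairing_XT_cos_cvg (c := c) cdf fM fK.
rewrite (_ : (fun k => _) = fun k => \int[P]_w cos (pairing_XT (u k) 1 f w + c))//.
apply/funext => k; rewrite /Rintegral; congr fine; apply: ae_eq_integral => //.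
- apply/measurable_EFinP; apply: measurableT_comp; first exact: measurable_cos.
  apply: measurable_funD => //; apply: measurable_sum => i; apply: measurable_funM => //.
  exact: measurable_pairing_XT.
- apply/measurable_EFinP; apply: measurableT_comp; first exact: measurable_cos.
  by apply: measurable_funD => //; exact: measurable_pairing_XT.
have := ae_pairing_XT_comb hrho hcells hmotions hlaw theta3 theta_moment b mpsi psiM psiK (u1 k).
by apply: filterS => w -> _.
Qed.

Lemma pairing_XT_tight e : 0 < e -> exists2 L, 0 < L &
  forall k i, (P [set w | (L < `|pairing_XT (u k) 1 (psi i) w|)%R] <= e%:E)%E.
Proof.
move=> e0; pose C := M ^+ 2 * m 2 * window_mass K.
have C0 : 0 <= C.
  rewrite mulr_ge0 ?window_mass_ge0// mulr_ge0 ?sqr_ge0//.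
  exact: (moment_ge0 theta_moment).
(* Chebyshev then gives e C / (C + 1); the added 1 keeps the level positive when [C] is 0. *)
exists (Num.sqrt ((C + 1) / e)).
  by rewrite sqrtr_gt0 divr_gt0// ltr_wpDl.
move=> k i.
apply: (le_trans (pairing_XT_tail hrho hcells hmotions hlaw theta3 theta_moment
  (mpsi i) (psiM i) (psiK i) (u1 k) _)).
  by rewrite sqrtr_gt0 divr_gt0// ltr_wpDl.
have q0 : 0 < (C + 1) / e by rewrite divr_gt0// ltr_wpDl.
rewrite lee_fin sqr_sqrtr; last exact: ltW.
rewrite -/C ler_pdivrMl// mulrAC -mulrA divff ?gt_eqF//.
by rewrite mulr1 lerDl.
Qed.

End limit_theorem.

(** * Finite dimensional convergence and the covariance of the limit *)

Theorem proposition2p3 (R : realType) (alpha : R)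
  (halpha : 0 < alpha <= 2)
  (d0 : measure_display) (Omega0 : measurableType d0)
  (P0 : probability Omega0 R) (theta0 : {RV P0 >-> nat})
  (htheta0 : ('E_P0[fun w => ((theta0 w)%:R ^+ 3)%R] < +oo)%E)
  (d : measure_display) (Omega : measurableType d) (P : probability Omega R)
  (theta : int -> {RV P >-> nat})
  (rho : int -> forall k : nat, 'I_k -> {RV P >-> R})
  (vartheta : int -> nat -> R -> {RV P >-> R})
  (htheta : forall (j : int) (A : set nat), measurable A ->
     distribution P (theta j) A = distribution P0 theta0 A)
  (hrho : forall (j : int) (k : nat) (i : 'I_k) (w : Omega),
     j%:~R <= rho j k i w < (j + 1)%:~R)
  (hcells : mutual_indep P (sigma_cell theta rho))
  (hstable : forall (j : int) (n : nat),
     standard_stable_process alpha (vartheta j n))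
  (hmotions : independent_motions theta rho vartheta)
  (p : R -> R -> R)
  (hp : forall (j : int) (n : nat), transition_density (vartheta j n) p)
  (d' : measure_display) (Omega' : measurableType d')
  (P' : probability Omega' R) (X1 : Omega' -> (R -> R) -> R)
  (hX1 : centered_gaussian_tempered P' X1)
  (hX1cov : forall phi psi : R -> R, schwartz phi -> schwartz psi ->
     'E_P'[fun w => (X1 w phi * X1 w psi)%R]%E =
     (fine 'E_P0[fun w => (theta0 w)%:R%R]%E
        * \int[lebesgue_measure]_x (phi x * psi x)
      + (fine 'V_P0[fun w => (theta0 w)%:R%R]%E
           - fine 'E_P0[fun w => (theta0 w)%:R%R]%E)
        * \int[lebesgue_measure]_x
            (stable_semigroup p 1 phi x * stable_semigroup p 1 psi x))%:E)
  (psi : R -> R -> R)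
  (hpsi : forall t : R, 0 <= t ->
     [/\ bounded_real (psi t), piecewise_continuous (psi t)
       & compact_support (psi t)])
  (varrho : R -> {RV P' >-> R})
  (hvarrho : forall t : R, 0 <= t -> L2_pairing P' X1 (psi t) (varrho t)) :
  [/\ cvg_fdd P P'
        (fun T t => pairing_XT theta rho vartheta T 1 (psi t))
        (fun t => varrho t),
      centered_gaussian_process varrho
    & forall s t : R, 0 <= s -> 0 <= t ->
        'E_P'[fun w => (varrho s w * varrho t w)%R]%E =
        (fine 'E_P0[fun w => (theta0 w)%:R%R]%E
           * \int[lebesgue_measure]_x (psi s x * psi t x)
         + (fine 'V_P0[fun w => (theta0 w)%:R%R]%E
              - fine 'E_P0[fun w => (theta0 w)%:R%R]%E)
           * \int[lebesgue_measure]_x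
               (psi s x * stable_semigroup p 2 (psi t) x))%:E].
Proof.
(* All motions have the same law at time 1; the first particle of cell 0 serves as reference. *)
pose X := vartheta 0 0%N 1.
pose m k : R := \int[P0]_w ((theta0 w)%:R ^+ k).
have hlaw j n A : measurable A -> P (vartheta j n 1 @^-1` A) = P (X @^-1` A).
  by move=> mA; exact: (stable_same_law (hstable j n) (hstable 0 0%N)).
have theta_moment j k : \int[P]_w ((theta j w)%:R ^+ k) = m k.
  exact: (count_moment (htheta j)).
have theta3 j := integrable_count_cube_law htheta0 (htheta j).
have mX : measurable_fun setT X by [].
have [mp _ Xp] := hp 0 0%N 1 ltr01.
pose c := m 2 - m 1 - m 1 ^+ 2.
pose B := limit_covariance P X (m 1) c.
have cE : fine 'V_P0[fun w => (theta0 w)%:R%R]%E - fine 'E_P0[fun w => (theta0 w)%:R%R]%E = c.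
  by rewrite count_variance// count_mean// /c -!/(m _); ring.
have mE : fine 'E_P0[fun w => (theta0 w)%:R%R]%E = m 1 by rewrite count_mean.
have T1E phi : schwartz phi -> stable_semigroup p 1 phi = mean_shift P X phi.
  move=> sphi; have [M phiM] := schwartz_bounded sphi.
  exact: (stable_semigroupE (hstable 0 0%N) (hp 0 0%N) ltr01 (schwartz_measurable sphi) phiM).
have hB phi chi : schwartz phi -> schwartz chi ->
    'E_P'[fun w => (X1 w phi * X1 w chi)%R]%E = (B phi chi)%:E.
  by move=> sphi schi; rewrite hX1cov// cE mE !T1E.
(* Finitely many test functions share one bound and one support radius; sums of absolute values
   serve in place of maxima. *)
have tests n (t : 'I_n -> R) : (forall i, 0 <= t i) -> exists M K,
    [/\ forall i, countably_discontinuous (psi (t i)), forall i y, `|psi (t i) y| <= M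
      & forall i y, K < `|y| -> psi (t i) y = 0].
  move=> t0.
  have /choice[MK MKP] i : exists MK : R * R, (forall y, `|psi (t i) y| <= MK.1) /\
      (forall y, MK.2 < `|y| -> psi (t i) y = 0).
    have [[M psiM] _ /compact_support_vanish[K _ psiK]] := hpsi _ (t0 i).
    by exists (M, K).
  have le_sum (F : 'I_n -> R) i : F i <= \sum_j `|F j|.
    rewrite (bigD1 i)//= (le_trans (ler_norm (F i)))// lerDl.
    by apply: sumr_ge0 => j _.
  exists (\sum_i `|(MK i).1|), (\sum_i `|(MK i).2|); split => [i|i y|i y Ky].
  - by have [_ /piecewise_continuous_countable] := hpsi _ (t0 i).
  - exact: le_trans ((MKP i).1 y) (le_sum (fun i => (MK i).1) i).
  - by apply: (MKP i).2; apply: le_lt_trans Ky; exact: (le_sum (fun i => (MK i).2) i).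
have Bcvg n (t : 'I_n -> R) : (forall i, 0 <= t i) -> forall i j (phi_ chi_ : nat -> R -> R),
    (forall k, schwartz (phi_ k)) -> (forall k, schwartz (chi_ k)) ->
    sqr_cvg (@lebesgue_measure R) phi_ (psi (t i)) ->
    sqr_cvg (@lebesgue_measure R) chi_ (psi (t j)) ->
    B (phi_ k) (chi_ k) @[k --> \oo] --> B (psi (t i)) (psi (t j)).
  move=> t0 i j phi_ chi_ sphi schi; have [M [K [cd psiM psiK]]] := tests n t t0.
  have mpsi i' := measurable_countably_discontinuous (cd i').
  exact: (limit_covariance_cvg mX (mpsi i) (psiM i)
    (integrable_compact_sqr (mpsi i) (psiM i) (psiK i)) (mpsi j) (psiM j)
    (integrable_compact_sqr (mpsi j) (psiM j) (psiK j)) sphi schi).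
have mvarrho t : measurable_fun setT (varrho t) by [].
split.
- move=> n t t0 f cf [C fC].
  have [M [K [cd psiM psiK]]] := tests n t t0.
  have fint d1 (U : measurableType d1) (Q : probability U R) (Z : 'I_n -> U -> R) :
      (forall i, measurable_fun setT (Z i)) ->
      Q.-integrable setT (EFin \o (fun w => f (\row_i Z i w))).
    move=> mZ; apply: (@bounded_integrable_probability _ _ _ _ _ C) => //.
    exact: (measurable_continuous_row mZ cf (ex_intro _ C fC)).
  apply/cvge_pinftyP => v voo.
  (* The limit is tested along an arbitrary sequence [v] tending to infinity. The estimates assume T
     >= 1, hence the truncation; [u] and [v] agree from some index on. *)
  pose u k := Num.max 1 (v k).
  have u1 k : 1 <= u k by rewrite /u le_max lexx.
  have uoo : u k @[k --> \oo] --> +oo%R.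
    apply/cvgryPge => A; have /cvgryPge/(_ A) := voo; apply: filterS => k Ak.
    by rewrite /u le_max Ak orbT.
  have mZ k i : measurable_fun setT (pairing_XT theta rho vartheta (u k) 1 (psi (t i))).
    exact: (measurable_pairing_XT theta rho vartheta (u k)
      (measurable_countably_discontinuous (cd i))).
  rewrite expectation_Rintegral; last exact: fint.
  have lim : \int[P]_w f (\row_i pairing_XT theta rho vartheta (u k) 1 (psi (t i)) w) @[k --> \oo]
      --> \int[P']_w f (\row_i varrho (t i) w).
    apply: (weak_cvg_of_cos mZ (fun i => mvarrho (t i))) => //; last by exists C.
    - exact: (pairing_XT_tight hrho hcells hmotions hlaw theta3 theta_moment u1 cd psiM psiK).
    - move=> b z.
      rewrite (pairing_comb_cos hX1 hB (fun i => mvarrho (t i)) (fun i => hvarrho _ (t0 i))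
        (Bcvg n t t0)).
      exact: (pairing_XT_comb_cos_cvg hrho hcells hmotions hlaw theta3 theta_moment mp Xp
        u1 uoo cd psiM psiK).
  apply: cvg_trans (cvg_EFin (nearW _ _) lim) => //; last first.
    by move=> k; exact: (integrable_fin_num measurableT (fint _ _ P _ (mZ k))).
  apply: near_eq_cvg; have /cvgryPge/(_ 1) := voo; apply: filterS => k vk.
  have -> : v k = u k by rewrite /u; apply/esym/max_idPr.
  by rewrite expectation.unlock.
- move=> n t a t0.
  exact: (pairing_comb_gaussian hX1 hB (fun i => mvarrho (t i)) (fun i => hvarrho _ (t0 i))
    (Bcvg n t t0) a).
move=> s t s0 t0.
(* The covariance is read off the two-point family, with indices [ord0] and [ord_max]. *)
pose r (i : 'I_2) := if i == ord0 then s else t.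
have r0 i : 0 <= r i by rewrite /r; case: ifP.
have iY := integrable_pairing_sqr hX1 hB (fun i => mvarrho (r i)) (fun i => hvarrho _ (r0 i)).
have [M [K [cd psiM psiK]]] := tests 2 r r0.
have mpsi i := measurable_countably_discontinuous (cd i).
rewrite expectation_Rintegral; last first.
  exact: (integrable_mul (mvarrho s) (mvarrho t) (iY ord0) (iY ord_max)).
congr EFin.
have := Rintegral_pairing_mul hX1 hB (fun i => mvarrho (r i)) (fun i => hvarrho _ (r0 i))
  (Bcvg 2 r r0) ord0 ord_max.
rewrite /r/= => ->; rewrite /B /limit_covariance cE mE; congr (_ + c * _).
(* Two particles of cell 0 supply the independent copies that the identity T_1 T_1 = T_2
   requires. *)
have XY := @independent_stable_motions _ _ _ P theta rho vartheta 0 0%N 1%N 1 hcells hmotions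
  ler01 isT.
have ipsi : (@lebesgue_measure R).-integrable setT (EFin \o psi s).
  apply: integrable_le (integrableZ_real M (integrable_window K)) => [|x].
    exact: (mpsi ord0).
  rewrite indicE; have [Kx|xK] := ltP K `|x|.
    by rewrite (psiK ord0 x Kx) normr0 mulr_ge0// (le_trans (normr_ge0 _) (psiM ord0 x)).
  rewrite mem_set ?mulr1; first exact: (psiM ord0).
  by rewrite /= in_itv/= -ler_norml (le_trans xK)// lerDl.
exact: (Rintegral_semigroup_mul (hstable 0 0%N) (hstable 0 1%N) (hp 0 0%N) XY
  (mpsi ord0) (psiM ord0) ipsi (mpsi ord_max) (psiM ord_max)).
Qed.
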